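(* Let $m,n\ge1$, $N=m+n$, let $\Psi\in C^2(\mathbb{G}(N,m),(0,\infty))$ satisfy (USAC) with constant $C>0$, let $p>m$, let $\Omega\subset\mathbb{R}^m$ be open and bounded, and let $u\in\mathrm{Lip}(\Omega,\mathbb{R}^n)$ be a map whose graph $\Gamma_u$ induces a varifold with $\Psi$-mean curvature $H$ in $L^p$ in $\Omega\times\mathbb{R}^n$. Put $k=2(1+\|u\|_{\mathrm{Lip}})$ and $H'(x):=H(x,u(x))$. Then there is a constant $C_2=C_2(n,m,\|\Psi\|_{C^2},C,\|u\|_{\mathrm{Lip}})>0$ such that $$\frac{1}{|B_r|}\int_{B_r(x_0)}\|Du(x)-A\|^2dx\le\frac{C_2}{r^2}\,\frac{1}{|B_{kr}|}\int_{B_{kr}(x_0)}\|u(x)-(u)_{x_0,kr}-A(x-x_0)\|^2dx+r^2C_2\,\frac{1}{|B_{kr}|}\int_{B_{kr}(x_0)}\|H'(x)\|^2dx$$ for all $A\in\mathbb{R}^{n\times m}$ with $\|A\|\le2\|Du\|_\infty$, all $x_0\in\Omega$ and all $r>0$ such that $B_{kr}(x_0)\subset\Omega$.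
   Context: Matrices carry the Frobenius inner product $\langle\cdot,\cdot\rangle$ and induced norm $\|\cdot\|$; $(\cdot,\cdot)$ is the Euclidean inner product. $\mathbb{G}(N,m)=\{P\in\mathbb{R}^{N\times N}: P=P^t,\ P^2=P,\ \mathrm{tr}(P)=m\}$; $T^\perp:=\mathrm{id}-T$. $\|u\|_{\mathrm{Lip}}$ is the Lipschitz constant of $u$, $B_R(z)$ is the ball in $\mathbb{R}^m$, $|B_R|$ is its volume, and $(f)_{z,R}:=\frac{1}{|B_R|}\int_{B_R(z)}f(y)\,dy$. For $\Psi\in C^1(\mathbb{G}(N,m))$, $D\Psi(T)$ denotes the differential (as a matrix) of any $C^1$ extension of $\Psi$ to a neighborhood of $\mathbb{G}(N,m)$ in $\mathbb{R}^{N\times N}$, $d\Psi(T):=D\Psi(T)+D\Psi(T)^t$, and $B_\Psi(T):=\Psi(T)T+T^\perp d\Psi(T)T$ (independent of the extension). The same definition is used on $\mathbb{G}(N,n)$. The dual function $\Psi^*:\mathbb{G}(N,n)\to\mathbb{R}$ is $\Psi^*(P):=\Psi(\mathrm{id}-P)$. (USAC) with constant $C$: $\langle B_\Psi(T),B_{\Psi^*}(S^\perp)\rangle\ge C\|T-S\|^2$ for all $T\ne S\in\mathbb{G}(N,m)$. The graph $\Gamma_u=\{(x,u(x)):x\in\Omega\}$ induces a multiplicity-one varifold with $\Psi$-mean curvature $H$ in $L^p$ in $U=\Omega\times\mathbb{R}^n$ if $H\in L^p(\Gamma_u\cap U,\mathbb{R}^N;\mathcal{H}^m\llcorner\Gamma_u)$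 and $\int_{\Gamma_u}\langle B_\Psi(T_z\Gamma_u),Dg(z)\rangle d\mathcal{H}^m(z)=-\int_{\Gamma_u}(H(z),g(z))d\mathcal{H}^m(z)$ for all $g\in C^1_c(U,\mathbb{R}^N)$, where $T_z\Gamma_u\in\mathbb{G}(N,m)$ is the approximate tangent plane. *)

(* Defs.v *)
From HB Require Import structures.
From mathcomp Require Import all_boot all_order all_algebra.
From mathcomp Require Import all_classical all_reals all_analysis ess_sup_inf.

Set Implicit Arguments.
Unset Strict Implicit.
Unset Printing Implicit Defensive.

Import Order.TTheory GRing.Theory Num.Theory.
Import numFieldNormedType.Exports.

Local Open Scope classical_set_scope.
Local Open Scope ring_scope.

(* The library norm on matrices is the maximum norm; it is used below only
   through the topology, differentiability and boundedness.  All metric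
   quantities use the Frobenius norm, which on columns is the Euclidean one. *)
Section euclidean.
Context {R : realType}.

Definition mxdot {a b} (A B : 'M[R]_(a, b)) : R := \tr (A^T *m B).

Definition frob {a b} (A : 'M[R]_(a, b)) : R := Num.sqrt (mxdot A A).

Definition eball {N} (z : 'cV[R]_N) (r : R) : set 'cV[R]_N :=
  [set x | frob (x - z) < r].

Definition ediam {N} (A : set 'cV[R]_N) : \bar R :=
  ereal_sup [set (frob (xy.1 - xy.2))%:E | xy in A `*` A].

End euclidean.

(* Outer measure generated by a cost function on arbitrary sets through
   countable covers; the empty set is always free. *)
Section cover_outer.
Local Open Scope ereal_scope.
Context {R : realType} {T : pointedType}.

Definition cost0 (c : set T -> \bar R) (A : set T) : \bar R :=
  if `[< A = set0 >] then 0 else c A.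

Definition cover_outer (c : set T -> \bar R) (A : set T) : \bar R :=
  ereal_inf [set \sum_(k <oo) cost0 c (F k) |
             F in [set F : (set T)^nat | A `<=` \bigcup_k F k]].

Definition all_sets : Type := T.
HB.instance Definition _ := Pointed.on all_sets.
HB.instance Definition _ := @isMeasurable.Build default_measure_display
  all_sets [set: set T] I (fun _ _ => I) (fun _ _ => I).

Lemma cover_outerE c : cover_outer c = @mu_ext _ all_sets R (cost0 c).
Proof.
apply/funext => A; rewrite /cover_outer /mu_ext; congr (ereal_inf (image _ _)).
by apply/seteqP; split => F /=; [split|case].
Qed.

Variable c : set T -> \bar R.
Hypothesis c_ge0 : forall A, 0 <= c A.

Let cost0_ge0 A : 0 <= cost0 c A.
Proof. by rewrite /cost0; case: ifP. Qed.

Let cost00 : cost0 c set0 = 0.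
Proof. by rewrite /cost0 asboolT. Qed.

Lemma cover_outer0 : cover_outer c set0 = 0.
Proof. by rewrite cover_outerE; exact: (@mu_ext0 _ all_sets). Qed.

Lemma cover_outer_ge0 A : 0 <= cover_outer c A.
Proof. by rewrite cover_outerE; exact: (@mu_ext_ge0 _ all_sets). Qed.

Lemma le_cover_outer : {homo cover_outer c : A B / A `<=` B >-> A <= B}.
Proof. by rewrite cover_outerE; exact: (@le_mu_ext _ all_sets). Qed.

Lemma cover_outer_sigma_subadditive : sigma_subadditive (cover_outer c).
Proof.
by rewrite cover_outerE; exact: (@mu_ext_sigma_subadditive _ all_sets).
Qed.

End cover_outer.

(* Lebesgue measure on the Lebesgue (i.e. Caratheodory) measurable subsets of
   R^N. *)
Section lebesgue.
Local Open Scope ereal_scope.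
Context (R : realType) (N : nat).

Definition obox (a b : 'cV[R]_N) : set 'cV[R]_N :=
  [set x | forall i, (a i 0 < x i 0 < b i 0)%R].

(* volume of A if A is a nonempty open box, and +oo if A is not a box *)
Definition box_cost (A : set 'cV[R]_N) : \bar R :=
  ereal_inf [set (\prod_i `|ab.2 i 0 - ab.1 i 0|)%:E |
             ab in [set ab : 'cV[R]_N * 'cV[R]_N | A = obox ab.1 ab.2]].

Definition lebesgue_outer : set 'cV[R]_N -> \bar R := cover_outer box_cost.

Let box_cost_ge0 A : 0 <= box_cost A.
Proof.
by apply: le_ereal_inf_tmp => _ [ab _ <-]; rewrite lee_fin; exact: prodr_ge0.
Qed.

HB.instance Definition _ := isOuterMeasure.Build R 'cV[R]_N lebesgue_outer
  (cover_outer0 box_cost_ge0) (cover_outer_ge0 box_cost_ge0)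
  (@le_cover_outer _ _ _) (cover_outer_sigma_subadditive box_cost_ge0).

Definition lebesgue_mx :
    {measure set (caratheodory_type lebesgue_outer) -> \bar R} :=
  [the {outer_measure set 'cV[R]_N -> \bar R} of lebesgue_outer].

End lebesgue.

(* k-dimensional Hausdorff measure on R^N, normalized to agree with Lebesgue
   measure on k-planes. *)
Section hausdorff.
Local Open Scope ereal_scope.
Context (R : realType) (k N : nat).

Definition ball_volume : R := fine (lebesgue_outer (@eball R k 0 1)).

Definition diam_cost (delta : R) (A : set 'cV[R]_N) : \bar R :=
  if ediam A <= delta%:E
  then (ball_volume * (fine (ediam A) / 2) ^+ k)%:E else +oo.

Definition hausdorff_outer (A : set 'cV[R]_N) : \bar R :=
  ereal_sup [set cover_outer (diam_cost delta) A |
             delta in [set delta : R | (0 < delta)%R]].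

Let diam_cost_ge0 delta A : 0 <= diam_cost delta A.
Proof.
rewrite /diam_cost; case: ifP => // _; rewrite lee_fin mulr_ge0//.
  by rewrite fine_ge0// cover_outer_ge0// => B;
    apply: le_ereal_inf_tmp => _ [ab _ <-]; rewrite lee_fin; exact: prodr_ge0.
rewrite exprn_ge0// divr_ge0//.
have [->|/set0P[x Ax]] := eqVneq A set0.
  by rewrite /ediam setX0 image_set0 ereal_sup0.
rewrite fine_ge0//; apply: le_trans (ereal_sup_ubound _); last first.
  by exists (x, x).
by rewrite lee_fin sqrtr_ge0.
Qed.

Lemma hausdorff_outer_ge0 A : 0 <= hausdorff_outer A.
Proof.
apply: le_trans (ereal_sup_ubound _); last by exists 1%R => //=.
exact: cover_outer_ge0.
Qed.

Lemma hausdorff_outer0 : hausdorff_outer set0 = 0.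
Proof.
apply/eqP; rewrite eq_le hausdorff_outer_ge0 andbT.
by apply: ge_ereal_sup => _ [d _ <-]; rewrite cover_outer0.
Qed.

Lemma le_hausdorff_outer : {homo hausdorff_outer : A B / A `<=` B >-> A <= B}.
Proof.
move=> A B AB; apply: ge_ereal_sup => _ [d d0 <-].
apply: le_trans (ereal_sup_ubound _); last by exists d.
exact: le_cover_outer.
Qed.

Lemma hausdorff_outer_sigma_subadditive : sigma_subadditive hausdorff_outer.
Proof.
move=> F; apply: ge_ereal_sup => _ [d d0 <-].
apply: le_trans (cover_outer_sigma_subadditive (diam_cost_ge0 d) _) _.
apply: lee_nneseries => [i _ _|i _]; first exact: cover_outer_ge0.
by apply: ereal_sup_ubound; exists d.
Qed.

HB.instance Definition _ := isOuterMeasure.Build R 'cV[R]_N hausdorff_outer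
  hausdorff_outer0 hausdorff_outer_ge0 le_hausdorff_outer
  hausdorff_outer_sigma_subadditive.

Definition hausdorff :
    {measure set (caratheodory_type hausdorff_outer) -> \bar R} :=
  [the {outer_measure set 'cV[R]_N -> \bar R} of hausdorff_outer].

End hausdorff.

Section calculus.
Context {R : realType}.

(* For an open subset of a finite-dimensional space, continuity of the
   differential is tested on each fixed vector. *)
Definition C1_on {V W : normedModType R} (U : set V) (f : V -> W) : Prop :=
  (forall x, U x -> differentiable f x) /\
  (forall v x, U x -> {for x, continuous (fun y => 'd f y v)}).

Definition C2_on {V W : normedModType R} (U : set V) (f : V -> W) : Prop :=
  C1_on U f /\ (forall v, C1_on U (fun y => 'd f y v)).

Definition jac {a b} (f : 'cV[R]_a -> 'cV[R]_b) (x : 'cV[R]_a) : 'M[R]_(b, a) :=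
  \matrix_(i, j) ('d f x (delta_mx j 0)) i 0.

Definition mxgrad {a b} (F : 'M[R]_(a, b) -> R) (T : 'M[R]_(a, b)) :
    'M[R]_(a, b) :=
  \matrix_(i, j) 'd F T (delta_mx i j).

Definition hess_norm {a b} (F : 'M[R]_(a, b) -> R) (T : 'M[R]_(a, b)) : R :=
  Num.sqrt (\sum_i \sum_j
    frob (mxgrad (fun S => 'd F S (delta_mx i j)) T) ^+ 2).

Definition compact_supp {V : topologicalType} {W : nmodType} (U : set V)
    (f : V -> W) : Prop :=
  compact (closure [set x | f x != 0]) /\ closure [set x | f x != 0] `<=` U.

(* the least Lipschitz constant of u on X, +oo if there is none *)
Definition lip_const {a b} (X : set 'cV[R]_a) (u : 'cV[R]_a -> 'cV[R]_b) :
    \bar R :=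
  ereal_inf [set l%:E | l in [set l : R | 0 <= l /\
    forall x y, X x -> X y -> frob (u x - u y) <= l * frob (x - y)]].

Definition ball_avg {m} (z : 'cV[R]_m) (r : R) (f : 'cV[R]_m -> R) : \bar R :=
  (((fine (lebesgue_mx R m (eball z r)))^-1)%:E *
   \int[lebesgue_mx R m]_(x in eball z r) (f x)%:E)%E.

Definition ball_mean {m n} (z : 'cV[R]_m) (r : R) (u : 'cV[R]_m -> 'cV[R]_n) :
    'cV[R]_n :=
  \col_i fine (ball_avg z r (fun x => u x i 0)).

Definition ess_sup_grad {m n} (Omega : set 'cV[R]_m)
    (u : 'cV[R]_m -> 'cV[R]_n) : \bar R :=
  ess_sup (lebesgue_mx R m) ((fun x => (frob (jac u x))%:E) \_ Omega).

End calculus.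

(* A function on the Grassmannian is represented by a function on all matrices
   whose values off the Grassmannian are irrelevant: every notion below depends
   only on the restriction. *)
Section grassmannian.
Context {R : realType} {N : nat}.
Implicit Types (k : nat) (Psi Phi : 'M[R]_N -> R) (T S P : 'M[R]_N).

Definition grass k : set 'M[R]_N :=
  [set P | [/\ P^T = P, P *m P = P & \tr P = k%:R]].

Definition perp T : 'M[R]_N := 1%:M - T.

Definition C1_extension k Psi Phi : Prop :=
  (exists U, [/\ open U, grass k `<=` U & C1_on U Phi]) /\
  {in grass k, Phi =1 Psi}.

Definition C2_grass k Psi : Prop :=
  exists Phi, (exists U, [/\ open U, grass k `<=` U & C2_on U Phi]) /\
              {in grass k, Phi =1 Psi}.

(* C^2 norm on the compact manifold G(N, k), as the quotient (trace) norm of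
   the C^2 norm on the ambient space *)
Definition C2_norm_ambient Phi : \bar R :=
  (ereal_sup [set `|Phi T|%:E | T in setT] +
   ereal_sup [set (frob (mxgrad Phi T))%:E | T in setT] +
   ereal_sup [set (hess_norm Phi T)%:E | T in setT])%E.

Definition C2_norm k Psi : \bar R :=
  ereal_inf [set C2_norm_ambient Phi |
             Phi in [set Phi | C2_on setT Phi /\ {in grass k, Phi =1 Psi}]].

(* DPsi is taken along an arbitrary C^1 extension; anisoB does not depend on
   which one. *)
Definition Dgrass k Psi T : 'M[R]_N :=
  mxgrad (xget Psi [set Phi | C1_extension k Psi Phi]) T.

Definition dgrass k Psi T : 'M[R]_N := Dgrass k Psi T + (Dgrass k Psi T)^T.

Definition anisoB k Psi T : 'M[R]_N :=
  Psi T *: T + perp T *m dgrass k Psi T *m T.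

Definition dual Psi : 'M[R]_N -> R := fun P => Psi (1%:M - P).

End grassmannian.

Definition usac {R : realType} (m n : nat) (C : R)
    (Psi : 'M[R]_(m + n) -> R) : Prop :=
  forall T S, grass m T -> grass m S -> T <> S ->
    C * frob (T - S) ^+ 2 <=
    mxdot (anisoB m Psi T) (anisoB n (dual Psi) (perp S)).

Section varifold.
Context {R : realType}.

Definition graph_on {m n} (Omega : set 'cV[R]_m) (u : 'cV[R]_m -> 'cV[R]_n) :
    set 'cV[R]_(m + n) :=
  [set col_mx x (u x) | x in Omega].

(* P projects onto the approximate tangent plane of G at z: the blow-ups of
   H^k restricted to G at z converge weakly-* to H^k restricted to im P. *)
Definition is_approx_tangent {N} (k : nat) (G : set 'cV[R]_N) (z : 'cV[R]_N)
    (P : 'M[R]_N) : Prop :=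
  grass k P /\
  forall phi : 'cV[R]_N -> R, continuous phi -> compact_supp setT phi ->
    (fun r : R => (r ^+ k)^-1 *
       \int[hausdorff R k N]_(y in G) phi (r^-1 *: (y - z)))
      @ 0^'+ -->
    \int[hausdorff R k N]_(y in [set y : 'cV[R]_N | P *m y = y]) phi y.

Definition approx_tangent {N} (k : nat) (G : set 'cV[R]_N) (z : 'cV[R]_N) :
    'M[R]_N :=
  xget 0 [set P | is_approx_tangent k G z P].

Definition Lp_on {N b} (k : nat) (p : \bar R) (G : set 'cV[R]_N)
    (H : 'cV[R]_N -> 'cV[R]_b) : Prop :=
  (forall i, measurable_fun
     (G : set (caratheodory_type (@hausdorff_outer R k N)))
     (fun z => H z i 0)) /\
  ('N[hausdorff R k N]_p[((fun z => (frob (H z))%:E) \_ G)] < +oo)%E.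

Definition has_mean_curvature {m n} (Psi : 'M[R]_(m + n) -> R) (p : \bar R)
    (Omega : set 'cV[R]_m) (u : 'cV[R]_m -> 'cV[R]_n)
    (H : 'cV[R]_(m + n) -> 'cV[R]_(m + n)) : Prop :=
  let G := graph_on Omega u in
  let U := [set z : 'cV[R]_(m + n) | Omega (usubmx z)] in
  Lp_on m p G H /\
  forall g : 'cV[R]_(m + n) -> 'cV[R]_(m + n),
    C1_on setT g -> compact_supp U g ->
    \int[hausdorff R m (m + n)]_(z in G)
      mxdot (anisoB m Psi (approx_tangent m G z)) (jac g z) =
    - \int[hausdorff R m (m + n)]_(z in G) mxdot (H z) (g z).

End varifold.

(* Main.v *)
(* Let S be the projection onto the graph of A, T the tangent plane of the graph
   of u, and M = B_{Psi*}(S^perp).  The first variation is tested with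
   g(z) = eta^2 M (z - z0), where eta is a cutoff and z0 = (x0, (u)_{x0,kr}).
   Since M kills the graph of A, on the graph of u one has M (z - z0) = M (0, w)
   with w = u - (u)_{x0,kr} - A (x - x0), so the undifferentiated part of g is of
   the order of w.  (USAC) bounds eta^2 <B(T), M> from below by C eta^2 |T - S|^2.
   Since B(S)^t M = 0, the term with the derivative of eta only sees
   B(T) - B(S) = O(|T - S|) and is absorbed by Young's inequality; finally
   |Du - A| <= c |T - S|.

   The area formula is not needed: the Hausdorff measure on a Lipschitz graph and
   the Lebesgue measure on its base bound each other up to constants.  The
   approximate tangent plane is identified by a blow-up at points of
   differentiability that are density points of sets on which the graph map is
   nearly an isometric copy of its linearization.  No measurability of the
   tangent map is used, the integral of a nonnegative function being defined as
   the supremum over the simple functions below it. *)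
Require Import Defs.
From HB Require Import structures.
From mathcomp Require Import all_boot all_order all_algebra.
From mathcomp Require Import all_classical all_reals all_analysis ess_sup_inf.
From mathcomp Require Import measurable_realfun.
From mathcomp Require Import ring lra.

Set Implicit Arguments.
Unset Strict Implicit.
Unset Printing Implicit Defensive.

Import Order.TTheory GRing.Theory Num.Theory.
Import numFieldNormedType.Exports.

Local Open Scope classical_set_scope.
Local Open Scope ring_scope.

(** * Frobenius norm *)

(** The test field must have compact support in the cylinder over [Omega], so the cutoff has to
    depend on the height as well; since the centre height [y0] is arbitrary, a fixed vertical scale
    could cut the graph off over the small ball. The quadratic form inside the cutoff is therefore
    stretched vertically until the cutoff equals 1 on the graph over [B_r], while the vertical part
    of its gradient stays below [1 / r]. The amount of stretching leaves no trace in the final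
    constant.

    The tangent plane is identified only at almost every point. Elsewhere the first variation
    integrand is merely bounded, so the exceptional null set is charged a large constant: this costs
    nothing after integration and keeps the pointwise inequality valid at every point of the graph.

    Since [u] is Lipschitz only on [Omega], an extension [v] to the whole space carries all the
    measure theory. The constants are built from [K + 1] and [|L| + 1] because the C^2 norm and the
    Lipschitz constant are infima, and a competitor is taken strictly above each. The integral of
    the squared curvature may be infinite; the right-hand side is then infinite too. *)

Section frobenius.
Context {R : realType}.

Lemma mxdotE {a b} (A B : 'M[R]_(a, b)) :
  mxdot A B = \sum_i \sum_j A i j * B i j.
Proof.
rewrite /mxdot /mxtrace exchange_big; apply: eq_bigr => j _ /=.
by rewrite mxE; apply: eq_bigr => i _; rewrite mxE.
Qed.

Lemma mxdotC {a b} (A B : 'M[R]_(a, b)) : mxdot A B = mxdot B A.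
Proof.
by rewrite !mxdotE; apply: eq_bigr => i _; apply: eq_bigr => j _; rewrite mulrC.
Qed.

Lemma mxdotDr {a b} (A B C : 'M[R]_(a, b)) :
  mxdot A (B + C) = mxdot A B + mxdot A C.
Proof. by rewrite /mxdot mulmxDr mxtraceD. Qed.

Lemma mxdotDl {a b} (A B C : 'M[R]_(a, b)) :
  mxdot (B + C) A = mxdot B A + mxdot C A.
Proof. by rewrite mxdotC mxdotDr !(mxdotC A). Qed.

Lemma mxdotZr {a b} c (A B : 'M[R]_(a, b)) : mxdot A (c *: B) = c * mxdot A B.
Proof. by rewrite /mxdot -scalemxAr mxtraceZ. Qed.

Lemma mxdotZl {a b} c (A B : 'M[R]_(a, b)) : mxdot (c *: A) B = c * mxdot A B.
Proof. by rewrite mxdotC mxdotZr mxdotC. Qed.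

Lemma mxdotNr {a b} (A B : 'M[R]_(a, b)) : mxdot A (- B) = - mxdot A B.
Proof. by rewrite -scaleN1r mxdotZr mulN1r. Qed.

Lemma mxdotNl {a b} (A B : 'M[R]_(a, b)) : mxdot (- A) B = - mxdot A B.
Proof. by rewrite mxdotC mxdotNr mxdotC. Qed.

Lemma mxdotBl {a b} (A B C : 'M[R]_(a, b)) :
  mxdot (B - C) A = mxdot B A - mxdot C A.
Proof. by rewrite mxdotDl mxdotNl. Qed.

Lemma mxdotBr {a b} (A B C : 'M[R]_(a, b)) :
  mxdot A (B - C) = mxdot A B - mxdot A C.
Proof. by rewrite mxdotDr mxdotNr. Qed.

Lemma mxdot_mulr {a b c} (A : 'M[R]_(a, b)) (B : 'M[R]_(a, c)) (C : 'M[R]_(c, b)) :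
  mxdot A (B *m C) = mxdot (B^T *m A) C.
Proof. by rewrite /mxdot trmx_mul trmxK mulmxA. Qed.

Lemma mxdot_tr {a b} (A B : 'M[R]_(a, b)) : mxdot A^T B^T = mxdot A B.
Proof.
rewrite !mxdotE exchange_big; apply: eq_bigr => i _; apply: eq_bigr => j _.
by rewrite !mxE.
Qed.

Lemma mxdot_ge0 {a b} (A : 'M[R]_(a, b)) : 0 <= mxdot A A.
Proof.
rewrite mxdotE; apply: sumr_ge0 => i _; apply: sumr_ge0 => j _.
by rewrite -expr2 sqr_ge0.
Qed.

Lemma frob_ge0 {a b} (A : 'M[R]_(a, b)) : 0 <= frob A.
Proof. exact: sqrtr_ge0. Qed.

Lemma frob_sqr {a b} (A : 'M[R]_(a, b)) : frob A ^+ 2 = mxdot A A.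
Proof. by rewrite sqr_sqrtr ?mxdot_ge0. Qed.

Lemma frob_eq0 {a b} (A : 'M[R]_(a, b)) : frob A = 0 -> A = 0.
Proof.
move=> /(congr1 (fun x => x ^+ 2)); rewrite frob_sqr expr0n /= mxdotE => /eqP.
rewrite psumr_eq0; last first.
  by move=> i _; apply: sumr_ge0 => j _; rewrite -expr2 sqr_ge0.
move=> /allP A0; apply/matrixP => i j; rewrite mxE; apply/eqP.
have := A0 i (mem_index_enum _); rewrite /= psumr_eq0; last first.
  by move=> k _; rewrite -expr2 sqr_ge0.
by move=> /allP/(_ j (mem_index_enum _)); rewrite /= mulf_eq0 orbb.
Qed.

(** Expanding the square of [frob B *: A - frob A *: B] gives [2 * (frob A * frob B)] times the
    defect of the inequality. *)
Lemma mxdot_CS {a b} (A B : 'M[R]_(a, b)) : mxdot A B <= frob A * frob B.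
Proof.
have [/frob_eq0 ->|A0] := eqVneq (frob A) 0.
  by rewrite /mxdot trmx0 mul0mx mxtrace0 mulr_ge0 ?frob_ge0.
have [/frob_eq0 ->|B0] := eqVneq (frob B) 0.
  by rewrite /mxdot mulmx0 mxtrace0 mulr_ge0 ?frob_ge0.
have := mxdot_ge0 (frob B *: A - frob A *: B).
rewrite mxdotBl !mxdotBr !mxdotZl !mxdotZr -!frob_sqr (mxdotC B A).
have pA : 0 < frob A by rewrite lt_def A0 frob_ge0.
have pB : 0 < frob B by rewrite lt_def B0 frob_ge0.
move=> h; have : 0 <= (frob A * frob B) * (2 * (frob A * frob B - mxdot A B)).
  by apply: le_trans h _; rewrite le_eqVlt; apply/orP; left; apply/eqP; ring.
rewrite pmulr_rge0 ?mulr_gt0// pmulr_rge0// subr_ge0; exact.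
Qed.

Lemma frobN {a b} (A : 'M[R]_(a, b)) : frob (- A) = frob A.
Proof. by rewrite /frob mxdotNl mxdotNr opprK. Qed.

Lemma frob_distC {a b} (A B : 'M[R]_(a, b)) : frob (A - B) = frob (B - A).
Proof. by rewrite -frobN opprB. Qed.

Lemma mxdot_absCS {a b} (A B : 'M[R]_(a, b)) : `|mxdot A B| <= frob A * frob B.
Proof.
by rewrite ler_norml mxdot_CS andbT lerNl -mxdotNl -(frobN A) mxdot_CS.
Qed.

Lemma ler_frobD {a b} (A B : 'M[R]_(a, b)) : frob (A + B) <= frob A + frob B.
Proof.
rewrite -(@ler_pXn2r _ 2) ?nnegrE ?addr_ge0 ?frob_ge0//.
rewrite frob_sqr mxdotDl !mxdotDr sqrrD -!frob_sqr (mxdotC B A).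
have := mxdot_CS A B; lra.
Qed.

Lemma ler_frobB {a b} (A B C : 'M[R]_(a, b)) :
  frob (A - C) <= frob (A - B) + frob (B - C).
Proof. by rewrite (le_trans _ (ler_frobD _ _))// subrKA. Qed.

Lemma frobZ {a b} c (A : 'M[R]_(a, b)) : frob (c *: A) = `|c| * frob A.
Proof.
by rewrite /frob mxdotZl mxdotZr mulrA -expr2 sqrtrM ?sqr_ge0// sqrtr_sqr.
Qed.

Lemma frob0 {a b} : frob (0 : 'M[R]_(a, b)) = 0.
Proof. by rewrite /frob /mxdot mulmx0 mxtrace0 sqrtr0. Qed.

Lemma frob_tr {a b} (A : 'M[R]_(a, b)) : frob A^T = frob A.
Proof. by rewrite /frob mxdot_tr. Qed.

(** Cauchy-Schwarz for each entry of the product, a row of [A] against a column of [B]; the sums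
    over the entries of [B] are reordered so that the bound factors. *)
Lemma frobM {a b c} (A : 'M[R]_(a, b)) (B : 'M[R]_(b, c)) :
  frob (A *m B) <= frob A * frob B.
Proof.
rewrite -(@ler_pXn2r _ 2) ?nnegrE ?mulr_ge0 ?frob_ge0//.
rewrite exprMn !frob_sqr !mxdotE.
have S1 : \sum_i \sum_j B i j * B i j = \sum_j \sum_i B i j * B i j.
  by rewrite exchange_big.
rewrite S1 mulr_suml; apply: ler_sum => i _; rewrite mulr_sumr.
apply: ler_sum => j _; rewrite -expr2 mxE.
pose u : 'cV[R]_b := \col_k A i k; pose v : 'cV[R]_b := \col_k B k j.
have E (x y : 'cV[R]_b) : mxdot x y = \sum_k x k 0 * y k 0.
  by rewrite mxdotE; apply: eq_bigr => k _; rewrite big_ord1.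
have -> : \sum_k A i k * B k j = mxdot u v.
  by rewrite E; apply: eq_bigr => k _; rewrite !mxE.
have -> : \sum_k A i k * A i k = mxdot u u.
  by rewrite E; apply: eq_bigr => k _; rewrite !mxE.
have -> : \sum_k B k j * B k j = mxdot v v.
  by rewrite E; apply: eq_bigr => k _; rewrite !mxE.
rewrite -!frob_sqr -exprMn -real_normK ?num_real//.
by rewrite ler_pXn2r ?nnegrE ?mulr_ge0 ?frob_ge0// mxdot_absCS.
Qed.

Lemma entry_le_frob {a b} (A : 'M[R]_(a, b)) i j : `|A i j| <= frob A.
Proof.
rewrite -(@ler_pXn2r _ 2) ?nnegrE ?frob_ge0// frob_sqr mxdotE real_normK ?num_real//.
rewrite (bigD1 i)//= (bigD1 j)//= -expr2 -addrA lerDl addr_ge0//.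
  by apply: sumr_ge0 => k _; rewrite -expr2 sqr_ge0.
by apply: sumr_ge0 => k _; apply: sumr_ge0 => l _; rewrite -expr2 sqr_ge0.
Qed.

Lemma mx_norm_leP {a b} (A : 'M[R]_(a, b)) c : 0 <= c ->
  reflect (forall i j, `|A i j| <= c) (`|A| <= c).
Proof.
move=> c0; rewrite [`|A|]/Num.norm/= mx_normrE; apply: (iffP idP).
  by move=> /bigmax_leP[_ h] i j; have := h (i, j) isT.
by move=> h; apply/bigmax_leP; split=> // -[i j] _; exact: h.
Qed.

Lemma mx_norm_ltP {a b} (A : 'M[R]_(a, b)) c : 0 < c ->
  reflect (forall i j, `|A i j| < c) (`|A| < c).
Proof.
move=> c0; rewrite [`|A|]/Num.norm/= mx_normrE; apply: (iffP idP).
  by move=> /bigmax_ltP[_ h] i j; have := h (i, j) isT.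
by move=> h; apply/bigmax_ltP; split=> // -[i j] _; exact: h.
Qed.

Lemma entry_le_norm {a b} (A : 'M[R]_(a, b)) i j : `|A i j| <= `|A|.
Proof. by have /mx_norm_leP -/(_ (normr_ge0 A)) := lexx `|A|; exact. Qed.

Lemma norm_le_frob {a b} (A : 'M[R]_(a, b)) : `|A| <= frob A.
Proof. by apply/mx_norm_leP; [exact: frob_ge0|move=> i j; exact: entry_le_frob]. Qed.

Lemma frob_le_norm {a b} (A : 'M[R]_(a, b)) : frob A <= (a * b)%:R * `|A|.
Proof.
rewrite {1}(matrix_sum_delta A); set X := `|A|.
apply: (@le_trans _ _ (\sum_(i < a) \sum_(j < b) X)); last first.
  by rewrite !sumr_const !card_ord -mulrnA mulr_natl (mulnC a) lexx.
have frob_sum (I : finType) (F : I -> 'M[R]_(a, b)) :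
    frob (\sum_i F i) <= \sum_i frob (F i).
  apply: (big_ind2 (fun x y => frob x <= y)) => [| |i _]; [by rewrite frob0 lexx| |exact: lexx].
  by move=> x x' y y' hx hy; rewrite (le_trans (ler_frobD _ _))// lerD.
apply: le_trans (frob_sum _ _) _; apply: ler_sum => i _.
apply: le_trans (frob_sum _ _) _; apply: ler_sum => j _.
rewrite frobZ (_ : frob _ = 1) ?mulr1; last first.
  rewrite /frob mxdotE (bigD1 i)//= (bigD1 j)//= !mxE !eqxx/= mulr1.
  rewrite big1 ?addr0; last by move=> k kj; rewrite !mxE (negbTE kj) andbF mul0r.
  rewrite big1 ?addr0 ?sqrtr1//.
  by move=> k ki; rewrite big1// => l _; rewrite !mxE (negbTE ki) mul0r.
by rewrite /X entry_le_norm.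
Qed.

End frobenius.

(** * Outer measures and Lebesgue measure *)

Lemma nneseries_le_bound {R : realType} (u : (\bar R)^nat) (M : \bar R) :
  (forall n, 0 <= u n)%E -> (forall N, \sum_(i < N) u i <= M)%E ->
  (\sum_(i <oo) u i <= M)%E.
Proof.
move=> u0 uM; apply: lime_le; first by apply: is_cvg_nneseries => n _ _.
by apply: nearW => n; rewrite big_mkord.
Qed.

(** * Caratheodory's criterion for metric outer measures *)

Section metric_outer_measure.
Local Open Scope ereal_scope.
Context {R : realType} {V : normedModType R}.

Definition metric_outer (mu : set V -> \bar R) :=
  forall (A B : set V) (e : R), (0 < e)%R ->
  (forall a b, A a -> B b -> (e <= `|a - b|)%R) ->
  mu A + mu B <= mu (A `|` B).

Variable mu : {outer_measure set V -> \bar R}.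
Hypothesis mu_metric : metric_outer mu.

(** [O] is exhausted by the sets [I n] of points whose ball of radius [1 / n.+1] stays in [O]. Each
    [I n] is at positive distance from the complement of [O], and what is lost in [X] by replacing
    [O] with [I n.+1] is the tail of a convergent series of shells. *)
Lemma metric_outer_open (O : set V) : open O -> mu.-caratheodory O.
Proof.
move=> oO; apply: le_caratheodory_measurable => X.
have [Xoo|Xfin] := eqVneq (mu X) +oo; first by rewrite Xoo leey.
have {}Xfin : mu X < +oo by rewrite lt_neqAle Xfin leey.
pose I n : set V := [set x | ball x (n.+1%:R^-1) `<=` O].
have I_mono n : I n `<=` I n.+1.
  move=> x; apply: subset_trans; apply: le_ball.
  by rewrite lef_pV2 ?posrE// ler_nat.
have IO n : I n `<=` O by move=> x; apply; exact: ballxx.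
have IU : O `<=` \bigcup_n I n.
  move=> x Ox; have /nbhs_ballP[e /= e0 xeO] := open_nbhs_nbhs (conj oO Ox).
  exists (Num.truncn e^-1) => //=; apply: subset_trans xeO; apply: le_ball.
  by rewrite invf_ple ?posrE// ltW// truncnS_gt.
have gap n x y : I n x -> ~ I n.+1 y ->
    (n.+1%:R^-1 - n.+2%:R^-1 <= `|x - y| :> R)%R.
  move=> Ix /existsNP[z /not_implyP[yz Oz]]; rewrite lerBlDr.
  rewrite leNgt; apply/negP => h; apply/Oz/Ix; rewrite -ball_normE /=.
  apply: le_lt_trans h; rewrite -(subrKA y) (le_trans (ler_normD _ _))// lerD2l.
  by move: yz; rewrite -ball_normE /= => /ltW.
have gap0 n : (0 < n.+1%:R^-1 - n.+2%:R^-1 :> R)%R.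
  by rewrite subr_gt0 ltf_pV2 ?posrE// ltr_nat.
pose D n := X `&` (I n.+2 `\` I n.+1).
have step n : mu (X `&` I n) + mu (D n) <= mu (X `&` I n.+2).
  apply: le_trans (mu_metric (gap0 n) _) _.
    by move=> a b [_ Ia] [_ [_ Ib]]; exact: gap.
  apply: le_outer_measure => x [[Xx Ix]|[Xx [Ix _]]]; split => //.
  exact/I_mono/I_mono.
(* The shell [D n] is separated from [I n] but not from its neighbours, so the even and the odd
   shells are summed apart; each family contributes at most [mu X]. *)
have sumD N : \sum_(k < N.*2) mu (D k) <=
    mu (X `&` I N.*2) + mu (X `&` I N.*2.+1).
  elim: N => [|N IH]; first by rewrite big_ord0 adde_ge0.
  rewrite doubleS !big_ord_recr /=.
  apply: le_trans (leeD2r _ (leeD2r _ IH)) _.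
  by rewrite -addeA [leLHS]addeACA leeD.
have sumDX : \sum_(k <oo) mu (D k) <= mu X + mu X.
  apply: nneseries_le_bound => // N.
  apply: (@le_trans _ _ (\sum_(k < N.*2) mu (D k))).
    rewrite -!(big_mkord xpredT (mu \o D)) /=.
    by apply: lee_sum_nneg_natr => //; rewrite -addnn leq_addr.
  by apply: le_trans (sumD N) _; rewrite leeD// le_outer_measure.
have := @nneseries_tail_cvg R (mu \o D) xpredT.
move=> /(_ (le_lt_trans sumDX (lte_add_pinfty Xfin Xfin)) (fun _ _ => outer_measure_ge0 _ _)).
move=> /fine_cvgP[fin tail0].
apply/lee_addgt0Pr => e e0.
have [n [finn tne]] : exists n, \sum_(n <= k <oo) mu (D k) \is a fin_num /\
    (fine (\sum_(n <= k <oo) mu (D k)) < e)%R.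
  near \oo => n; exists n; split; first by near: n.
  apply: le_lt_trans (ler_norm _) _; near: n.
  by have /cvgr0Pnorm_lt := tail0; apply.
have XO : mu (X `&` O) <= mu (X `&` I n.+1) + \sum_(n <= k <oo) mu (D k).
  apply: le_trans (leeD2l _ (outer_measure_sigma_subadditive_tail _ n D)).
  apply: le_trans (outer_measureU2 _ _ _); apply: le_outer_measure.
  move=> x [Xx /IU[k _ Ikx]].
  have [Ix|Ix] := pselect (I n.+1 x); first by left.
  right; elim: k Ikx => [I0|k IH Ik].
    by exfalso; apply: Ix; elim: n.+1 => // j; exact: I_mono.
  have [|Ikx] := pselect (I k x); first exact: IH.
  have nk : (n < k)%N.
    rewrite ltnNge; apply/negP => kn; apply: Ix; rewrite -(subnK kn) -addnS.
    by elim: (n - k)%N => // j; exact: I_mono.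
  case: k nk Ikx Ik {IH} => // k nk Ikx Ik; exists k => //.
  by move=> /=; rewrite ltnNge -ltnS nk.
apply: le_trans (leeD2r _ XO) _; rewrite addeAC leeD//.
  apply: le_trans (mu_metric (gap0 n.+1) _) _.
    by move=> a b [_ Ia] [_ Ob]; apply: gap => // /IO.
  by apply: le_outer_measure => x [] [].
by rewrite -(fineK finn) lee_fin ltW.
Unshelve. all: by end_near. Qed.

End metric_outer_measure.

Section polynomial_limit.
Context {R : realType}.

(** Volumes of boxes widened by [t] are polynomials in [t]; the passage to [t = 0] is then
    continuity of a polynomial, and no epsilon has to be distributed over a product. *)
Lemma le_horner0 (X : R) (p : {poly R}) :
  (forall e, 0 < e -> exists t, [/\ 0 < t, t < e & X <= p.[t]]) -> X <= p.[0].
Proof.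
move=> h; apply/ler_addgt0Pr => e e0.
have /cvgr_dist_lt/(_ _ e0)/nbhs_ballP[d /= d0 pd] := @continuous_horner _ p 0.
have [t [t0 td Xt]] := h d d0; apply: le_trans Xt _.
rewrite -lerBlDl; apply: le_trans (ler_norm _) (ltW _); rewrite distrC; apply: pd.
by rewrite /ball/= sub0r normrN gtr0_norm.
Qed.

Lemma horner_prod_addX (I : finType) (l : I -> R) (t : R) :
  (\prod_i ((l i)%:P + 'X)).[t] = \prod_i (l i + t).
Proof. by rewrite horner_prod; apply: eq_bigr => i _; rewrite !hornerE. Qed.

End polynomial_limit.

Lemma outer_measure_fin {R : realType} {T : Type}
    (mu : {outer_measure set T -> \bar R}) (I : eqType) (s : seq I)
    (P : pred I) (F : I -> set T) (A : set T) :
  (forall x, A x -> exists2 i, (i \in s) && P i & F i x) ->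
  (mu A <= \sum_(i <- s | P i) mu (F i))%E.
Proof.
elim: s A => [|j s IH] A AF.
  rewrite big_nil (_ : A = set0) ?outer_measure0//.
  by apply/seteqP; split => // x /AF[].
rewrite big_cons; case: ifPn => Pj; last first.
  apply: IH => x /AF[i /andP[]]; rewrite inE => /orP[/eqP->|si Pi Fi].
    by rewrite (negbTE Pj).
  by exists i => //; rewrite si.
apply: (@le_trans _ _ (mu (F j) + mu (A `\` F j))%E).
  apply: le_trans (outer_measureU2 _ _ _); apply: le_outer_measure => x Ax.
  by have [|] := pselect (F j x); [left|right].
rewrite leeD2l// IH// => x [/AF[i /andP[]]]; rewrite inE => /orP[/eqP->//|si Pi Fi _].
by exists i => //; rewrite si.
Qed.

(** The index of the cell of [x] is the truncation of [(x - c) / s] in each coordinate. The exact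
    number of cells is recorded because the volume estimates count them. *)
Lemma grid_cover {R : realType} {m} (c s : 'cV[R]_m) (n : 'I_m -> nat)
    (A : set 'cV[R]_m) :
  (forall i, 0 < s i 0) ->
  (forall x i, A x -> c i 0 <= x i 0 < c i 0 + (n i)%:R * s i 0) ->
  exists l : seq 'cV[R]_m, size l = (\prod_i n i)%N /\
   forall x, A x -> exists2 d, d \in l & forall i, d i 0 <= x i 0 <= d i 0 + s i 0.
Proof.
move=> s0 An.
pose pt (f : {dffun forall i : 'I_m, 'I_(n i)}) : 'cV[R]_m :=
  \col_i (c i 0 + (f i)%:R * s i 0).
exists [seq pt f | f : {dffun forall i : 'I_m, 'I_(n i)}]; split.
  rewrite size_image card_dep_ffun foldrE big_map big_enum /=.
  by apply: eq_bigr => i _; rewrite card_ord.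
move=> x Ax.
have tr i : (Num.truncn ((x i 0 - c i 0) / s i 0)%R < n i)%N.
  have /andP[h0 h] := An x i Ax; rewrite truncn_lt_nat.
    by rewrite ltr_pdivrMr// ltrBlDl.
  by rewrite divr_ge0 ?subr_ge0// ltW.
exists (pt (finfun (fun i => Ordinal (tr i)))); first by apply: map_f; rewrite mem_enum.
move=> i; rewrite !mxE ffunE /=; have /andP[h _] := An x i Ax.
have q0 : (0 : R) <= (x i 0 - c i 0) / s i 0 by rewrite divr_ge0 ?subr_ge0// ltW.
have /andP[h1 /ltW h2] := truncn_itv q0.
rewrite -lerBrDl -ler_pdivlMr// h1/=.
by move: h2; rewrite ler_pdivrMr// -natr1 mulrDl mul1r lerBlDl addrA.
Qed.

(** * Covers by boxes *)

Section lebesgue_outer.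
Context {R : realType} {m : nat}.
Hypothesis m0 : (0 < m)%N.
Implicit Types (a b x : 'cV[R]_m) (A : set 'cV[R]_m).

Definition vol a b : R := \prod_i (b i 0 - a i 0).

Definition cbox a b : set 'cV[R]_m :=
  [set x | forall i, a i 0 <= x i 0 <= b i 0].

Lemma cover_outer_le1 {T : pointedType} (c : set T -> \bar R) (A B : set T) :
  (forall A : set T, 0 <= c A)%E -> A `<=` B -> (cover_outer c A <= c B)%E.
Proof.
move=> c0 AB; apply: (@le_trans _ _ (\sum_(k <oo) cost0 c (bigcup2 B set0 k))%E).
  apply: ereal_inf_lbound; exists (bigcup2 B set0) => //=.
  by apply: subset_trans AB _ => x Bx; exists 0%N.
have cc0 (A' : set T) : (0 <= cost0 c A')%E by rewrite /cost0; case: ifP.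
apply: nneseries_le_bound => // N.
case: N => [|N]; first by rewrite big_ord0.
rewrite big_ord_recl big1 => [|i _]; last by rewrite /bigcup2/= if_same /cost0 asboolT.
by rewrite adde0 /= /cost0; case: ifP.
Qed.

Lemma box_cost_ge0 A : (0 <= box_cost A)%E.
Proof.
by apply: le_ereal_inf_tmp => _ [ab _ <-]; rewrite lee_fin; exact: prodr_ge0.
Qed.

Lemma leb_obox_le a b : (forall i, a i 0 <= b i 0) ->
  (lebesgue_outer (obox a b) <= (vol a b)%:E)%E.
Proof.
move=> ab; apply: le_trans (cover_outer_le1 box_cost_ge0 (@subset_refl _ _)) _.
apply: ereal_inf_lbound; exists (a, b) => //=; congr (_%:E).
by apply: eq_bigr => i _; rewrite ger0_norm// subr_ge0.
Qed.

Lemma leb_cbox_le a b : (forall i, a i 0 <= b i 0) ->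
  (lebesgue_outer (cbox a b) <= (vol a b)%:E)%E.
Proof.
move=> ab.
have H t : 0 < t -> (lebesgue_outer (cbox a b) <=
    (\prod_i ((b i 0 - a i 0 + t) + t))%:E)%E.
  move=> t0; pose a' := \col_i (a i 0 - t); pose b' := \col_i (b i 0 + t).
  apply: (@le_trans _ _ (lebesgue_outer (obox a' b'))).
    apply: le_outer_measure => x xab i; rewrite !mxE.
    by have /andP[? ?] := xab i; apply/andP; split; lra.
  apply: le_trans (leb_obox_le _) _.
    by move=> i; rewrite !mxE; have := ab i; lra.
  rewrite lee_fin le_eqVlt; apply/orP; left; apply/eqP.
  by apply: eq_bigr => i _; rewrite !mxE; ring.
have fin : lebesgue_outer (cbox a b) \is a fin_num.
  by rewrite ge0_fin_numE ?outer_measure_ge0// (le_lt_trans (H 1 ltr01))// ltry.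
rewrite -(fineK fin) lee_fin.
have -> : vol a b = (\prod_i ((b i 0 - a i 0)%:P + 'X)).[0].
  by rewrite horner_prod_addX; apply: eq_bigr => i _; rewrite addr0.
apply: le_horner0 => e e0; exists (e / 2); split; [lra|lra|].
rewrite horner_prod_addX.
have e4 : 0 < e / 4 by lra.
have := H _ e4; rewrite -(fineK fin) lee_fin => /le_trans; apply.
rewrite le_eqVlt; apply/orP; left; apply/eqP.
by apply: eq_bigr => i _; field.
Qed.

(** The cost of a set is itself an infimum over its representations as an open box. Each member of a
    nearly optimal cover is replaced by a concrete box at the price of a geometrically small
    error. *)
Lemma leb_coverP A (M : \bar R) : (lebesgue_outer A < M)%E ->
  exists a b : nat -> 'cV[R]_m, [/\ forall k i, a k i 0 <= b k i 0,
    A `<=` \bigcup_k obox (a k) (b k) &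
    (\sum_(k <oo) (vol (a k) (b k))%:E < M)%E].
Proof.
move=> /ereal_inf_lt[_ [F AF <-]] FM.
have cc0 A' : (0 <= cost0 (@box_cost R m) A')%E.
  by rewrite /cost0; case: ifP => // _; exact: box_cost_ge0.
set S := (\sum_(k <oo) _)%E in FM.
have S0 : (0 <= S)%E by apply: nneseries_ge0.
have Sfin : S \is a fin_num.
  by rewrite ge0_fin_numE// (lt_le_trans FM)// leey.
have [e e0 eM] : exists2 e, 0 < e & (S + e%:E < M)%E.
  case: M FM => [r|_|]; last by rewrite ltNge leNye.
    rewrite -(fineK Sfin) lte_fin => h; exists ((r - fine S) / 2); first by lra.
    by rewrite -EFinD lte_fin; lra.
  by exists 1; rewrite // -(fineK Sfin) -EFinD ltry.
have Ffin k : cost0 (@box_cost R m) (F k) \is a fin_num.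
  rewrite ge0_fin_numE//; apply: le_lt_trans (lt_le_trans FM (leey _)).
  apply: le_trans (nneseries_lim_ge k.+1 _) => //.
  by rewrite big_nat_recr//= leeDr// sume_ge0.
have H k : exists ab : 'cV[R]_m * 'cV[R]_m, [/\ forall i, ab.1 i 0 <= ab.2 i 0,
    F k `<=` obox ab.1 ab.2 &
    ((vol ab.1 ab.2)%:E <= cost0 (@box_cost R m) (F k) + (e / (2 ^ k.+1)%:R)%:E)%E].
  have ek0 : 0 < e / (2 ^ k.+1)%:R :> R by rewrite divr_gt0// ltr0n expn_gt0.
  have [F0|F0] := pselect (F k = set0).
    (* An empty member is replaced by a degenerate box, whose volume vanishes because there is at
       least one coordinate. *)
    exists (0, 0); split => //=; first by rewrite F0.
    rewrite /vol (bigD1 (Ordinal m0))//= subrr mul0r.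
    by rewrite adde_ge0// lee_fin ltW.
  have := Ffin k; rewrite /cost0 asboolF// => Fk.
  have : (box_cost (F k) < box_cost (F k) + (e / (2 ^ k.+1)%:R)%:E)%E.
    by rewrite -(fineK Fk) -EFinD lte_fin ltrDl.
  move=> /ereal_inf_lt[_ [[a b] /= Fab <-] /ltW h].
  move: F0 => /eqP/set0P[x Fx].
  have ab i : a i 0 <= b i 0.
    by move: Fx; rewrite Fab => /(_ i)/andP[h1 h2]; rewrite ltW// (lt_trans h1).
  exists (a, b); split => //=; first by rewrite -Fab.
  rewrite (_ : vol _ _ = \prod_i `|b i 0 - a i 0|)//.
  by apply: eq_bigr => i _; rewrite ger0_norm// subr_ge0.
have {H}[f Hf] := choice H.
exists (fun k => (f k).1), (fun k => (f k).2); split.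
- by move=> k; have [] := Hf k.
- by move=> x /AF[k _ Fk]; exists k => //; have [_ + _] := Hf k; exact.
- apply: le_lt_trans eM; apply: le_trans (epsilon_trick xpredT (fun k => cc0 (F k)) (ltW e0)).
  apply: lee_nneseries => [k _ _|k _]; last by have [] := Hf k.
  by rewrite lee_fin; apply: prodr_ge0 => i _; rewrite subr_ge0; have [] := Hf k.
Qed.

End lebesgue_outer.

Lemma outer_measure_cover {R : realType} {T : Type}
    (mu : {outer_measure set T -> \bar R}) (A : set T) (F : (set T)^nat) :
  A `<=` \bigcup_k F k -> (mu A <= \sum_(k <oo) mu (F k))%E.
Proof.
move=> AF; apply: le_trans (outer_measure_sigma_subadditive mu F).
exact: le_outer_measure.
Qed.

(** Estimates against covers produce bounds by every [M] above the infimum; this form treats finite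
    and infinite infima alike. *)
Lemma lee_ltP {R : realType} (x y : \bar R) :
  (forall M, (y < M)%E -> (x <= M)%E) -> (x <= y)%E.
Proof.
move=> h; rewrite leNgt; apply/negP => yx.
have [z yz zx] : exists2 z, (y < z)%E & (z < x)%E.
  case: x y yx {h} => [x| |] [y| |] //=.
  - rewrite lte_fin => yx; exists ((x + y) / 2)%:E; rewrite lte_fin; lra.
  - by move=> _; exists (x - 1)%:E; rewrite ?ltNyr// lte_fin; lra.
  - by move=> _; exists (y + 1)%:E; rewrite ?ltry// lte_fin; lra.
  - by move=> _; exists 0%E.
by have := h _ yz; rewrite leNgt zx.
Qed.

Lemma bounded_setP {R : realType} {V : normedModType R} (A : set V) :
  bounded_set A <-> exists M, forall x, A x -> `|x| <= M.
Proof.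
split=> [[M [_ h]]|[M h]]; first by exists (M + 1); apply: h; rewrite ltrDl.
by exists M; split; [exact: num_real|move=> N MN x /h /le_trans; apply; exact: ltW].
Qed.

(** * Measurability and regularity for Lebesgue measure *)

Section lebesgue_regularity.
Context {R : realType} {m : nat}.
Hypothesis m0 : (0 < m)%N.
Implicit Types (a b x : 'cV[R]_m) (A B : set 'cV[R]_m).
Notation leb := (@lebesgue_outer R m).

Lemma leb_ge0 A : (0 <= leb A)%E.
Proof. exact: outer_measure_ge0. Qed.

Lemma vol_ge0 a b : (forall i, a i 0 <= b i 0) -> 0 <= vol a b.
Proof. by move=> ab; apply: prodr_ge0 => i _; rewrite subr_ge0. Qed.

(** Cut the box into equal cells with all sides shorter than [e]. No cell meets both sets, so the
    cells meeting [A] and those meeting [B] together have at most the volume of the box. *)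
Lemma leb_obox_split a b A B (e : R) : (forall i, a i 0 <= b i 0) -> 0 < e ->
  (forall x y, A x -> B y -> e <= `|x - y|) ->
  (leb (obox a b `&` A) + leb (obox a b `&` B) <= (vol a b)%:E)%E.
Proof.
move=> ab e0 AB; have [lab|/existsNP[i /negP]] :=
    pselect (forall i, a i 0 < b i 0); last first.
  rewrite -leNgt => bai.
  have Q0 X : obox a b `&` X = set0.
    by apply/seteqP; split => // x [/(_ i)/andP[h1 h2] _]; lra.
  by rewrite !Q0 outer_measure0 adde0 lee_fin vol_ge0.
pose K := (Num.truncn (`|b - a| / e)).+1.
have K0 : 0 < K%:R :> R by rewrite ltr0n.
pose s : 'cV[R]_m := \col_i ((b i 0 - a i 0) / K%:R).
have s0 i : 0 < s i 0 by rewrite mxE divr_gt0// subr_gt0.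
have se i : s i 0 < e.
  rewrite mxE ltr_pdivrMr// mulrC -ltr_pdivrMr//.
  apply: le_lt_trans (truncnS_gt _); rewrite ler_pM2r ?invr_gt0//.
  have := entry_le_norm (b - a) i 0; rewrite !mxE; apply: le_trans.
  exact: ler_norm.
have [x i|l [sl lP]] := @grid_cover _ _ a s (fun=> K) (obox a b) s0.
  move=> /(_ i)/andP[h1 h2]; rewrite ltW//= mxE mulrCA divff ?gt_eqF// mulr1.
  by rewrite (lt_le_trans h2)//; lra.
pose P X d := `[< (cbox d (d + s) `&` X) !=set0 >].
have H X : (leb (obox a b `&` X) <= \sum_(d <- l | P X d) (\prod_i s i 0)%:E)%E.
  apply: le_trans (_ : _ <= \sum_(d <- l | P X d) leb (cbox d (d + s)))%E _.
    apply: outer_measure_fin => x [/lP[d dl dx] Xx].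
    have cx : cbox d (d + s) x by move=> i; rewrite mxE dx.
    by exists d; rewrite // dl/=; apply/asboolP; exists x.
  apply: lee_sum => d _.
  apply: le_trans (leb_cbox_le _) _; first by move=> i; rewrite !mxE; have := s0 i; rewrite mxE; lra.
  rewrite lee_fin le_eqVlt; apply/orP; left; apply/eqP.
  by apply: eq_bigr => i _; rewrite !mxE addrAC subrr add0r.
apply: le_trans (leeD (H A) (H B)) _.
rewrite !sumEFin -EFinD lee_fin.
have -> : vol a b = \sum_(d <- l) \prod_i s i 0.
  rewrite big_const_seq count_predT iter_addr_0 sl prod_nat_const card_ord.
  rewrite -[RHS]mulr_natl natrX -[X in _ ^+ X](card_ord m) -prodr_const -big_split /=.
  by apply: eq_bigr => i _; rewrite mxE mulrCA divff ?gt_eqF// mulr1.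
rewrite [X in X + _]big_mkcond [X in _ + X]big_mkcond -big_split /=.
apply: ler_sum => d _; have sp : 0 <= \prod_i s i 0 by apply: prodr_ge0 => i _; exact: ltW.
case: ifPn => [/asboolP[x [dx Ax]]|_]; last by rewrite add0r; case: ifP.
case: ifPn => [/asboolP[y [dy By]]|_]; last by rewrite addr0.
have := AB _ _ Ax By; rewrite leNgt => /negP[].
apply/mx_norm_ltP => // i j; rewrite ord1 !mxE; apply: le_lt_trans (se i).
have := dx i; have := dy i; rewrite !mxE ler_norml => /andP[? ?] /andP[? ?].
by apply/andP; split; lra.
Qed.

Lemma leb_metric : metric_outer leb.
Proof.
move=> A B e e0 AB; apply: lee_ltP => M /(leb_coverP m0)[a [b [ab ABc S]]].
have H X : X `<=` A `|` B -> (leb X <= \sum_(k <oo) leb (obox (a k) (b k) `&` X))%E.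
  move=> XAB; apply: outer_measure_cover => x Xx.
  by have [k _ kx] := ABc _ (XAB _ Xx); exists k.
apply: le_trans (leeD (H A _) (H B _)) _; [by left|by right|].
rewrite -nneseriesD; try by move=> *; exact: outer_measure_ge0.
apply: le_trans (ltW S); apply: lee_nneseries => [k _ _|k _].
  by apply: adde_ge0; exact: outer_measure_ge0.
exact: leb_obox_split (ab k) e0 AB.
Qed.

Lemma leb_open_measurable A : open A -> leb.-caratheodory A.
Proof. exact: (metric_outer_open leb_metric). Qed.

Lemma obox_open a b : open (obox a b).
Proof.
rewrite openE => x xab; apply/nbhs_ballP.
pose e := \big[Num.min/1]_i Num.min (x i 0 - a i 0) (b i 0 - x i 0).
exists e => /=.
  rewrite /e; elim/big_ind : _ => // [y z y0 z0|i _]; first by rewrite lt_min y0.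
  by have /andP[? ?] := xab i; rewrite lt_min !subr_gt0; apply/andP.
move=> y; rewrite -ball_normE /= => xy i.
have := le_lt_trans (entry_le_norm _ i 0) xy; rewrite !mxE.
move=> /lt_le_trans/(_ (bigmin_le _ i _)).
by rewrite lt_min !ltr_norml => /andP[/andP[? ?] /andP[? ?]]; apply/andP; split; lra.
Qed.

Lemma leb_outer_regular A (M : \bar R) : (leb A < M)%E ->
  exists U, [/\ open U, A `<=` U & (leb U < M)%E].
Proof.
move=> /(leb_coverP m0)[a [b [ab Aab S]]].
exists (\bigcup_k obox (a k) (b k)); split => //.
  by apply: bigcup_open => k _; exact: obox_open.
apply: le_lt_trans S; apply: le_trans (outer_measure_sigma_subadditive _ _) _.
by apply: lee_nneseries => // k _; exact: leb_obox_le.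
Qed.

Lemma leb_bounded A : bounded_set A -> (leb A < +oo)%E.
Proof.
move=> /bounded_setP[M AM].
apply: (@le_lt_trans _ _ (vol (const_mx (- `|M|) : 'cV[R]_m) (const_mx `|M|))%:E).
  2: exact: ltry.
apply: le_trans (leb_cbox_le _); last by move=> i; rewrite !mxE; have := normr_ge0 M; lra.
apply: le_outer_measure => x Ax i; rewrite !mxE -ler_norml.
apply: le_trans (entry_le_norm _ _ _) _; apply: le_trans (ler_norm M).
exact: AM.
Qed.

Lemma leb_caraC A : leb.-caratheodory A -> leb.-caratheodory (~` A).
Proof. exact: caratheodory_measurable_setC. Qed.

Lemma leb_closed_measurable A : closed A -> leb.-caratheodory A.
Proof.
move=> cA; rewrite -(setCK A); apply: leb_caraC; apply: leb_open_measurable.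
exact: closed_openC.
Qed.

Lemma cbox_closed a b : closed (cbox a b).
Proof.
rewrite -(setCK (cbox a b)); apply: open_closedC.
rewrite openE => x /existsNP[i /negP]; rewrite negb_and -!ltNge => xi.
apply/nbhs_ballP; case/orP : xi => h.
  exists (a i 0 - x i 0) => /=; first by rewrite subr_gt0.
  move=> y; rewrite -ball_normE /= => xy /(_ i)/andP[h1 _].
  have := le_lt_trans (entry_le_norm _ i 0) xy; rewrite !mxE ltr_norml => /andP[? ?]; lra.
exists (x i 0 - b i 0) => /=; first by rewrite subr_gt0.
move=> y; rewrite -ball_normE /= => xy /(_ i)/andP[_ h1].
have := le_lt_trans (entry_le_norm _ i 0) xy; rewrite !mxE ltr_norml => /andP[? ?]; lra.
Qed.

Lemma trmx_continuous {p q} : continuous (@trmx R p q).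
Proof.
move=> A B /nbhs_ballP[e /= e0 h]; apply/nbhs_ballP; exists e => //= C AC.
apply: h; move: AC; rewrite -!ball_normE /= => AC.
by apply/mx_norm_ltP => // i j; have /mx_norm_ltP/(_ j i) := AC; rewrite !mxE; apply.
Qed.

(** Transposition carries the Heine-Borel theorem from row vectors to columns. *)
Lemma cV_bounded_closed_compact {n} (A : set 'cV[R]_n) :
  bounded_set A -> closed A -> compact A.
Proof.
move=> bA cA; rewrite (_ : A = trmx @` (trmx @^-1` A)); last first.
  apply/seteqP; split => [x Ax|_ [y Ay <-]//].
  by exists x^T; rewrite /= trmxK.
apply: continuous_compact; first by apply: continuous_subspaceT; exact: trmx_continuous.
apply: bounded_closed_compact.
  move: bA => /bounded_setP[M AM]; apply/bounded_setP; exists M => x /= /AM.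
  rewrite (_ : `|x^T| = `|x|)//; apply/le_anti/andP; split.
    by apply/mx_norm_leP => // i j; rewrite mxE entry_le_norm.
  by apply/mx_norm_leP => // i j; have := entry_le_norm (x^T) j i; rewrite mxE.
apply: closed_comp => // x _; exact: trmx_continuous.
Qed.

(** Outer regularity is applied to the complement of [A] in a closed cube [Q] containing [A]: if [U]
    is open, covers that complement and is hardly larger, then [Q] minus [U] is the compact set. *)
Lemma leb_inner_regular A (c : \bar R) : bounded_set A -> leb.-caratheodory A ->
  (c < leb A)%E -> exists K, [/\ compact K, K `<=` A & (c < leb K)%E].
Proof.
move=> bA mA cA; have Afin := leb_bounded bA.
move: (bA) => /bounded_setP[M AM].
pose Q : set 'cV[R]_m := cbox (const_mx (- `|M|)) (const_mx `|M|).
have AQ : A `<=` Q.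
  move=> x Ax i; rewrite !mxE -ler_norml.
  apply: le_trans (entry_le_norm _ _ _) _; apply: le_trans (ler_norm M).
  exact: AM.
have bQ : bounded_set Q.
  apply/bounded_setP; exists `|M| => x Qx; apply/mx_norm_leP => // i j.
  by rewrite ord1 ler_norml; have := Qx i; rewrite !mxE.
have mQ : leb.-caratheodory Q by apply: leb_closed_measurable; exact: cbox_closed.
have Qfin := leb_bounded bQ.
have Afn : leb A \is a fin_num by rewrite ge0_fin_numE ?leb_ge0.
have Qfn : leb Q \is a fin_num by rewrite ge0_fin_numE ?leb_ge0.
have QAE : leb Q = (leb A + leb (Q `\` A))%E.
  by rewrite (mA Q) setIidr.
have QAfin : leb (Q `\` A) \is a fin_num.
  rewrite ge0_fin_numE ?leb_ge0//; apply: le_lt_trans Qfin.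
  by apply: le_outer_measure => x [].
have [c' [cc' c'A]] : exists c' : R, (c <= c'%:E)%E /\ (c'%:E < leb A)%E.
  case: c cA => [r h| |_]; first by exists r.
    by rewrite ltNge leey.
  by exists (-1); rewrite leNye; split => //; rewrite (lt_le_trans _ (outer_measure_ge0 _ _))// lte_fin; lra.
have [U [oU QU Ulow]] : exists U, [/\ open U, Q `\` A `<=` U &
    (leb U < leb Q - c'%:E)%E].
  apply: leb_outer_regular; rewrite QAE -(fineK Afn) -(fineK QAfin).
  by rewrite -EFinN -!EFinD lte_fin; move: c'A; rewrite -(fineK Afn) lte_fin; lra.
have mU := leb_open_measurable oU.
exists (Q `\` U); split.
- apply: cV_bounded_closed_compact.
    move: bQ => /bounded_setP[N QN]; apply/bounded_setP; exists N => x [Qx _]; exact: QN.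
  by apply: closedI; [exact: cbox_closed|exact: open_closedC].
- by move=> x [Qx Ux]; apply: contrapT => Ax; apply: Ux; apply: QU.
- apply: le_lt_trans cc' _.
  have QUI : (leb (Q `&` U) <= leb U)%E by apply: le_outer_measure => x [].
  have := mU Q; have : leb (Q `\` U) \is a fin_num.
    rewrite ge0_fin_numE ?leb_ge0//; apply: le_lt_trans Qfin.
    by apply: le_outer_measure => x [].
  have : leb (Q `&` U) \is a fin_num.
    rewrite ge0_fin_numE ?leb_ge0//; apply: le_lt_trans Qfin.
    by apply: le_outer_measure => x [].
  rewrite -/(setD Q U); move: (le_lt_trans QUI Ulow) => + f1 f2.
  rewrite -(fineK f1) -(fineK f2) -(fineK Qfn) -EFinN -!EFinD !lte_fin => h [] h2.
  by lra.
Qed.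

End lebesgue_regularity.

(** * Null sets and density points *)

Section null_sets.
Context {R : realType} {T : Type} (mu : {outer_measure set T -> \bar R}).
Local Open Scope ereal_scope.

Lemma null_subset (A B : set T) : A `<=` B -> mu B = 0 -> mu A = 0.
Proof.
move=> AB B0; apply/eqP; rewrite eq_le outer_measure_ge0 andbT -B0.
exact: le_outer_measure.
Qed.

Lemma null_bigcup (F : (set T)^nat) :
  (forall k, mu (F k) = 0) -> mu (\bigcup_k F k) = 0.
Proof.
move=> F0; apply/eqP; rewrite eq_le outer_measure_ge0 andbT.
apply: le_trans (outer_measure_sigma_subadditive mu F) _.
by rewrite eseries0.
Qed.

Lemma null_bigcup_count (I : countType) (F : I -> set T) :
  (forall k, mu (F k) = 0) -> mu (\bigcup_k F k) = 0.
Proof.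
move=> F0; pose G n := if unpickle n is Some i then F i else set0.
apply: (@null_subset _ (\bigcup_n G n)).
  by move=> x [i _ Fx]; exists (pickle i) => //; rewrite /G pickleK.
by apply: null_bigcup => n; rewrite /G; case: unpickle; rewrite ?outer_measure0.
Qed.

Lemma null_setU (A B : set T) : mu A = 0 -> mu B = 0 -> mu (A `|` B) = 0.
Proof.
move=> A0 B0; apply/eqP; rewrite eq_le outer_measure_ge0 andbT.
by apply: le_trans (outer_measureU2 _ _ _) _; rewrite A0 B0 adde0.
Qed.

Lemma null_caratheodory (A : set T) : mu A = 0 -> mu.-caratheodory A.
Proof.
move=> A0; apply: le_caratheodory_measurable => X.
rewrite (_ : mu (X `&` A) = 0) ?add0e; last by apply: null_subset A0 => x [].
by apply: le_outer_measure => x [].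
Qed.

End null_sets.

(** The number of integers in an open interval. The induction needs the auxiliary bound [cA], which
    says that those already counted below [n] number at most [n - al] when this is nonnegative. *)
Lemma count_between {R : realType} (al be : R) (N : nat) : al <= be ->
  \sum_(j < N) ((al < j%:R < be)%R : nat)%:R <= be - al + 1 :> R.
Proof.
move=> ab; pose c n : R := \sum_(j < n) ((al < j%:R < be)%R : nat)%:R.
rewrite -/(c N).
have cA n : c n <= Num.max 0 (n%:R - al).
  elim: n => [|n IH]; first by rewrite /c big_ord0 le_max lexx.
  rewrite /c big_ord_recr /= -/(c n) -natr1.
  have [/andP[h1 h2]|_] := boolP (al < n%:R < be).
    by move: IH; rewrite !le_max => /orP[]/= ?; apply/orP; right; lra.
  by rewrite addr0; apply: le_trans IH _; rewrite ge_max !le_max lexx/=; apply/orP; right; lra.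
elim: N => [|n IH]; first by rewrite /c big_ord0; lra.
rewrite /c big_ord_recr /= -/(c n).
have [/andP[h1 h2]|_] := boolP (al < n%:R < be); last by rewrite addr0.
by have := cA n; rewrite le_max => /orP[]/= ?; lra.
Qed.

Section lebesgue_density.
Context {R : realType} {m : nat}.
Hypothesis m0 : (0 < m)%N.
Implicit Types (a b x : 'cV[R]_m) (A B E : set 'cV[R]_m).
Notation leb := (@lebesgue_outer R m).

(** By compactness finitely many boxes of a cover suffice. The cube contains [N ^ m] points of a
    grid of mesh [s / N], and a box contains at most the product of [N / s] times its sides, each
    increased by 1. Multiplying by the cell volume and letting the mesh tend to 0 compares the
    volumes. *)
Lemma leb_cube_ge x (s : R) : 0 < s ->
  ((s ^+ m)%:E <= leb (cbox x (x + const_mx s)))%E.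
Proof.
move=> s0; set Q := cbox _ _; apply: lee_ltP => M /(leb_coverP m0)[a [b [ab Qab S]]].
have cQ : compact Q.
  apply: cV_bounded_closed_compact; last exact: cbox_closed.
  apply/bounded_setP; exists (`|x| + s) => y Qy; apply/mx_norm_leP.
    by rewrite addr_ge0 ?normr_ge0// ltW.
  move=> i j; rewrite ord1; have := Qy i; rewrite !mxE => /andP[h1 h2].
  have := entry_le_norm x i 0; rewrite !ler_norml => /andP[? ?].
  by apply/andP; split; lra.
move: cQ; rewrite compact_cover => /(_ nat setT (fun k => obox (a k) (b k))).
move=> /(_ (fun k _ => @obox_open _ _ _ _) Qab)[D' _ QD].
pose n := (\max_(k <- finmap.enum_fset D') k).+1.
have {}QD : Q `<=` \bigcup_(k in `I_n) obox (a k) (b k).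
  move=> y /QD[k /= kD ky]; exists k => //=.
  by rewrite ltnS (leq_bigmax_seq k).
suff H : s ^+ m <= \sum_(k < n) vol (a k) (b k).
  apply: le_trans (ltW S); apply: le_trans (nneseries_lim_ge n _); last first.
    by move=> k _ _; rewrite lee_fin vol_ge0.
  by rewrite big_mkord sumEFin lee_fin.
pose p : {poly R} := \sum_(k < n) \prod_i ((b k i 0 - a k i 0)%:P + 'X).
have pE t : p.[t] = \sum_(k < n) \prod_i (b k i 0 - a k i 0 + t).
  by rewrite horner_sum; apply: eq_bigr => k _; rewrite horner_prod_addX.
have -> : \sum_(k < n) vol (a k) (b k) = p.[0].
  by rewrite pE; apply: eq_bigr => k _; apply: eq_bigr => i _; rewrite addr0.
apply: le_horner0 => e e0.
pose N := (Num.truncn (s / e)).+1.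
have N0 : 0 < N%:R :> R by rewrite ltr0n.
exists (s / N%:R); split; first by rewrite divr_gt0.
  by rewrite ltr_pdivrMr// mulrC -ltr_pdivrMr// truncnS_gt.
rewrite pE.
pose pt (f : {ffun 'I_m -> 'I_N}) : 'cV[R]_m := \col_i (x i 0 + s * (f i)%:R / N%:R).
have ptQ f : Q (pt f).
  move=> i; rewrite !mxE lerDl lerD2l; apply/andP; split.
    by rewrite divr_ge0 ?mulr_ge0 ?ler0n// ltW.
  by rewrite ler_pdivrMr// ler_pM2l// ler_nat ltnW.
(* Every grid point lies in some box, so the sum over the boxes of their numbers of grid points is
   at least the number of grid points. The indicator is written as a product over coordinates to
   make the sum over the grid factor. *)
have H1 : (N%:R ^+ m : R) <= \sum_(f : {ffun 'I_m -> 'I_N}) \sum_(k < n)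
    \prod_i ((a k i 0 < x i 0 + s * (f i)%:R / N%:R < b k i 0)%R : nat)%:R.
  have -> : (N%:R ^+ m : R) = \sum_(f : {ffun 'I_m -> 'I_N}) 1.
    by rewrite sumr_const card_ffun !card_ord natrX.
  apply: ler_sum => f _; have [k /= kn kf] := QD _ (ptQ f).
  rewrite (bigD1 (Ordinal kn))//= big1 => [|i _]; last first.
    by have := kf i; rewrite mxE => ->.
  by rewrite lerDl; apply: sumr_ge0 => j _; apply: prodr_ge0 => i _; rewrite ler0n.
rewrite exchange_big /= in H1.
have Ns0 : 0 < N%:R / s by rewrite divr_gt0.
rewrite -(ler_pM2l (exprn_gt0 m Ns0)) -exprMn divfK ?gt_eqF//.
apply: le_trans H1 _; rewrite mulr_sumr; apply: ler_sum => k _.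
rewrite -(bigA_distr_bigA (fun i (j : 'I_N) =>
  ((a k i 0 < x i 0 + s * j%:R / N%:R < b k i 0)%R : nat)%:R)).
rewrite -[X in _ ^+ X](card_ord m) -prodr_const -big_split /=.
apply: ler_prod => i _; apply/andP; split; first by apply: sumr_ge0.
have := @count_between R ((a k i 0 - x i 0) * (N%:R / s)) ((b k i 0 - x i 0) * (N%:R / s)) N.
rewrite ler_pM2r// lerD2r => /(_ (ab k i)).
have -> : N%:R / s * (b k i 0 - a k i 0 + s / N%:R) =
   (b k i 0 - x i 0) * (N%:R / s) - (a k i 0 - x i 0) * (N%:R / s) + 1.
  by field; rewrite !gt_eqF.
apply: le_trans; rewrite le_eqVlt; apply/orP; left; apply/eqP.
apply: eq_bigr => j _; congr (nat_of_bool _)%:R.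
have E1 y : (y - x i 0) * (N%:R / s) < j%:R = (y < x i 0 + s * j%:R / N%:R).
  rewrite mulrA ltr_pdivrMr// -ltr_pdivlMr// ltrBlDl.
  by rewrite [j%:R * s]mulrC.
have E2 y : j%:R < (y - x i 0) * (N%:R / s) = (x i 0 + s * j%:R / N%:R < y).
  rewrite mulrA ltr_pdivlMr// -ltr_pdivrMr// ltrBrDl.
  by rewrite [j%:R * s]mulrC.
by rewrite E1 E2.
Qed.

Lemma ball_cbox x (r : R) : 0 < r -> ball x r `<=` cbox (x - const_mx r) (x + const_mx r).
Proof.
move=> r0 y; rewrite -ball_normE /= => /ltW xy i.
have := le_trans (entry_le_norm _ i 0) xy; rewrite !mxE ler_norml => /andP[? ?].
by apply/andP; split; lra.
Qed.

Lemma leb_ball_le x (r : R) : 0 < r -> (leb (ball x r) <= ((2 * r) ^+ m)%:E)%E.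
Proof.
move=> r0; apply: le_trans (le_outer_measure _ _ _ (ball_cbox r0)) _.
apply: le_trans (leb_cbox_le _) _; first by move=> i; rewrite !mxE; lra.
rewrite lee_fin /vol (eq_bigr (fun=> 2 * r)) ?prodr_const ?card_ord//.
by move=> i _; rewrite !mxE; ring.
Qed.

Lemma leb_affine_preimage x (r M : R) A : 0 < r -> (leb A < M%:E)%E ->
  (leb [set y : 'cV[R]_m | A (x + r *: y)%R] <= (M / r ^+ m)%:E)%E.
Proof.
move=> r0 /(leb_coverP m0)[a [b [ab Aab S]]].
pose a' k := r^-1 *: (a k - x); pose b' k := r^-1 *: (b k - x).
have ab' k i : a' k i 0 <= b' k i 0.
  by rewrite !mxE ler_pM2l ?invr_gt0// lerD2r.
apply: (@le_trans _ _ (\sum_(k <oo) leb (obox (a' k) (b' k)))%E).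
  apply: outer_measure_cover => y /= /Aab[k _ ky]; exists k => // i.
  have := ky i; rewrite !mxE => /andP[h1 h2].
  rewrite ![r^-1 * _]mulrC ltr_pdivrMr// ltr_pdivlMr//.
  by rewrite ltrBlDl ltrBrDl [y i 0 * r]mulrC h1.
apply: (@le_trans _ _ (\sum_(k <oo) ((r ^- m)%:E * (vol (a k) (b k))%:E))%E).
  apply: lee_nneseries => [k _ _|k _]; first exact: leb_ge0.
  apply: le_trans (leb_obox_le (ab' k)) _; rewrite -EFinM lee_fin.
  rewrite /vol -exprVn -[X in _ ^+ X](card_ord m) -prodr_const -big_split /=.
  apply: ler_prod => i _; rewrite !mxE -mulrBr opprB addrA subrK lexx andbT.
  by rewrite mulr_ge0 ?invr_ge0 ?subr_ge0 ?ab// ltW.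
rewrite nneseriesZl; last by move=> k _; rewrite lee_fin vol_ge0.
by rewrite mulrC EFinM lee_pmul2l ?lte_fin ?invr_gt0 ?exprn_gt0 ?ltW.
Qed.

(** Vitali's greedy selection by induction on the number of balls. The largest ball is removed with
    all those meeting it, which lie in its threefold dilate, a cube of side [6 * p.2]. The dilate is
    paid for by the part of [X] in the ball, and the remaining balls keep their share of what is
    left of [X]. *)
Lemma vitali_sum (s : seq ('cV[R]_m * R)) (X : set 'cV[R]_m) (k : R) : 0 <= k ->
  (forall p, p \in s -> 0 < p.2 /\
    (((6 * p.2) ^+ m)%:E <= k%:E * leb (X `&` ball p.1 p.2))%E) ->
  (leb (\bigcup_(p in [set` s]) ball p.1 p.2) <= k%:E * leb X)%E.
Proof.
move=> k0; have [n sn] := ubnP (size s); elim: n s sn X => // n IH s sn X Hs.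
have [->|s0] := eqVneq s [::].
  rewrite (_ : \bigcup_(_ in _) _ = set0) ?outer_measure0 ?mule_ge0 ?leb_ge0//.
  by apply/seteqP; split => // x [].
have [p ps pmax] : exists2 p, p \in s & forall q, q \in s -> q.2 <= p.2.
  elim: s s0 {sn Hs} => // q s IHs _.
  have [->|/IHs[p ps pmax]] := eqVneq s [::].
    by exists q; rewrite ?mem_head// => q'; rewrite inE => /eqP ->.
  have [qp|pq] := leP q.2 p.2.
    exists p; first by rewrite inE ps orbT.
    by move=> q'; rewrite inE => /orP[/eqP->//|/pmax].
  exists q; first by rewrite mem_head.
  move=> q'; rewrite inE => /orP[/eqP->//|/pmax h].
  by apply: le_trans h (ltW pq).
have [p0 pX] := Hs _ ps.
pose d (q : 'cV[R]_m * R) := `[< ball q.1 q.2 `&` ball p.1 p.2 = set0 >].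
pose s' := [seq q <- s | d q].
have ndp : ~~ d p.
  apply/asboolPn => /seteqP[+ _] => /(_ p.1); apply.
  by split; apply: ballxx.
have ss' : (size s' < n)%N.
  rewrite -ltnS; apply: leq_trans sn; rewrite ltnS size_filter.
  rewrite -(count_predC d s) -[X in (X < _)%N]addn0 ltn_add2l -has_count.
  by apply/hasP; exists p.
have mB : leb.-caratheodory (ball p.1 p.2).
  by apply: leb_open_measurable => //; exact: ball_open.
have := IH s' ss' (X `\` ball p.1 p.2); move=> /(_ _)IHs'.
apply: (@le_trans _ _ (leb (ball p.1 (3 * p.2)) + leb (\bigcup_(q in [set` s']) ball q.1 q.2))%E).
  apply: le_trans (outer_measureU2 _ _ _); apply: le_outer_measure.
  move=> x [q /= qs qx]; have [dq|/asboolPn/eqP/set0P[y [qy py]]] := boolP (d q).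
    by right; exists q => //=; rewrite mem_filter dq.
  left; move: qx qy py; rewrite -!ball_normE /= => qx qy py.
  have := pmax _ qs.
  rewrite -(subrKA y) -[y - x](subrKA q.1) => qp.
  apply: le_lt_trans (ler_normD _ _) _.
  have := ler_normD (y - q.1) (q.1 - x); rewrite (distrC y q.1).
  by move: qx qy py; lra.
rewrite (mB X) muleDr ?ge0_adde_def ?inE ?leb_ge0//; apply: leeD.
  apply: le_trans (leb_ball_le _ _) _; first by rewrite mulr_gt0.
  by apply: le_trans pX; rewrite lee_fin mulrA (_ : 2 * 3 = 6 :> R)// -natrM.
apply: IHs' => q; rewrite mem_filter => /andP[/asboolP dq qs].
have [q0 qX] := Hs _ qs; split => //; apply: le_trans qX _.
rewrite lee_wpmul2l ?lee_fin//; apply: le_outer_measure => x [Xx qx].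
by split => //; split => // px; have : set0 x by rewrite -dq.
Qed.

Definition density_point E x := forall e, 0 < e ->
  exists2 d, 0 < d & forall r, 0 < r -> r < d ->
    (leb (ball x r `\` E) < (e * r ^+ m)%:E)%E.

(** At a point of [E] where density fails, arbitrarily small balls contain a fixed fraction outside
    [E]. They can be kept inside an open [U] containing a bounded part of [E] with [U] minus [E]
    small; the Vitali estimate then bounds the union of the balls by a multiple of the measure of
    [U] minus [E]. *)
Theorem leb_density E : closed E -> leb [set x | E x /\ ~ density_point E x] = 0%E.
Proof.
move=> cE.
pose Z (jM : nat * nat) : set 'cV[R]_m := [set x | [/\ E x, `|x| <= jM.2%:R &
  forall d, 0 < d -> exists r, [/\ 0 < r, r < d &
   ((jM.1.+1%:R^-1 * r ^+ m)%:E <= leb (ball x r `\` E))%E]]].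
apply: (@null_subset _ _ leb _ (\bigcup_jM Z jM)).
  move=> x [Ex /existsNP[e /not_implyP[e0 h]]].
  exists (Num.truncn e^-1, (Num.truncn `|x|).+1) => //; split => //=.
    exact/ltW/truncnS_gt.
  move=> d d0; apply: contrapT => h2; apply: h; exists d => // r r0 rd.
  rewrite ltNge; apply/negP => er; apply: h2; exists r; split => //.
  apply: le_trans er; rewrite lee_fin ler_pM2r ?exprn_gt0//.
  by rewrite invf_ple ?posrE// ltW// truncnS_gt.
apply: null_bigcup_count => -[j M].
apply/eqP; rewrite eq_le leb_ge0 andbT; apply/lee_addgt0Pr => eta eta0; rewrite add0e.
(* This factor turns [r ^+ m / j.+1 <= leb (ball x r \ E)] into the hypothesis of [vitali_sum] on
   the threefold dilates. *)
pose k : R := 6 ^+ m * j.+1%:R.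
have k0 : 0 < k by rewrite mulr_gt0 ?exprn_gt0.
pose EM := E `&` cbox (const_mx (- M%:R)) (const_mx M%:R).
have bEM : bounded_set EM.
  apply/bounded_setP; exists M%:R => x [_ Qx]; apply/mx_norm_leP => // i c.
  by rewrite ord1 ler_norml; have := Qx i; rewrite !mxE.
have cEM : leb.-caratheodory EM.
  by apply: leb_closed_measurable => //; apply: closedI => //; exact: cbox_closed.
have fEM : leb EM \is a fin_num by rewrite ge0_fin_numE ?leb_ge0// leb_bounded.
have [U [oU EU Ulow]] : exists U, [/\ open U, EM `<=` U &
    (leb U < leb EM + (eta / k)%:E)%E].
  by apply: leb_outer_regular => //; rewrite -(fineK fEM) -EFinD lte_fin ltrDl divr_gt0.
have UE : (leb (U `\` E) <= (eta / k)%:E)%E.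
  apply: (@le_trans _ _ (leb (U `\` EM))).
    by apply: le_outer_measure => x [Ux Ex]; split => // -[].
  move: Ulow; rewrite (cEM U) setIidr// -(fineK fEM).
  by rewrite lteD2lE// => /ltW.
have H x : Z (j, M) x -> exists r, [/\ 0 < r, r < 1, ball x r `<=` U &
    (((6 * r) ^+ m)%:E <= k%:E * leb ((U `\` E) `&` ball x r))%E].
  move=> [Ex xM h]; have Ux : U x.
    apply: EU; split => // i; rewrite !mxE -ler_norml.
    by apply: le_trans (entry_le_norm _ _ _) _.
  have /nbhs_ballP[d /= d0 xU] := open_nbhs_nbhs (conj oU Ux).
  have [|r [r0 rd hr]] := h (Num.min d 1); first by rewrite lt_min d0/=.
  move: rd; rewrite lt_min => /andP[rd r1].
  have xrU : ball x r `<=` U by apply: subset_trans xU; apply: le_ball; exact: ltW.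
  exists r; split => //.
  rewrite (_ : (U `\` E) `&` ball x r = ball x r `\` E); last first.
    apply/seteqP; split => y; first by move=> [[Uy Ey] xy].
    by move=> [xy Ey]; split => //; split => //; exact: xrU.
  apply: le_trans (lee_wpmul2l _ hr); last by rewrite lee_fin ltW.
  rewrite -EFinM lee_fin /k exprMn -mulrA ler_pM2l ?exprn_gt0//.
  by rewrite mulrA divff ?mul1r ?gt_eqF.
pose rr x : R := xget 1 [set r : R | [/\ 0 < r, r < 1, ball x r `<=` U &
    (((6 * r) ^+ m)%:E <= k%:E * leb ((U `\` E) `&` ball x r))%E] ].
pose B x := ball x (rr x).
pose O := \bigcup_(x in Z (j, M)) B x.
apply: (@le_trans _ _ (leb O)).
  apply: le_outer_measure => x Zx; exists x => //; rewrite /B /rr.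
  by case: xgetP => [r _ [r0 _ _ _]|/(_ _)/= h]; apply: ballxx.
have oO : open O by apply: bigcup_open => x _; exact: ball_open.
(* [O] is a union of possibly uncountably many balls. If it were larger than [eta], so would be some
   compact part of it, which finitely many of the balls cover. *)
rewrite leNgt; apply/negP => lO.
have [K [cK KO]] : exists K, [/\ compact K, K `<=` O & (eta%:E < leb K)%E].
  apply: leb_inner_regular => //; last exact: leb_open_measurable.
  apply/bounded_setP; exists (M%:R + 1) => y [x Zx]; rewrite /B /rr.
  case: xgetP => [r _ [r0 r1 _ _]|]; last by have [r hr] := H _ Zx => /(_ r).
  rewrite -ball_normE /= => xy; have [_ xM _] := Zx.
  rewrite -[y](subrK x) (le_trans (ler_normD _ _))// addrC lerD// distrC ltW//.
  exact: lt_trans r1.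
apply/negP; rewrite -leNgt.
move: cK; rewrite compact_cover.
move=> /(_ _ (Z (j, M)) B (fun x _ => @ball_open _ _ _ _) KO)[D DZ KD].
apply: (@le_trans _ _ (leb (\bigcup_(p in [set` [seq (x, rr x) | x <- finmap.enum_fset D]]) ball p.1 p.2))).
  apply: le_outer_measure => y /KD[x /= xD xy]; exists (x, rr x) => //=.
  exact: map_f.
apply: le_trans (vitali_sum (X := U `\` E) (ltW k0) _) _.
  move=> _ /mapP[x xD ->] /=; have := DZ _ xD; rewrite inE => /H[r hr].
  by rewrite /rr; case: xgetP => [r' _ [h1 h2 h3 h4]|/(_ r)].
apply: le_trans (lee_wpmul2l _ UE) _; first by rewrite lee_fin ltW.
by rewrite -EFinM lee_fin mulrCA divff ?mulr1 ?gt_eqF.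
Qed.

End lebesgue_density.

(** * Rademacher theorem *)

Section lipschitz_derivable.
Context {R : realType}.
Notation mu := (@lebesgue_measure R).

Lemma lebesgue_null_cover (A : set R) (e : R) : mu A = 0%E -> 0 < e ->
  exists F : (set R)^nat, [/\ forall k, ocitv (F k), A `<=` \bigcup_k F k &
    (\sum_(k <oo) wlength idfun (F k) < e%:E)%E].
Proof.
move=> A0 e0; have : (mu A < e%:E)%E by rewrite A0 lte_fin.
rewrite /lebesgue_measure /lebesgue_stieltjes_measure /measure_extension /mu_ext.
move=> /ereal_inf_lt[_ [F [mF AF] <-]] Fe; exists F; split => // k; exact: mF.
Qed.

Variables (f : R -> R) (L : R).
Hypothesis fL : forall x y, `|f x - f y| <= L * `|x - y|.

(** Adding [L * x] makes the function monotone, hence the distribution function of a Stieltjes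
    measure. *)
Let g x := f x + L * x.

Let g_nd : nondecreasing g.
Proof.
move=> x y xy; rewrite /g; have := fL x y.
by rewrite ler_norml (distrC x) (ger0_norm (_ : 0 <= y - x)) ?subr_ge0// => /andP[_ ?]; lra.
Qed.

Let L_ge0 : 0 <= L.
Proof. by have := le_trans (normr_ge0 _) (fL 1 0); rewrite subr0 normr1 mulr1. Qed.

Let f_cont : continuous f.
Proof.
have L1 : 0 < L + 1 by rewrite ltr_wpDl.
move=> x; apply/cvgrPdist_lt => e e0; near=> y.
apply: le_lt_trans (fL _ _) _.
apply: (@le_lt_trans _ _ ((L + 1) * `|x - y|)); first by rewrite ler_wpM2r// lerDl.
rewrite -ltr_pdivlMl//; near: y; apply/nbhs_ballP.
exists ((L + 1)^-1 * e); first by rewrite /= mulr_gt0// invr_gt0.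
by move=> y.
Unshelve. all: by end_near. Qed.

Let g_cont : continuous g.
Proof. by move=> x; apply: cvgD; [exact: f_cont|exact: mulrl_continuous]. Qed.

Let g_rc : right_continuous g.
Proof. by apply: right_continuousW; exact: g_cont. Qed.

HB.instance Definition _ := isCumulative.Build R _ R g g_nd g_rc.
Notation nu := (lebesgue_stieltjes_measure g).

Let nu_oc a b : a <= b -> nu `]a, b]%classic = (g b - g a)%:E.
Proof.
move=> ab; rewrite /lebesgue_stieltjes_measure /measure_extension.
rewrite measurable_mu_extE/=; last exact: is_ocitv.
by rewrite wlength_itv_bnd.
Qed.

Let nu_null A : mu A = 0%E -> nu A = 0%E.
Proof.
move=> A0; apply/eqP; rewrite eq_le outer_measure_ge0 andbT.
apply/lee_addgt0Pr => e e0; rewrite add0e.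
(* The increments of [g] are at most [2 * L] times the length; the extra 1 keeps the factor positive
   when [L = 0]. *)
have e1 : 0 < e / (2 * L + 1) by rewrite divr_gt0// ltr_wpDl// mulr_ge0.
have [F [oF AF Fe]] := lebesgue_null_cover A0 e1.
apply: (@le_trans _ _ (\sum_(k <oo) wlength g (F k))%E).
  by apply: ereal_inf_lbound; exists F.
apply: (@le_trans _ _ (\sum_(k <oo) ((2 * L + 1)%:E * wlength idfun (F k)))%E).
  apply: lee_nneseries => k _; first by move=> _; exact: wlength_ge0.
  have /ocitvP[->|[[a b] /= ab ->]] := oF k; first by rewrite !wlength0 mule0.
  rewrite !wlength_itv_bnd ?(ltW ab)// -EFinM lee_fin /g /=.
  have ba : 0 <= b - a by rewrite subr_ge0 ltW.
  by have := fL b a; rewrite ler_norml (ger0_norm ba) => /andP[_ ?]; lra.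
rewrite nneseriesZl; last by move=> k _; exact: wlength_ge0.
rewrite -[X in (_ <= X)%E](_ : ((2 * L + 1)%:E * (e / (2 * L + 1))%:E = e%:E)%E).
  by rewrite lee_wpmul2l ?(ltW Fe)// lee_fin addr_ge0 ?mulr_ge0.
by rewrite -EFinM mulrCA divff ?mulr1// gt_eqF// ltr_wpDl// mulr_ge0.
Qed.

(** The Stieltjes measure of [g] is absolutely continuous, so [g] is locally the integral of a
    Radon-Nikodym density, and the fundamental theorem of calculus makes it derivable almost
    everywhere. *)
Lemma lipschitz_ae_derivable : {ae mu, forall x, derivable f x 1}.
Proof.
suff H (n : nat) : {ae mu, forall x, `|x| < n%:R -> derivable f x 1}.
  have [N HN] := choice H.
  exists (\bigcup_n N n); split.
  - by apply: bigcup_measurable => n _; have [] := HN n.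
  - apply/eqP; rewrite eq_le measure_ge0 andbT.
    apply: le_trans (measure_sigma_subadditive _ _ _ (@subset_refl _ _)) _.
    + by move=> n; have [] := HN n.
    + by apply: bigcup_measurable => n _; have [] := HN n.
    by rewrite eseries0// => n _ _; have [] := HN n.
  - move=> x dx; exists (Num.truncn `|x|).+1 => //; have [_ _] := HN (Num.truncn `|x|).+1.
    by apply => /(_ (truncnS_gt _)).
(* The Stieltjes measure is restricted to a bounded interval to make it finite, as the Radon-Nikodym
   density is taken for a finite measure. *)
pose D : set (measurableTypeR R) := `]- n%:R, n%:R]%classic.
have mD : measurable D by exact: measurable_itv.
have nn : - n%:R <= n%:R :> R by rewrite ge0_cp.
have Dfin : (nu D < +oo)%E by rewrite /D nu_oc// ltry.
pose nuD := mfrestr mD Dfin.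
have dom : charge_of_finite_measure nuD `<< mu.
  apply/null_content_dominatesP => A mA A0.
  rewrite /charge_of_finite_measure /nuD /mfrestr /mrestr.
  by apply: nu_null; apply: null_subset A0 => x [].
pose d := Radon_Nikodym (charge_of_finite_measure nuD) mu.
have dfin x : d x \is a fin_num by exact: Radon_Nikodym_fin_num.
have dint : mu.-integrable setT d by exact: Radon_Nikodym_integrable.
have dE : EFin \o (fine \o d) = d by apply/funext => x /=; rewrite fineK.
have := @FTC1 R (fine \o d) (BRight (- n%:R)).
rewrite dE => FTC; have {}FTC := FTC _ _.
have int1 (A : set (measurableTypeR R)) : measurable A -> mu.-integrable A d.
  by move=> mA; apply: integrableS dint.
have {}FTC := FTC (fun y => int1 _ (measurable_itv _)).
have loc : locally_integrable [set: R] (fine \o d).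
  by apply: open_integrable_locally; [exact: openT|rewrite dE].
have {}FTC := FTC loc.
move: FTC; apply: filterS; first exact: (ae_filter_ringOfSetsType mu).
move=> x Hx xn; have [nx xn'] : - n%:R < x /\ x < n%:R by apply/andP; rewrite -ltr_norml.
have [] := Hx nx.
set F := fun y : R => _ => dF _.
have FE y : - n%:R < y -> y < n%:R -> F y = g y - g (- n%:R).
  move=> ny yn; rewrite /F /Rintegral.
  have -> : (fun t => ((fine \o d) t)%:E) = d := dE.
  rewrite -Radon_Nikodym_integral; [|exact: dom|exact: measurable_itv].
  rewrite -[X in fine X]/(nu (`]- n%:R, y]%classic `&` D)) setIidl.
    by rewrite nu_oc// ltW.
  by move=> t; rewrite /D /= !in_itv/= => /andP[-> /le_trans]; apply; exact: ltW.
have dg : derivable g x 1.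
  have : derivable (F \+ cst (g (- n%:R))) x 1 by apply: derivableD.
  apply: near_eq_derivable; near=> y; rewrite /= FE ?subrK//.
    by near: y; exact: lt_nbhsr.
  by near: y; exact: lt_nbhsl.
have -> : f = g - (fun y => L * y).
  by apply/funext => y; rewrite /g !fctE addrK.
apply: derivableB => //; apply: derivableM => //.
Unshelve. all: by end_near. Qed.

End lipschitz_derivable.

Lemma sum_cst_seq {R : nmodType} {I : Type} (l : seq I) (x : R) :
  \sum_(c <- l) x = x *+ size l.
Proof. by elim: l => [|a l IH]; rewrite ?big_nil ?big_cons//= IH mulrS. Qed.

(** * A compact set with null sections is null *)

Section null_sections.
Context {R : realType} {m : nat}.
Hypothesis m0 : (0 < m)%N.
Notation leb := (@lebesgue_outer R m).
Notation mu := (@lebesgue_measure R).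
Notation e_ := (fun i : 'I_m => delta_mx i 0 : 'cV[R]_m).

Lemma lebesgue_null_open_cover (A : set R) (e : R) : mu A = 0%E -> 0 < e ->
  exists a b : nat -> R, [/\ forall k, a k <= b k,
    A `<=` \bigcup_k `]a k, b k[%classic &
    (\sum_(k <oo) (b k - a k)%:E <= e%:E)%E].
Proof.
move=> A0 e0; have e2 : 0 < e / 2 by rewrite divr_gt0.
have [F [oF AF Fe]] := lebesgue_null_cover A0 e2.
have d0 k : 0 < e / 2 / (2 ^ k.+1)%:R :> R by rewrite divr_gt0// ltr0n expn_gt0.
have H k : exists ab : R * R, [/\ ab.1 <= ab.2, F k `<=` `]ab.1, ab.2[%classic &
    ((ab.2 - ab.1)%:E <= wlength idfun (F k) + (e / 2 / (2 ^ k.+1)%:R)%:E)%E].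
  have /ocitvP[->|[[a b] /= ab ->]] := oF k.
    by exists (0, 0); split => //=; rewrite wlength0 add0e subrr lee_fin ltW.
  exists (a, b + e / 2 / (2 ^ k.+1)%:R); split => /=.
  - by have := d0 k; lra.
  - move=> x /=; rewrite !in_itv/= => /andP[-> h] /=.
    by apply: le_lt_trans h _; rewrite ltrDl.
  - by rewrite wlength_itv_bnd ?(ltW ab)//= -EFinD lee_fin addrAC.
have {H}[f Hf] := choice H.
exists (fun k => (f k).1), (fun k => (f k).2); split.
- by move=> k; have [] := Hf k.
- by move=> x /AF[k _ Fk]; exists k => //; have [_ + _] := Hf k; exact.
- have w0 k : (0 <= wlength idfun (F k) :> \bar R)%E by exact: wlength_ge0.
  apply: (@le_trans _ _ (\sum_(k <oo) (wlength idfun (F k) + (e / 2 / (2 ^ k.+1)%:R)%:E))%E).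
    apply: lee_nneseries => [k _ _|k _]; last by have [] := Hf k.
    by rewrite lee_fin subr_ge0; have [] := Hf k.
  apply: le_trans (epsilon_trick xpredT w0 (ltW e2)) _.
  by apply: le_trans (leeD2r _ (ltW Fe)) _; rewrite -EFinD -splitr.
Qed.

(** The part of Fubini's theorem that Rademacher's theorem requires. By compactness an open cover of
    one section also covers all neighbouring sections, with a width [d] of the neighbourhood that is
    uniform over [K]. In thin columns parallel to the axis [i] the set then lies in slabs of total
    height at most [e]. *)
Lemma null_sections (K : set 'cV[R]_m) (i : 'I_m) : compact K ->
  (forall x, mu [set t | K (x + t *: e_ i)] = 0%E) -> leb K = 0%E.
Proof.
move=> cK K0.
have bK : bounded_set K by exact: compact_bounded.
have /bounded_setP[M KM] := bK.
pose W := 2 * (`|M| + 1).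
have W0 : 0 < W by rewrite mulr_gt0// ltr_wpDl.
pose P (ed : R * R) (p : 'cV[R]_m) := exists a b : nat -> R, [/\ forall k, a k <= b k,
  (\sum_(k <oo) (b k - a k)%:E <= ed.1%:E)%E &
  forall z, K z -> (forall j, j != i -> `|z j 0 - p j 0| <= ed.2) ->
    exists k, a k < z i 0 < b k].
have unif e : 0 < e -> exists2 d, 0 < d & forall p, K p -> P (e, d) p.
  move=> e0.
  have : \forall d \near 0^'+, K `<=` P (e, d).
    move: (cK) => /compact_near_coveringP; apply => x Kx.
    have [a [b [ab Sab sum]]] := lebesgue_null_open_cover (K0 (x - x i 0 *: e_ i)) e0.
    (* The points of [K] that the intervals chosen at [x] fail to cover. They form a compact set
       disjoint from the line through [x], hence at positive distance from it. *)
    pose K' := K `&` ~` [set z | exists k, a k < z i 0 < b k].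
    have oV : open [set z : 'cV[R]_m | exists k, a k < z i 0 < b k].
      rewrite (_ : mkset _ =
          (fun z : 'cV[R]_m => z i 0) @^-1` (\bigcup_k `]a k, b k[%classic)).
        apply: open_comp; first by move=> z _; exact: coord_continuous.
        by apply: bigcup_open => k _; exact: interval_open.
      apply/seteqP; split => z /=.
        by move=> [k kz]; exists k => //=; rewrite in_itv.
      by move=> [k _]/=; rewrite in_itv/= => kz; exists k.
    have cK' : compact K'.
      apply: (subclosed_compact _ cK); last by move=> z [].
      apply: closedI; last exact: open_closedC.
      by apply: compact_closed => //; exact: norm_hausdorff.
    (* The component of [z - x] transverse to the axis [i], which measures the distance to the line
       through [x]. *)
    pose h (z : 'cV[R]_m) := z - x - (z i 0 - x i 0) *: e_ i.
    have hE z j : h z j 0 = if j == i then 0 else z j 0 - x j 0.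
      rewrite !mxE eqxx andbT; case: (j =P i) => [->|_]; rewrite ?mulr1 ?mulr0 ?subr0//.
      by rewrite subrr.
    have hc z y : `|h z - h y| <= `|z - y|.
      apply/mx_norm_leP => // j c; rewrite ord1 !mxE eqxx andbT.
      have := entry_le_norm (z - y) j 0; rewrite !mxE; apply: le_trans.
      case: (j =P i) => [->|_]; last by rewrite !mulr0 !subr0 opprB addrA subrK.
      by rewrite !mulr1 (_ : _ - _ = 0) ?normr0//; ring.
    have : \forall d \near 0^'+, K' `<=` [set z | d < `|h z|].
      move: (cK') => /compact_near_coveringP; apply => z [Kz nz].
      have hz : 0 < `|h z|.
        rewrite normr_gt0; apply/negP => /eqP hz0; apply: nz.
        have : [set t | K (x - x i 0 *: e_ i + t *: e_ i)] (z i 0).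
          rewrite /= (_ : _ + _ = z) //.
          apply/matrixP => j c; rewrite ord1.
          have := congr1 (fun A : 'cV[R]_m => A j 0) hz0; rewrite hE !mxE eqxx andbT.
          case: (j =P i) => [->|_]; first by rewrite !mulr1 subrr add0r.
          by rewrite !mulr0 subr0 addr0 => /eqP; rewrite subr_eq0 => /eqP.
        by move=> /Sab[k _]/=; rewrite in_itv/= => ?; exists k.
      have hz2 : 0 < `|h z| / 2 by rewrite divr_gt0.
      near=> z' d => /=.
      have : `|z - z'| < `|h z| / 2 by near: z'; apply/nbhs_ballP; exists (`|h z| / 2) => // y; rewrite -ball_normE.
      have : d < `|h z| / 2 by near: d; apply: nbhs_right_lt.
      have := hc z z'; have := ler_normD (h z - h z') (h z'); rewrite subrK.
      by lra.
    move=> Kd; near_simpl.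
    have [d0 d00 Kd0] : exists2 d, 0 < d & K' `<=` [set z | d < `|h z|].
      near (0 : R)^'+ => d; exists d; last by near: d.
      by near: d; exact: nbhs_right_gt.
    have d02 : 0 < d0 / 2 by rewrite divr_gt0.
    near=> x' d; exists a, b; split => // z Kz zx'.
    apply: contrapT => nz; have /Kd0 /= := conj Kz nz.
    apply/negP; rewrite -leNgt; apply/mx_norm_leP; first exact: ltW.
    move=> j c; rewrite ord1 hE; case: eqP => [_|/eqP ji]; first by rewrite normr0 ltW.
    have := zx' j ji; rewrite /= => h1.
    have h2 : `|x - x'| < d0 / 2 by near: x'; apply/nbhs_ballP; exists (d0 / 2) => // y; rewrite -ball_normE.
    have h3 := le_lt_trans (entry_le_norm _ j 0) h2; rewrite !mxE in h3.
    have h4 : d < d0 / 2 by near: d; apply: nbhs_right_lt.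
    rewrite -(subrKA (x' j 0)); apply: le_trans (ler_normD _ _) _.
    by move: h3; rewrite distrC; lra.
  move=> nd; near (0 : R)^'+ => d; exists d; last by near: d.
  by near: d; exact: nbhs_right_gt.
suff H e : 0 < e -> (leb K <= (e * \prod_(j | j != i) W)%:E)%E.
  have V0 : 0 < \prod_(j < m | j != i) W by apply: prodr_gt0.
  apply/eqP; rewrite eq_le leb_ge0 andbT; apply/lee_addgt0Pr => e e0; rewrite add0e.
  apply: le_trans (H (e / \prod_(j < m | j != i) W) _) _; first by rewrite divr_gt0.
  by rewrite divfK// gt_eqF.
move=> e0; have [d d0 Pd] := unif e e0.
pose N := (Num.truncn (W / d)).+1.
have N0 : 0 < N%:R :> R by rewrite ltr0n.
(* The cells are not subdivided along the axis [i]: there the intervals of the cover do the work. *)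
pose n j := if j == i then 1%N else N.
pose s : 'cV[R]_m := \col_j (W / (n j)%:R).
have n0 j : 0 < (n j)%:R :> R by rewrite ltr0n /n; case: ifP.
have s0 j : 0 < s j 0 by rewrite mxE divr_gt0.
have sd j : j != i -> s j 0 <= d.
  move=> ji; rewrite mxE /n (negbTE ji) ler_pdivrMr// mulrC -ler_pdivrMr//.
  exact/ltW/truncnS_gt.
have [x j Kx|l [sl lP]] := @grid_cover _ _ (const_mx (- (`|M| + 1))) s n K s0.
  rewrite !mxE mulrCA divff ?gt_eqF// mulr1.
  have := le_trans (entry_le_norm x j 0) (KM _ Kx).
  by rewrite ler_norml => /andP[? ?]; have := ler_norm M; rewrite /W; lra.
apply: le_trans (_ : _ <= \sum_(c <- l) leb (K `&` cbox c (c + s)))%E _.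
  apply: outer_measure_fin => x Kx; have [c cl cx] := lP _ Kx.
  by exists c; rewrite ?cl//; split => // j; rewrite mxE.
have colE c : (leb (K `&` cbox c (c + s)) <= (e * \prod_(j | j != i) s j 0)%:E)%E.
  have V0 : 0 < \prod_(j < m | j != i) s j 0 by apply: prodr_gt0.
  have [->|/set0P[p [Kp cp]]] := eqVneq (K `&` cbox c (c + s)) set0.
    by rewrite outer_measure0 lee_fin mulr_ge0 ?ltW.
  have [a [b /= [ab sab Kab]]] := Pd _ Kp.
  pose lo k : 'cV[R]_m := \col_j if j == i then a k else c j 0.
  pose hi k : 'cV[R]_m := \col_j if j == i then b k else c j 0 + s j 0.
  apply: (@le_trans _ _ (\sum_(k <oo) leb (cbox (lo k) (hi k)))%E).
    apply: outer_measure_cover => z [Kz cz].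
    have [|k kz] := Kab z Kz.
      move=> j ji; have := cz j; have := cp j; have := sd j ji.
      rewrite [(c + s) j 0]mxE ler_norml => ? /andP[? ?] /andP[? ?].
      by apply/andP; split; lra.
    exists k => // j; rewrite !mxE; case: eqP => [->|_].
      by have /andP[? ?] := kz; rewrite !ltW.
    by have := cz j; rewrite !mxE.
  apply: (@le_trans _ _ (\sum_(k <oo) ((\prod_(j < m | j != i) s j 0)%:E * (b k - a k)%:E))%E).
    apply: lee_nneseries => [k _ _|k _]; first exact: leb_ge0.
    apply: le_trans (leb_cbox_le _) _.
      by move=> j; rewrite !mxE; case: ifP => // _; have := s0 j; rewrite mxE; lra.
    rewrite -EFinM lee_fin /vol (bigD1 i)//= mulrC !mxE eqxx.
    rewrite (eq_bigr (fun j => s j 0))// => j /negbTE ji.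
    by rewrite !mxE ji addrAC subrr add0r.
  rewrite nneseriesZl; last by move=> k _; rewrite lee_fin subr_ge0.
  by rewrite mulrC EFinM lee_wpmul2l// lee_fin ltW.
apply: le_trans (lee_sum _ (fun c _ => colE c)) _.
rewrite sumEFin lee_fin sum_cst_seq sl.
rewrite -[X in X <= _]mulr_natl (bigD1 i)//= /n eqxx mul1n natr_prod mulrCA -big_split /=.
rewrite ler_pM2l// le_eqVlt; apply/orP; left; apply/eqP.
apply: eq_bigr => j /negbTE ji; rewrite mxE /n ji.
by rewrite mulrCA divff ?gt_eqF// mulr1.
Unshelve. all: by end_near. Qed.

End null_sections.

Section continuity.
Context {R : realType} {V W : normedModType R}.
Implicit Types f g : V -> W.

Lemma lipschitz_continuous f (L : R) :
  (forall x y, `|f x - f y| <= L * `|x - y|) -> continuous f.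
Proof.
move=> fL x; apply/cvgrPdist_lt => e e0; apply/nbhs_ballP.
have L1 : 0 < `|L| + 1 by rewrite ltr_wpDl.
exists ((`|L| + 1)^-1 * e); first by rewrite /= mulr_gt0// invr_gt0.
move=> y; rewrite -ball_normE /= ltr_pdivlMl// => xy.
apply: le_lt_trans (fL _ _) _; apply: le_lt_trans xy.
by rewrite ler_wpM2r// (le_trans (ler_norm _))// lerDl.
Qed.

Lemma continuousBf f g : continuous f -> continuous g ->
  continuous (fun x => f x - g x).
Proof. by move=> fc gc x; apply: cvgB; [exact: fc|exact: gc]. Qed.

Lemma continuousZl (c : R) f : continuous f -> continuous (fun x => c *: f x).
Proof. by move=> fc x; apply: cvgZl_tmp; exact: fc. Qed.

Lemma continuous_shift f (h : V) : continuous f -> continuous (fun x => f (x + h)).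
Proof.
move=> fc x; apply: (@continuous_comp _ _ _ (fun x => x + h) f); last exact: fc.
by apply: cvgD; [exact: cvg_id|exact: cvg_cst].
Qed.

Lemma closed_norm_le f (c : R) : continuous f -> closed [set x | `|f x| <= c].
Proof.
move=> fc; apply: (@closed_comp _ _ (fun x => `|f x|) [set y | y <= c]).
  by move=> x _; apply: continuous_comp; [exact: fc|exact: norm_continuous].
exact: closed_le.
Qed.

End continuity.

Lemma closed_forall (T : topologicalType) (I : Type) (P : I -> T -> Prop) :
  (forall i, closed [set x | P i x]) -> closed [set x | forall i, P i x].
Proof.
move=> h; rewrite (_ : mkset _ = \bigcap_(i in [set: I]) [set x | P i x]).
  by apply: closed_bigI => i _; exact: h.
by apply/seteqP; split => x /= px i; [move=> _|]; apply: px.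
Qed.

Section rademacher.
Context {R : realType} {m n : nat}.
Hypothesis m0 : (0 < m)%N.
Notation leb := (@lebesgue_outer R m).
Notation mu := (@lebesgue_measure R).
Notation e_ := (fun i : 'I_m => delta_mx i 0 : 'cV[R]_m).
Variables (v : 'cV[R]_m -> 'cV[R]_n) (L : R).
Hypothesis vL : forall x y, `|v x - v y| <= L * `|x - y|.

Lemma lipL_ge0 : 0 <= L.
Proof.
have := le_trans (normr_ge0 _) (vL (const_mx 1) 0); rewrite subr0.
rewrite pmulr_lge0// normr_gt0; apply/eqP => /matrixP/(_ (Ordinal m0) 0).
by rewrite !mxE; apply/eqP; rewrite oner_eq0.
Qed.

Lemma lip_continuous : continuous v.
Proof. exact: lipschitz_continuous vL. Qed.

Definition dquot (i : 'I_m) (t : R) x := t^-1 *: (v (x + t *: e_ i) - v x).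

(** The Cauchy condition on difference quotients instead of the existence of their limit: for fixed
    tolerance and radius it is an intersection of closed conditions, so the set of points with a
    partial derivative is visibly Borel. The pairs of steps form a type so that the intersection has
    a single index. *)
Definition cauchy_dquot (i : 'I_m) (j k : nat) : set 'cV[R]_m :=
  [set x | forall st : {st : R * R | [&& 0 < `|st.1|, `|st.1| < k.+1%:R^-1,
     0 < `|st.2| & `|st.2| < k.+1%:R^-1]},
     `|dquot i (sval st).1 x - dquot i (sval st).2 x| <= j.+1%:R^-1].

Lemma dquot_continuous i t : continuous (dquot i t).
Proof.
apply: continuousZl; apply: continuousBf; last exact: lip_continuous.
exact: continuous_shift lip_continuous.
Qed.

Lemma cauchy_dquot_closed i j k : closed (cauchy_dquot i j k).
Proof.
apply: closed_forall => st; apply: closed_norm_le.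
by apply: continuousBf; exact: dquot_continuous.
Qed.

Definition partial_ok (i : 'I_m) : set 'cV[R]_m :=
  \bigcap_j \bigcup_k cauchy_dquot i j k.

Lemma derivable_partial_ok i (x : 'cV[R]_m) (t : R) :
  (forall c, derivable (fun s : R => v (x + s *: e_ i) c 0) t 1) ->
  partial_ok i (x + t *: e_ i).
Proof.
move=> dv j _.
have e0 : 0 < (2 * j.+1%:R)^-1 :> R by rewrite invr_gt0.
have H c : \forall h \near 0^', `|'D_1 (fun s : R => v (x + s *: e_ i) c 0) t -
    dquot i h (x + t *: e_ i) c 0| < (2 * j.+1%:R)^-1.
  have /cvgrPdist_lt/(_ _ e0) := dv c.
  apply: filterS => h; rewrite /= /dquot !mxE.
  rewrite (_ : h%:A = h); last by rewrite /GRing.scale /= mulr1.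
  by rewrite [h + t]addrC scalerDl addrA.
have {}H : \forall h \near (0 : R)^', forall c, `|'D_1 (fun s : R => v (x + s *: e_ i) c 0) t -
    dquot i h (x + t *: e_ i) c 0| < (2 * j.+1%:R)^-1.
  exact: filter_forall.
have /nbhs_ballP[d /= d0 Hd] : nbhs (0 : R) [set h | h != 0 -> forall c, `|'D_1 (fun s : R => v (x + s *: e_ i) c 0) t -
    dquot i h (x + t *: e_ i) c 0| < (2 * j.+1%:R)^-1] by exact: H.
exists (Num.truncn d^-1) => // -[[s r] /= /and4P[s0 sk r0 rk]].
have kd : (Num.truncn d^-1).+1%:R^-1 <= d.
  by rewrite invf_ple ?posrE//; apply/ltW/truncnS_gt.
apply/mx_norm_leP => // c z; rewrite ord1.
have Hs := Hd s _ _ c; have Hr := Hd r _ _ c.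
have := Hs _ _; rewrite /ball/= sub0r normrN => /(_ (lt_le_trans sk kd)).
rewrite -normr_gt0 => /(_ s0) h1.
have := Hr _ _; rewrite /ball/= sub0r normrN => /(_ (lt_le_trans rk kd)).
rewrite -normr_gt0 => /(_ r0) h2.
set D := 'D_1 _ t in h1 h2.
have -> : (dquot i s (x + t *: e_ i) - dquot i r (x + t *: e_ i)) c 0 =
  (D - dquot i r (x + t *: e_ i) c 0) - (D - dquot i s (x + t *: e_ i) c 0).
  by rewrite !mxE; ring.
apply: le_trans (ler_normB _ _) _.
have -> : j.+1%:R^-1 = (2 * j.+1%:R)^-1 + (2 * j.+1%:R)^-1 :> R by field.
by apply: lerD; exact: ltW.
Qed.

Lemma null_bounded_pieces (A : set 'cV[R]_m) :
  (forall N : nat, leb (A `&` [set x | `|x| <= N%:R]) = 0%E) -> leb A = 0%E.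
Proof.
move=> h; apply: (@null_subset _ _ leb _ (\bigcup_N (A `&` [set x | `|x| <= N%:R]))).
  by move=> x Ax; exists (Num.truncn `|x|).+1 => //; split => //=; apply/ltW/truncnS_gt.
exact: null_bigcup.
Qed.

(** The exceptional set is measurable; if a bounded part of it had positive measure, it would
    contain a compact set of positive measure. The sections of that set along the axis are null by
    the one-dimensional theorem, which [null_sections] excludes. *)
Lemma partial_ok_ae i : leb (~` partial_ok i) = 0%E.
Proof.
apply: null_bounded_pieces => N.
apply/eqP; rewrite eq_le leb_ge0 andbT leNgt; apply/negP => lt0.
have mP : leb.-caratheodory (partial_ok i).
  rewrite -(setCK (partial_ok i)); apply: caratheodory_measurable_setC.
  rewrite setC_bigcap; apply: caratheodory_measurable_bigcup => j.
  apply: caratheodory_measurable_setC; apply: caratheodory_measurable_bigcup => k.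
  by apply: leb_closed_measurable => //; exact: cauchy_dquot_closed.
have [|||K [cK KA]] := @leb_inner_regular R m m0 (~` partial_ok i `&` [set x | `|x| <= N%:R]) 0%E.
- by apply/bounded_setP; exists N%:R => x [].
- apply: caratheodory_measurable_setI; first exact: caratheodory_measurable_setC.
  by apply: leb_closed_measurable => //; apply: (@closed_norm_le _ _ _ id) => x; exact: cvg_id.
- exact: lt0.
rewrite (@null_sections R m K i cK) ?ltxx// => x.
have Lp c : forall s r, `|v (x + s *: e_ i) c 0 - v (x + r *: e_ i) c 0| <= L * `|s - r|.
  move=> s r; have := entry_le_norm (v (x + s *: e_ i) - v (x + r *: e_ i)) c 0.
  rewrite !mxE => /le_trans; apply; apply: le_trans (vL _ _) _.
  rewrite opprD addrACA subrr add0r -scalerBl normrZ mulrA ler_piMr ?mulr_ge0 ?lipL_ge0//.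
  by apply/mx_norm_leP => // k l; rewrite mxE normr_nat lern1 leq_b1.
have : {ae mu, forall t, forall c, derivable (fun s : R => v (x + s *: e_ i) c 0) t 1}.
  apply: filter_forall => c; exact: (@lipschitz_ae_derivable _ _ _ (Lp c)).
move=> [B [mB B0 HB]].
apply/eqP; rewrite eq_le outer_measure_ge0 andbT -B0.
apply: le_outer_measure => t /= Kt; apply: HB => /= d.
by have [+ _] := KA _ Kt; apply; exact: derivable_partial_ok.
Qed.

End rademacher.

Section rational_approximation.
Context {R : realType}.

Lemma rat_approx (r e : R) : 0 < e -> exists q : rat, `|r - ratr q| < e.
Proof.
move=> e0; have [q] := @rat_in_itvoo R (r - e) (r + e) ltac:(lra).
by rewrite in_itv/= => /andP[? ?]; exists q; rewrite ltr_norml; apply/andP; split; lra.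
Qed.

Lemma rat_mx_approx {a b} (A : 'M[R]_(a, b)) (e : R) : 0 < e ->
  exists y : 'M[rat]_(a, b), `|A - map_mx ratr y| < e.
Proof.
move=> e0; have [f Hf] := choice (fun ij : 'I_a * 'I_b => rat_approx (A ij.1 ij.2) e0).
exists (\matrix_(i, j) f (i, j)); apply/mx_norm_ltP => // i j.
by rewrite !mxE; exact: Hf (i, j).
Qed.

Lemma norm_mulmx_le {a b c} (A : 'M[R]_(a, b)) (B : 'M[R]_(b, c)) :
  `|A *m B| <= b%:R * `|A| * `|B|.
Proof.
apply/mx_norm_leP; first by rewrite !mulr_ge0.
move=> i j; rewrite mxE; apply: le_trans (ler_norm_sum _ _ _) _.
apply: (@le_trans _ _ (\sum_(k < b) `|A| * `|B|)).
  by apply: ler_sum => k _; rewrite normrM ler_pM// entry_le_norm.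
by rewrite sumr_const card_ord -[X in X <= _]mulr_natl mulrA.
Qed.

End rational_approximation.

Section density_closeness.
Context {R : realType} {m : nat}.
Hypothesis m0 : (0 < m)%N.
Notation leb := (@lebesgue_outer R m).

(** If no point of [E] were that close to [p], a cube of side [e * rho / 2] at [p] would be missing
    from [E] inside the ball of radius [2 * rho]. Its volume is exactly
    [(e / 4) ^+ m * (2 * rho) ^+ m], which density forbids. *)
Lemma density_point_near (E : set 'cV[R]_m) a (e : R) : density_point E a ->
  0 < e -> e <= 1 -> exists2 d, 0 < d & forall rho, 0 < rho -> rho < d ->
    forall p, `|p - a| <= rho -> exists2 b, E b & `|b - p| <= e * rho.
Proof.
move=> Ea e0 e1; have e40 : 0 < (e / 4) ^+ m by rewrite exprn_gt0// divr_gt0.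
have [d d0 dE] := Ea _ e40; exists (d / 2); first by rewrite divr_gt0.
move=> rho rho0 rhod p pa; apply: contrapT => nb.
have r0 : 0 < 2 * rho by rewrite mulr_gt0.
have := dE (2 * rho) r0 _; move=> /(_ _)h.
have {}h := h ltac:(lra).
move: h; apply/negP; rewrite -leNgt.
have s0 : 0 < e * rho / 2 by rewrite !mulr_gt0.
apply: le_trans (le_trans _ (leb_cube_ge m0 p s0)) _.
  rewrite lee_fin -exprMn; rewrite le_eqVlt; apply/orP; left; apply/eqP.
  by congr (_ ^+ _); field.
apply: le_outer_measure => x px.
have xp : `|x - p| <= e * rho / 2.
  apply/mx_norm_leP; first exact: ltW.
  move=> i j; rewrite ord1; have := px i; rewrite !mxE ler_norml => /andP[? ?].
  by apply/andP; split; lra.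
split; last by move=> Ex; apply: nb; exists x => //; apply: le_trans xp _; lra.
rewrite -ball_normE /= distrC -(subrKA p); apply: le_lt_trans (ler_normD _ _) _.
have : e * rho <= rho by rewrite ler_piMl// ltW.
by move: pa xp; lra.
Qed.

End density_closeness.

(** * Total differentiability at density points *)

Section rademacher2.
Context {R : realType} {m n : nat}.
Hypothesis m0 : (0 < m)%N.
Notation leb := (@lebesgue_outer R m).
Notation e_ := (fun i : 'I_m => delta_mx i 0 : 'cV[R]_m).
Variables (v : 'cV[R]_m -> 'cV[R]_n) (L : R).
Hypothesis vL : forall x y, `|v x - v y| <= L * `|x - y|.

Definition lin_approx (A : 'M[R]_(n, m)) (e d : R) : set 'cV[R]_m :=
  [set x | forall h : 'cV[R]_m, `|h| < d -> `|v (x + h) - v x - A *m h| <= e * `|h|].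

Definition diff_at x (A : 'M[R]_(n, m)) :=
  forall e, 0 < e -> exists2 d, 0 < d & lin_approx A e d x.

Definition par_approx (A : 'M[R]_(n, m)) (e d : R) : set 'cV[R]_m :=
  [set x | forall (i : 'I_m) t, `|t| < d ->
    `|v (x + t *: e_ i) - v x - t *: col i A| <= e * `|t|].

Lemma lin_approx_closed A e d : closed (lin_approx A e d).
Proof.
apply: closed_forall => h.
have [hd|hd] := pselect (`|h| < d); last first.
  by rewrite (_ : mkset _ = setT); [exact: closedT|apply/seteqP; split => x //= _ /hd].
rewrite (_ : mkset _ = [set x | `|v (x + h) - v x - A *m h| <= e * `|h|]); last first.
  by apply/seteqP; split => x /=; [exact|].
apply: closed_norm_le; apply: continuousBf; last by move=> x; exact: cst_continuous.
apply: continuousBf; last exact: lip_continuous vL.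
exact: continuous_shift (lip_continuous vL).
Qed.

Lemma par_approx_closed A e d : closed (par_approx A e d).
Proof.
apply: closed_forall => i; apply: closed_forall => t.
have [hd|hd] := pselect (`|t| < d); last first.
  by rewrite (_ : mkset _ = setT); [exact: closedT|apply/seteqP; split => x //= _ /hd].
rewrite (_ : mkset _ = [set x | `|v (x + t *: e_ i) - v x - t *: col i A| <= e * `|t|]); last first.
  by apply/seteqP; split => x /=; [exact|].
apply: closed_norm_le; apply: continuousBf; last by move=> x; exact: cst_continuous.
apply: continuousBf; last exact: lip_continuous vL.
exact: continuous_shift (lip_continuous vL).
Qed.

Lemma partial_ok_approx x (e : R) : (forall i, partial_ok v i x) -> 0 < e ->
  exists (y : 'M[rat]_(n, m)) (k : nat), par_approx (map_mx ratr y) e k.+1%:R^-1 x.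
Proof.
move=> px e0; pose j := Num.truncn (2 / e).
have je : j.+1%:R^-1 <= e / 2 :> R.
  rewrite invf_ple ?posrE ?divr_gt0// invf_div; exact/ltW/truncnS_gt.
have H i : exists k, cauchy_dquot v i j k x by have [k _ ?] := px i j I; exists k.
have {H}[kk Hk] := choice H.
pose k := \max_i kk i.
have kki i : k.+1%:R^-1 <= (kk i).+1%:R^-1 :> R.
  by rewrite lef_pV2 ?posrE// ler_nat ltnS /k leq_bigmax.
pose t0 : R := k.+2%:R^-1.
have t00 : 0 < t0 by rewrite invr_gt0.
have t0k : t0 < k.+1%:R^-1 by rewrite ltf_pV2 ?posrE// ltr_nat.
pose A : 'M[R]_(n, m) := \matrix_(c, i) dquot v i t0 x c 0.
have [y yA] := @rat_mx_approx R _ _ A (e / 2) ltac:(lra).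
exists y, k => i t tk.
have [->|t_neq0] := eqVneq t 0.
  by rewrite !scale0r addr0 subrr subr0 !normr0 mulr0.
have -> : v (x + t *: e_ i) - v x - t *: col i (map_mx ratr y) =
    t *: (dquot v i t x - col i (map_mx ratr y)).
  by rewrite /dquot scalerBr scalerA divff// scale1r.
rewrite normrZ mulrC ler_wpM2r// -(subrKA (dquot v i t0 x)).
apply: le_trans (ler_normD _ _) _; rewrite [leRHS]splitr; apply: lerD.
  apply: le_trans je.
  have tt : [&& 0 < `|(t, t0).1|, `|(t, t0).1| < (kk i).+1%:R^-1, 0 < `|(t, t0).2| & `|(t, t0).2| < (kk i).+1%:R^-1].
    rewrite /= !normr_gt0 t_neq0 gt_eqF// (gtr0_norm t00).
    by rewrite (lt_le_trans tk)//= (lt_le_trans t0k).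
  exact: Hk (exist _ (t, t0) tt).
apply/mx_norm_leP; first lra.
move=> c z; rewrite ord1 !mxE.
have := entry_le_norm (A - map_mx ratr y) c i; rewrite !mxE => /le_trans; apply.
exact: ltW.
Qed.

(** Walk from [a] to [a + h] along the axes. The corners need not belong to the set where the
    partial derivatives are uniformly controlled, but points of it lie within [e * |h|] of them.
    Each of the [m] steps costs [e] for the approximation and twice [L * e] for moving to such a
    point and back. *)
Lemma par_lin_approx A e d a : par_approx A e d a -> 0 < e -> e <= 1 -> 0 < d ->
  density_point (par_approx A e d) a ->
  exists2 d', 0 < d' & lin_approx A (m%:R * (2 * L + 1) * e) d' a.
Proof.
move=> Ea e0 e1 d0 Da; have L0 := lipL_ge0 m0 vL.
have [d1 d10 near1] := density_point_near m0 Da e0 e1.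
exists (Num.min d d1); first by rewrite lt_min d0.
move=> h; rewrite lt_min => /andP[hd hd1].
have [->|h0] := eqVneq h 0.
  by rewrite addr0 subrr mulmx0 subr0 !normr0 mulr0.
have hp : 0 < `|h| by rewrite normr_gt0.
(* The corners of the walk: the vector [h] with only its first [l] coordinates kept. *)
pose hh l : 'cV[R]_m := \col_i if (i < l)%N then h i 0 else 0.
have hhh l : `|hh l| <= `|h|.
  apply/mx_norm_leP => // i j; rewrite mxE; case: ifP => _.
    exact: entry_le_norm.
  by rewrite normr0.
have hhm : hh m = h by apply/matrixP => i j; rewrite ord1 mxE ltn_ord.
have step (l : nat) : (l <= m)%N ->
    `|v (a + hh l) - v a - A *m hh l| <= l%:R * (2 * L + 1) * e * `|h|.
  elim: l => [_|l IH lm].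
    rewrite (_ : hh 0%N = 0) ?addr0 ?subrr ?mulmx0 ?subr0 ?normr0 ?mul0r//.
    by apply/matrixP => i j; rewrite !mxE.
  pose i := Ordinal lm.
  have hhS : hh l.+1 = hh l + h i 0 *: e_ i.
    apply/matrixP => j z; rewrite ord1 !mxE eqxx andbT ltnS leq_eqVlt.
    have -> : (j == i) = (val j == l) by [].
    case: eqP => [jl|_] /=; last by rewrite mulr0 addr0.
    by rewrite jl ltnn add0r mulr1; congr (h _ _); apply/val_inj.
  have [|b Eb bp] := near1 _ hp hd1 (a + hh l); first by rewrite addrAC subrr add0r.
  have hi : `|h i 0| < d by apply: le_lt_trans hd; exact: entry_le_norm.
  have h1 := Eb i (h i 0) hi.
  have colE : A *m (h i 0 *: e_ i) = h i 0 *: col i A.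
    by rewrite -scalemxAr; congr (_ *: _); rewrite colE.
  have -> : v (a + hh l.+1) - v a - A *m hh l.+1 =
    (v (a + hh l) - v a - A *m hh l) +
    ((v (a + hh l.+1) - v (b + h i 0 *: e_ i)) +
     (v (b + h i 0 *: e_ i) - v b - h i 0 *: col i A) + (v b - v (a + hh l))).
    rewrite hhS mulmxDr colE; set p := v (a + _).
    rewrite opprD !addrA.
    apply/matrixP => r c; rewrite !mxE; ring.
  apply: le_trans (ler_normD _ _) _.
  rewrite -natr1 !mulrDl; apply: lerD; first by have := IH (ltnW lm); rewrite !mulrDl.
  apply: le_trans (ler_normD _ _) _; apply: le_trans (lerD (ler_normD _ _) (lexx _)) _.
  have e2 : `|v (a + hh l.+1) - v (b + h i 0 *: e_ i)| <= L * (e * `|h|).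
    apply: le_trans (vL _ _) _; rewrite ler_wpM2l// hhS addrA opprD addrACA subrr addr0.
    by rewrite distrC.
  have e3 : `|v b - v (a + hh l)| <= L * (e * `|h|).
    by apply: le_trans (vL _ _) _; rewrite ler_wpM2l.
  have e4 : e * `|h i 0| <= e * `|h| by rewrite ler_wpM2l ?(ltW e0)// entry_le_norm.
  by move: h1 e2 e3 e4; rewrite ?mul1r; lra.
by have := step m (leqnn _); rewrite hhm.
Qed.

(** Differentiability alone would not support the blow-up, which also needs density of the sets with
    a uniform linear approximation. Rational matrices and reciprocals of integers keep the number of
    density conditions countable. *)
Definition lip_good x := (forall i, partial_ok v i x) /\
  forall (y : 'M[rat]_(n, m)) (j k : nat),
    (par_approx (map_mx ratr y) j.+1%:R^-1 k.+1%:R^-1 x ->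
      density_point (par_approx (map_mx ratr y) j.+1%:R^-1 k.+1%:R^-1) x) /\
    (lin_approx (map_mx ratr y) j.+1%:R^-1 k.+1%:R^-1 x ->
      density_point (lin_approx (map_mx ratr y) j.+1%:R^-1 k.+1%:R^-1) x).

Lemma lip_good_ae : leb (~` lip_good) = 0%E.
Proof.
pose F1 (i : 'I_m) := ~` partial_ok v i.
pose F2 (p : 'M[rat]_(n, m) * nat * nat) := [set x |
  par_approx (map_mx ratr p.1.1) p.1.2.+1%:R^-1 p.2.+1%:R^-1 x /\
  ~ density_point (par_approx (map_mx ratr p.1.1) p.1.2.+1%:R^-1 p.2.+1%:R^-1) x].
pose F3 (p : 'M[rat]_(n, m) * nat * nat) := [set x |
  lin_approx (map_mx ratr p.1.1) p.1.2.+1%:R^-1 p.2.+1%:R^-1 x /\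
  ~ density_point (lin_approx (map_mx ratr p.1.1) p.1.2.+1%:R^-1 p.2.+1%:R^-1) x].
apply: (@null_subset _ _ leb _ (\bigcup_i F1 i `|` (\bigcup_p F2 p `|` \bigcup_p F3 p))).
  move=> x nx; apply: contrapT => /not_orP[n1 /not_orP[n2 n3]]; apply: nx; split.
    by move=> i; apply: contrapT => pi; apply: n1; exists i.
  move=> y j k; split => hx; apply: contrapT => dx.
    by apply: n2; exists (y, j, k).
  by apply: n3; exists (y, j, k).
apply: null_setU; first by apply: null_bigcup_count => i; exact: partial_ok_ae.
apply: null_setU; apply: null_bigcup_count => p.
  by apply: leb_density => //; exact: par_approx_closed.
by apply: leb_density => //; exact: lin_approx_closed.
Qed.

(** Rational matrices approximate the increments at [x] up to [C / j.+1]. Two of them, tested on the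
    same short coordinate vector, differ by at most the sum of their errors, so they form a Cauchy
    sequence; its limit is the differential. *)
Lemma lip_good_diff x : lip_good x -> exists A, diff_at x A.
Proof.
move=> [px dx].
pose C : R := m%:R * (2 * L + 1) + 1.
have C0 : 0 < C by rewrite ltr_wpDl// mulr_ge0// addr_ge0// mulr_ge0// (lipL_ge0 m0 vL).
have H (j : nat) : exists A : 'M[R]_(n, m), exists2 d, 0 < d & lin_approx A (C * j.+1%:R^-1) d x.
  have j0 : 0 < j.+1%:R^-1 :> R by rewrite invr_gt0.
  have [y [k yk]] := partial_ok_approx px j0.
  have [d d0 dl] := par_lin_approx yk j0 (ltac:(by rewrite invf_le1// ler1n))
    (ltac:(by rewrite invr_gt0)) ((dx y j k).1 yk).
  exists (map_mx ratr y), d => // h hd; apply: le_trans (dl h hd) _.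
  by rewrite ler_wpM2r// ler_wpM2r ?(ltW j0)// lerDl.
have {H}[AA HA] := choice H.
have cau j l : `|AA j - AA l| <= C * j.+1%:R^-1 + C * l.+1%:R^-1.
  have [d d0 dj] := HA j; have [d' d'0 dl] := HA l.
  apply/mx_norm_leP => [|c i].
    by rewrite addr_ge0// mulr_ge0 ?invr_ge0// ltW.
  pose t := Num.min d d' / 2.
  have t0 : 0 < t by rewrite divr_gt0// lt_min d0.
  have tN : `|t *: e_ i| = t.
    rewrite normrZ gtr0_norm// (_ : `|_| = 1) ?mulr1//; apply/le_anti/andP; split.
      by apply/mx_norm_leP => // k z; rewrite mxE normr_nat lern1 leq_b1.
    by have := entry_le_norm (e_ i) i 0; rewrite mxE !eqxx normr1.
  have := dj (t *: e_ i); have := dl (t *: e_ i); rewrite tN.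
  have td : t < Num.min d d' by rewrite /t ltr_pdivrMr// ltr_pMr ?ltr1n// lt_min d0.
  move: td; rewrite lt_min => /andP[td td'] /(_ td') h1 /(_ td) h2.
  set w := v (x + _) - v x in h1 h2.
  have : `|(AA j - AA l) *m (t *: e_ i)| <= (C * j.+1%:R^-1 + C * l.+1%:R^-1) * t.
    have -> : (AA j - AA l) *m (t *: e_ i) =
        (w - AA l *m (t *: e_ i)) - (w - AA j *m (t *: e_ i)).
      by rewrite mulmxBl opprB [RHS]addrC subrKA.
    by apply: le_trans (ler_normB _ _) _; rewrite mulrDl addrC lerD.
  move=> /(le_trans (entry_le_norm _ c 0)).
  rewrite -scalemxAr -colE !mxE normrM (gtr0_norm t0) mulrC ler_pM2r//.
have clim c i : cvg ((fun j => AA j c i) @ \oo).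
  apply: cauchy_cvg; apply/cauchy_ballP => e e0.
  pose N := Num.truncn (2 * C / e).
  have NE k : (N <= k)%N -> C * k.+1%:R^-1 < e / 2.
    move=> Nk; rewrite ltr_pdivrMr//.
    have : 2 * C / e < k.+1%:R by apply: lt_le_trans (truncnS_gt _) _; rewrite ler_nat ltnS.
    by rewrite ltr_pdivrMr//; lra.
  pose U := (fun j => AA j c i) @` [set k | (N <= k)%N].
  have UF : ((fun j => AA j c i) @ \oo) U by exists N => // k Nk; exists k.
  exists (U, U) => //= -[_ _] /= [[k Nk <-] [l Nl <-]]; rewrite /ball /=.
  have := entry_le_norm (AA k - AA l) c i; rewrite !mxE => /le_lt_trans; apply.
  by apply: le_lt_trans (cau k l) _; rewrite [ltRHS]splitr; apply: ltrD; exact: NE.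
pose A : 'M[R]_(n, m) := \matrix_(c, i) lim ((fun j => AA j c i) @ \oo).
have AAj j : `|AA j - A| <= C * j.+1%:R^-1.
  apply/mx_norm_leP => [|c i]; first by rewrite mulr_ge0 ?invr_ge0// ltW.
  rewrite !mxE.
  have lc : `|AA j c i - AA l c i| @[l --> \oo] --> `|AA j c i - lim ((fun j => AA j c i) @ \oo)|.
    by apply: cvg_norm; apply: cvgB; [exact: cvg_cst|exact: clim].
  have rc : C * j.+1%:R^-1 + C * l.+1%:R^-1 @[l --> \oo] --> C * j.+1%:R^-1 + C * 0.
    by apply: cvgD; [exact: cvg_cst|apply: cvgMr; exact: cvg_harmonic].
  rewrite mulr0 addr0 in rc.
  apply: ler_cvg_to lc rc _; apply: nearW => l.
  by apply: le_trans (cau j l); have := entry_le_norm (AA j - AA l) c i; rewrite !mxE.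
exists A => e e0.
pose C' := C + m%:R * C.
have C'0 : 0 < C' by rewrite ltr_pwDl// mulr_ge0// ltW.
pose j := Num.truncn (C' / e).
have jE : C' * j.+1%:R^-1 <= e.
  rewrite ler_pdivrMr// mulrC -ler_pdivrMr//; exact/ltW/truncnS_gt.
have [d d0 dj] := HA j; exists d => // h hd.
have -> : v (x + h) - v x - A *m h = (v (x + h) - v x - AA j *m h) + (AA j - A) *m h.
  by rewrite mulmxBl addrA subrK.
apply: le_trans (ler_normD _ _) _.
apply: le_trans (lerD (dj h hd) (norm_mulmx_le _ _)) _.
rewrite -mulrDl ler_wpM2r//; apply: le_trans jE.
by rewrite /C' (mulrDl C) lerD2l -mulrA ler_wpM2l.
Qed.

End rademacher2.

(** * Differentials by increments, and Lipschitz extension *)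

Section differentiability.
Context {R : realType}.

Lemma diff_intro {V W : normedModType R} (f : V -> W) (df : {linear V -> W}) x :
  continuous df ->
  (forall e, 0 < e -> exists2 d, 0 < d &
     forall h, `|h| < d -> `|f (x + h) - f x - df h| <= e * `|h|) ->
  differentiable f x /\ 'd f x = df :> (V -> W).
Proof.
move=> dfc H.
have E : f \o shift x = cst (f x) + df +o_ 0 id.
  apply/eqaddoP => _/posnumP[e]; have [d d0 hd] := H e%:num [gt0 of e%:num].
  apply/nbhs_ballP; exists d => // h; rewrite -ball_normE /= sub0r normrN => /hd.
  suff -> : (f \o shift x - (cst (f x) + df)) h = f (x + h) - f x - df h by [].
  by rewrite !fctE /= opprD addrA [h + x]addrC.
have dE : 'd f x = df :> (V -> W) by exact: diff_unique.
by split => //; apply/diff_locallyP; rewrite dE.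
Qed.

Lemma diff_elim {V W : normedModType R} (f : V -> W) x : differentiable f x ->
  forall e, 0 < e -> exists2 d, 0 < d &
     forall h, `|h| < d -> `|f (x + h) - f x - 'd f x h| <= e * `|h|.
Proof.
move=> /diff_locallyP[_ /eqaddoP H] e e0.
have /nbhs_ballP[d /= d0 hd] := H e e0; exists d => // h hd'.
have := hd h; rewrite -ball_normE /= sub0r normrN => /(_ hd').
suff -> : (f \o shift x - (cst (f x) + 'd f x)) h = f (x + h) - f x - 'd f x h by [].
by rewrite !fctE /= opprD addrA [h + x]addrC.
Qed.

Lemma mulmx_continuous {a b c} (A : 'M[R]_(a, b)) :
  continuous (mulmx A : 'M[R]_(b, c) -> 'M[R]_(a, c)).
Proof.
apply: (@lipschitz_continuous _ _ _ _ (b%:R * `|A|)) => x y.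
by rewrite -mulmxBr norm_mulmx_le.
Qed.

Lemma diff_at_jac {m n} (f : 'cV[R]_m -> 'cV[R]_n) x A : diff_at f x A ->
  differentiable f x /\ jac f x = A.
Proof.
move=> fA; have [] := @diff_intro _ _ f (mulmx A) x (@mulmx_continuous _ _ _ A) fA.
move=> df dE; split => //; apply/matrixP => i j; rewrite mxE dE /=.
by rewrite -colE mxE.
Qed.

Lemma diff_at_local {m n} (f g : 'cV[R]_m -> 'cV[R]_n) (U : set 'cV[R]_m) x A :
  open U -> U x -> (forall y, U y -> f y = g y) -> diff_at g x A -> diff_at f x A.
Proof.
move=> oU Ux fg gA e e0.
have /nbhs_ballP[r /= r0 xU] := open_nbhs_nbhs (conj oU Ux).
have [d d0 hd] := gA e e0; exists (Num.min d r); first by rewrite lt_min d0.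
move=> h; rewrite lt_min => /andP[h1 h2]; rewrite !fg//; first exact: hd.
by apply: xU; rewrite -ball_normE /= opprD addrA subrr sub0r normrN.
Qed.

Lemma diff_at_bound {m n} (f : 'cV[R]_m -> 'cV[R]_n) (L : R) x A : 0 <= L ->
  (forall x y, `|f x - f y| <= L * `|x - y|) -> diff_at f x A -> `|A| <= L.
Proof.
move=> L0 fL fA; apply/ler_addgt0Pr => e e0; have [d d0 hd] := fA e e0.
apply/mx_norm_leP => [|i j]; first by rewrite addr_ge0// ltW.
pose h : 'cV[R]_m := (d / 2) *: delta_mx j 0.
have d20 : 0 < d / 2 by rewrite divr_gt0.
have hN : `|h| = d / 2.
  rewrite normrZ gtr0_norm// (_ : `|_| = 1) ?mulr1//; apply/le_anti/andP; split.
    by apply/mx_norm_leP => // k z; rewrite mxE normr_nat lern1 leq_b1.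
  by have := entry_le_norm (delta_mx j 0 : 'cV[R]_m) j 0; rewrite mxE !eqxx normr1.
have := hd h _; rewrite hN => /(_ ltac:(lra)) h1.
have h2 := fL (x + h) x; rewrite addrAC subrr add0r hN in h2.
have : `|A *m h| <= (L + e) * (d / 2).
  rewrite -(subrK (f (x + h) - f x) (A *m h)).
  by apply: le_trans (ler_normD _ _) _; rewrite mulrDl [leLHS]addrC lerD// distrC.
move=> /(le_trans (entry_le_norm _ i 0)).
by rewrite -scalemxAr -colE !mxE normrM (gtr0_norm d20) mulrC ler_pM2r.
Qed.

(* McShane: the infimum of the cones [u a i 0 + l |x - a|] *)
Lemma lipschitz_extension {m n} (X : set 'cV[R]_m) (u : 'cV[R]_m -> 'cV[R]_n) (l : R) :
  0 <= l -> X !=set0 ->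
  (forall x y, X x -> X y -> `|u x - u y| <= l * `|x - y|) ->
  exists v, (forall x, X x -> v x = u x) /\
    (forall x y, `|v x - v y| <= l * `|x - y|).
Proof.
move=> l0 [a0 Xa0] ul.
pose S i x := [set u a i 0 + l * `|x - a| | a in X].
have Slb i x : lbound (S i x) (u a0 i 0 - l * `|a0 - x|).
  move=> _ [a Xa <-]; have := le_trans (entry_le_norm _ i 0) (ul _ _ Xa0 Xa).
  rewrite !mxE ler_norml => /andP[_ h1].
  have : l * `|a0 - a| <= l * `|a0 - x| + l * `|x - a|.
    by rewrite -mulrDr ler_wpM2l// -{1}(subrKA x) ler_normD.
  lra.
have Sinf i x : has_inf (S i x).
  by split; [exists (u a0 i 0 + l * `|x - a0|); exists a0|exists (u a0 i 0 - l * `|a0 - x|)].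
pose v x : 'cV[R]_n := \col_i inf (S i x).
exists v; split.
  move=> x Xx; apply/matrixP => i j; rewrite ord1 mxE; apply/le_anti/andP; split.
    by apply: (ge_inf (Sinf i x).2); exists x => //; rewrite subrr normr0 mulr0 addr0.
  apply: lb_le_inf; first exact: (Sinf i x).1.
  move=> _ [a Xa <-]; have := le_trans (entry_le_norm _ i 0) (ul _ _ Xx Xa).
  by rewrite !mxE ler_norml => /andP[_ h1]; lra.
have H i x y : inf (S i x) - inf (S i y) <= l * `|x - y|.
  rewrite lerBlDr -lerBlDl; apply: lb_le_inf; first exact: (Sinf i y).1.
  move=> _ [a Xa <-]; rewrite lerBlDl.
  apply: le_trans (_ : u a i 0 + l * `|x - a| <= _).
    by apply: (ge_inf (Sinf i x).2); exists a.
  rewrite addrCA lerD2l -mulrDr ler_wpM2l// -{1}(subrKA y) ler_normD//.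
move=> x y; apply/mx_norm_leP => [|i j]; first by rewrite mulr_ge0.
rewrite ord1 !mxE ler_norml H andbT lerNl opprB.
by rewrite distrC H.
Qed.

End differentiability.

(** * Hausdorff measure *)

Section hausdorff_measure.
Context {R : realType} {k : nat}.
Hypothesis k0 : (0 < k)%N.
Notation omega := (ball_volume R k).
Local Open Scope ereal_scope.

Lemma frob_lipschitz {a b} (A B : 'M[R]_(a, b)) :
  (`|frob A - frob B| <= (a * b)%:R * `|A - B|)%R.
Proof.
apply: le_trans (frob_le_norm (A - B)).
have h1 := ler_frobB A B 0; have h2 := ler_frobB B A 0.
rewrite !subr0 in h1 h2; rewrite frob_distC in h2.
by rewrite ler_norml; apply/andP; split; lra.
Qed.

Lemma frob_continuous {a b} : continuous (@frob R a b).
Proof. exact: lipschitz_continuous frob_lipschitz. Qed.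

Lemma omega_gt0 : (0 < omega)%R.
Proof.
have k1 : (0 < (2 * k%:R)^-1 :> R)%R by rewrite invr_gt0 mulr_gt0// ltr0n.
have lb := leb_cube_ge k0 (0 : 'cV[R]_k) k1.
have h : lebesgue_outer (cbox 0 (0 + const_mx (2 * k%:R)^-1)%R : set 'cV[R]_k) <=
    lebesgue_outer (eball (0 : 'cV[R]_k) 1).
  apply: le_outer_measure => x xk; rewrite /eball /= subr0.
  apply: le_lt_trans (frob_le_norm _) _; rewrite muln1.
  apply: (@le_lt_trans _ _ (k%:R * (2 * k%:R)^-1)%R).
    rewrite ler_wpM2l//; apply/mx_norm_leP; first exact: ltW.
    move=> i j; rewrite ord1; have := xk i; rewrite !mxE add0r => /andP[h1 h2].
    by rewrite ger0_norm.
  by rewrite invfM mulrCA divff ?mulr1 ?invf_lt1 ?ltr1n// pnatr_eq0 -lt0n.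
rewrite /ball_volume fine_gt0//; apply/andP; split.
  by apply: lt_le_trans (le_trans lb h); rewrite lte_fin exprn_gt0.
apply: leb_bounded; apply/bounded_setP; exists 1%R => x; rewrite /eball /= subr0 => /ltW.
exact: le_trans (norm_le_frob _).
Qed.

Section fixed_dim.
Context {N : nat}.
Implicit Types (A B F X : set 'cV[R]_N) (d delta : R).
Notation H := (@hausdorff_outer R k N).
Notation cost := (@diam_cost R k N).

Lemma diam_cost_ge0 delta A : 0 <= cost delta A.
Proof.
rewrite /diam_cost; case: ifP => // _; rewrite lee_fin mulr_ge0 ?(ltW omega_gt0)//.
rewrite exprn_ge0// divr_ge0//.
have [->|/set0P[x Ax]] := eqVneq A set0.
  by rewrite /ediam setX0 image_set0 ereal_sup0.
rewrite fine_ge0//; apply: le_trans (ereal_sup_ubound _); last first.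
  by exists (x, x).
by rewrite lee_fin sqrtr_ge0.
Qed.

Lemma cost0_ge0 delta A : 0 <= cost0 (cost delta) A.
Proof. by rewrite /cost0; case: ifP => // _; exact: diam_cost_ge0. Qed.

Definition hausdorff_pre delta : set 'cV[R]_N -> \bar R := cover_outer (cost delta).
Notation Hd := hausdorff_pre.

HB.instance Definition _ delta := isOuterMeasure.Build R 'cV[R]_N (Hd delta)
  (cover_outer0 (diam_cost_ge0 delta)) (cover_outer_ge0 (diam_cost_ge0 delta))
  (@le_cover_outer _ _ _) (cover_outer_sigma_subadditive (diam_cost_ge0 delta)).

(** With [diam_cost_elim] below, this exchanges the extended-real diameter for a real number
    bounding all distances; later covers are handled only through such numbers. *)
Lemma diam_cost_le A d delta : (0 <= d)%R -> (d <= delta)%R ->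
  (forall x y, A x -> A y -> frob (x - y) <= d)%R ->
  cost0 (cost delta) A <= (omega * (d / 2) ^+ k)%:E.
Proof.
move=> d0 ddl Ad; rewrite /cost0; case: ifPn => [_|/asboolPn/eqP/set0P[x Ax]].
  by rewrite lee_fin mulr_ge0 ?(ltW omega_gt0)// exprn_ge0// divr_ge0.
have eA : ediam A <= d%:E.
  by apply: ge_ereal_sup => _ [[y z] /= [Ay Az] <-]; rewrite lee_fin Ad.
have eA0 : 0 <= ediam A.
  apply: le_trans (ereal_sup_ubound _); last by exists (x, x).
  by rewrite lee_fin sqrtr_ge0.
rewrite /diam_cost (le_trans eA) ?lee_fin//.
rewrite ler_pM2l ?omega_gt0// ler_pXn2r ?nnegrE ?divr_ge0 ?fine_ge0//.
rewrite ler_pM2r ?invr_gt0// -lee_fin fineK// ge0_fin_numE//.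
by apply: le_lt_trans eA _; rewrite ltry.
Qed.

Lemma diam_cost_elim A delta : A !=set0 -> cost0 (cost delta) A < +oo ->
  exists d, [/\ (0 <= d)%R, (d <= delta)%R,
    (forall x y, A x -> A y -> frob (x - y) <= d)%R &
    cost0 (cost delta) A = (omega * (d / 2) ^+ k)%:E].
Proof.
move=> [x Ax]; have An0 : A <> set0 by move=> A0; move: Ax; rewrite A0.
rewrite /cost0 asboolF// /diam_cost; case: ifPn => // eA _.
have eA0 : 0 <= ediam A.
  apply: le_trans (ereal_sup_ubound _); last by exists (x, x).
  by rewrite lee_fin sqrtr_ge0.
have fA : ediam A \is a fin_num.
  by rewrite ge0_fin_numE//; apply: le_lt_trans eA _; rewrite ltry.
exists (fine (ediam A)); split => //; first exact: fine_ge0.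
  by rewrite -lee_fin fineK.
move=> y z Ay Az; rewrite -lee_fin fineK//; apply: ereal_sup_ubound.
by exists (y, z).
Qed.

Lemma le_Hd_H delta A : (0 < delta)%R -> Hd delta A <= H A.
Proof. by move=> d0; apply: ereal_sup_ubound; exists delta. Qed.

Lemma H_le A (M : \bar R) : (forall delta, (0 < delta)%R -> Hd delta A <= M) -> H A <= M.
Proof. by move=> h; apply: ge_ereal_sup => _ [d d0 <-]; exact: h. Qed.

Lemma Hd_cover delta A (F : (set 'cV[R]_N)^nat) : A `<=` \bigcup_j F j ->
  Hd delta A <= \sum_(j <oo) cost0 (cost delta) (F j).
Proof. by move=> AF; apply: ereal_inf_lbound; exists F. Qed.

Lemma Hd_lt delta A (M : \bar R) : Hd delta A < M ->
  exists F : (set 'cV[R]_N)^nat, [/\ A `<=` \bigcup_j F j,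
    \sum_(j <oo) cost0 (cost delta) (F j) < M &
    forall j, cost0 (cost delta) (F j) < +oo].
Proof.
move=> /ereal_inf_lt[_ [F AF <-] FM]; exists F; split => // j.
apply: le_lt_trans (lt_le_trans FM (leey _)).
apply: le_trans (nneseries_lim_ge j.+1 _); last by move=> *; exact: cost0_ge0.
by rewrite big_nat_recr//= leeDr// sume_ge0// => i _; exact: cost0_ge0.
Qed.

Lemma le_Hd_delta d1 d2 A : (d1 <= d2)%R -> Hd d2 A <= Hd d1 A.
Proof.
move=> d12; apply: lee_ltP => M /Hd_lt[F [AF FM Ffin]].
apply: le_trans (Hd_cover _ AF) _; apply: le_trans (ltW FM).
apply: lee_nneseries => [j _ _|j _]; first exact: cost0_ge0.
have [->|/set0P F0] := eqVneq (F j) set0; first by rewrite /cost0 asboolT.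
have [d [d0 dd Fd ->]] := diam_cost_elim F0 (Ffin j).
exact: diam_cost_le d0 (le_trans dd d12) Fd.
Qed.

(** Once the mesh is at most [e / 2], no member of a cover meets both sets, so a cover of the union
    splits into a cover of each. *)
Lemma hausdorff_metric : metric_outer H.
Proof.
move=> A B e e0 AB.
have key d : (0 < d)%R -> Hd d A + Hd d B <= H (A `|` B).
  move=> d0; pose d' := Num.min d (e / 2)%R.
  have d'0 : (0 < d')%R by rewrite lt_min d0 divr_gt0.
  have d'd : (d' <= d)%R by rewrite /d' ge_min lexx.
  apply: le_trans (leeD (le_Hd_delta A d'd) (le_Hd_delta B d'd)) _.
  apply: le_trans (le_Hd_H _ d'0).
  apply: lee_ltP => M /Hd_lt[F [ABF FM Ffin]].
  pose FX X j := if `[< F j `&` X !=set0 >] then F j else set0.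
  have FXc X : X `<=` A `|` B -> X `<=` \bigcup_j FX X j.
    move=> XAB x Xx; have [j _ Fx] := ABF _ (XAB _ Xx).
    by exists j => //; rewrite /FX asboolT//; exists x.
  apply: le_trans (leeD (Hd_cover _ (FXc A _)) (Hd_cover _ (FXc B _))) _; [by left|by right|].
  rewrite -nneseriesD; try by move=> *; exact: cost0_ge0.
  apply: le_trans (ltW FM); apply: lee_nneseries => [j _ _|j _].
    by apply: adde_ge0; exact: cost0_ge0.
  have c00 : cost0 (cost d') set0 = 0 by rewrite /cost0 asboolT.
  rewrite /FX; case: ifPn => [/asboolP[x [Fx Ax]]|_]; last first.
    by rewrite c00 add0e; case: ifP => // _; rewrite c00 cost0_ge0.
  case: ifPn => [/asboolP[y [Fy By]]|_]; last by rewrite c00 adde0.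
  have [|r [r0 rd Fr _]] := diam_cost_elim _ (Ffin j); first by exists x.
  have := AB _ _ Ax By; have := Fr _ _ Fx Fy; have := norm_le_frob (x - y)%R.
  have : (r <= e / 2)%R by apply: le_trans rd _; rewrite /d' ge_min lexx orbT.
  by move=> h1 h2 h3 h4; exfalso; lra.
have [HAB|HAB] := eqVneq (H (A `|` B)) +oo; first by rewrite HAB leey.
have HABf : H (A `|` B) \is a fin_num.
  by rewrite ge0_fin_numE ?outer_measure_ge0// lt_neqAle HAB leey.
have Hd0 d X : 0 <= Hd d X by exact: outer_measure_ge0.
(* The two Hausdorff measures are suprema over independent mesh sizes; monotonicity in the mesh
   reduces a pair of sizes to their minimum, after which the suprema can be taken one at a time. *)
have key2 d1 d2 : (0 < d1)%R -> (0 < d2)%R -> Hd d1 A + Hd d2 B <= H (A `|` B).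
  move=> d10 d20; apply: le_trans (key (Num.min d1 d2) _); last by rewrite lt_min d10.
  by apply: leeD; apply: le_Hd_delta; rewrite ge_min lexx ?orbT.
have HBf d : (0 < d)%R -> Hd d A \is a fin_num.
  move=> d0; rewrite ge0_fin_numE//.
  apply: le_lt_trans (le_trans _ (key _ d0)) _; last by rewrite -ge0_fin_numE// outer_measure_ge0.
  by rewrite leeDl.
have s1 d : (0 < d)%R -> Hd d A + H B <= H (A `|` B).
  move=> d0; rewrite -leeBrDl ?HBf//; apply: H_le => d2 d20.
  by rewrite leeBrDl ?HBf// key2.
have HBf' : H B \is a fin_num.
  rewrite ge0_fin_numE ?outer_measure_ge0//.
  apply: le_lt_trans (le_trans _ (s1 1%R _)) _; last 2 first.
  - exact: ltr01.
  - by rewrite -ge0_fin_numE// outer_measure_ge0.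
  by rewrite leeDr.
rewrite -leeBrDr//; apply: H_le => d d0.
by rewrite leeBrDr// s1.
Qed.

Lemma hausdorff_open_measurable A : open A -> H.-caratheodory A.
Proof. exact: (metric_outer_open hausdorff_metric). Qed.

Lemma hausdorff_closed_measurable A : closed A -> H.-caratheodory A.
Proof.
move=> cA; rewrite -(setCK A); apply: caratheodory_measurable_setC.
by apply: hausdorff_open_measurable; exact: closed_openC.
Qed.

(* The double polar of F at distance d is closed and has the same diameter. *)
Lemma closed_hull F d : (forall x y, F x -> F y -> frob (x - y) <= d)%R ->
  exists F', [/\ closed F', F `<=` F' &
    (forall x y, F' x -> F' y -> frob (x - y) <= d)%R].
Proof.
move=> Fd; pose P := [set z : 'cV[R]_N | forall x, F x -> (frob (x - z) <= d)%R].
exists [set y | forall z, P z -> (frob (z - y) <= d)%R]; split.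
- apply: closed_forall => z.
  have [Pz|Pz] := pselect (P z); last first.
    by rewrite (_ : mkset _ = setT); [exact: closedT|apply/seteqP; split => x //= _ /Pz].
  rewrite (_ : mkset _ = [set y | (`|frob (z - y)| <= d)%R]).
    apply: closed_norm_le; apply: (@lipschitz_continuous _ _ _ _ (N * 1)%:R) => x y.
    apply: le_trans (frob_lipschitz _ _) _.
    by rewrite opprB addrC addrA subrK distrC.
  by apply/seteqP; split => y /=; rewrite ger0_norm ?frob_ge0//; exact.
- by move=> y Fy z /(_ y Fy); rewrite frob_distC.
- move=> x y Px Py; apply: Py => x' Fx'; apply: Px => y' Fy'; exact: Fd.
Qed.

(** Closed hulls do not raise the cost, so nearly optimal covers may be taken closed. The hull is
    the intersection over the scales [1 / j.+1] of the unions of these covers. *)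
Lemma hausdorff_hull A : H A < +oo -> exists B : set 'cV[R]_N,
  [/\ <<s open >> B, A `<=` B & H B = H A].
Proof.
move=> HA.
have H1 (j : nat) : exists B : set 'cV[R]_N, [/\ <<s open >> B, A `<=` B &
    Hd j.+1%:R^-1 B <= H A + (j.+1%:R^-1)%:E].
  have j0 : (0 < j.+1%:R^-1 :> R)%R by rewrite invr_gt0.
  have : Hd j.+1%:R^-1 A < H A + (j.+1%:R^-1)%:E.
    apply: le_lt_trans (le_Hd_H _ j0) _.
    have fA : H A \is a fin_num by rewrite ge0_fin_numE ?outer_measure_ge0.
    by rewrite -(fineK fA) -EFinD lte_fin ltrDl.
  move=> /Hd_lt[F [AF FM Ffin]].
  have Hc i : exists F', [/\ closed F', F i `<=` F' &
      cost0 (cost j.+1%:R^-1) F' <= cost0 (cost j.+1%:R^-1) (F i)].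
    have [->|/set0P F0] := eqVneq (F i) set0.
      by exists set0; split => //; exact: closed0.
    have [d [d0 dd Fd ->]] := diam_cost_elim F0 (Ffin i).
    have [F' [cF' FF' F'd]] := closed_hull Fd.
    by exists F'; split => //; exact: diam_cost_le.
  have [F' HF'] := choice Hc.
  exists (\bigcup_i F' i); split.
  - apply: sigma_algebra_bigcup => i; rewrite -(setCK (F' i)).
    apply: sigma_algebraC; apply: sub_sigma_algebra; apply: closed_openC.
    by have [] := HF' i.
  - by move=> x /AF[i _ Fx]; exists i => //; have [_ + _] := HF' i; exact.
  - apply: le_trans (Hd_cover _ (@subset_refl _ _)) _; apply: le_trans (ltW FM).
    apply: lee_nneseries => [i _ _|i _]; first exact: cost0_ge0.
    by have [] := HF' i.
have [B HB] := choice H1.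
have AB : A `<=` \bigcap_j B j by move=> x Ax j _; have [_ + _] := HB j; exact.
exists (\bigcap_j B j); split => //.
  rewrite -(setCK (\bigcap_j B j)); apply: sigma_algebraC; rewrite setC_bigcap.
  apply: sigma_algebra_bigcup => j; apply: sigma_algebraC; by have [] := HB j.
apply/eqP; rewrite eq_le (le_outer_measure _ _ _ AB) andbT.
apply: H_le => d d0; apply/lee_addgt0Pr => e e0.
pose j := Num.truncn (Num.min d e)^-1.
have de0 : (0 < Num.min d e)%R by rewrite lt_min d0.
have jd : (j.+1%:R^-1 <= Num.min d e)%R.
  by rewrite invf_ple ?posrE//; apply/ltW/truncnS_gt.
move: jd; rewrite le_min => /andP[jd je].
apply: le_trans (le_Hd_delta _ jd) _.
apply: (@le_trans _ _ (Hd j.+1%:R^-1 (B j))).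
  by apply: le_outer_measure; exact: bigcap_inf.
have [_ _] := HB j; move=> /le_trans; apply.
by rewrite leeD2l// lee_fin.
Qed.

End fixed_dim.

Lemma lee_mul_ltP (c : R) (x y : \bar R) : (0 < c)%R -> 0 <= y ->
  (forall M : R, y < M%:E -> x <= (c * M)%:E) -> x <= c%:E * y.
Proof.
move=> c0 y0 h; have [->|yoo] := eqVneq y +oo.
  by rewrite gt0_muley ?lte_fin// leey.
have yf : y \is a fin_num by rewrite ge0_fin_numE// lt_neqAle yoo leey.
rewrite -(fineK yf) -EFinM; apply/lee_addgt0Pr => e e0.
have := h (fine y + e / c)%R; rewrite -[X in X < _](fineK yf) lte_fin ltrDl divr_gt0//.
by move=> /(_ isT); rewrite mulrDr mulrCA divff ?mulr1 ?gt_eqF// EFinD.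
Qed.

Lemma hausdorff_lip {N N'} (f : 'cV[R]_N -> 'cV[R]_N') (l : R) (X : set 'cV[R]_N) :
  (0 < l)%R ->
  (forall x y, X x -> X y -> frob (f x - f y) <= l * frob (x - y))%R ->
  @hausdorff_outer R k N' (f @` X) <= (l ^+ k)%:E * @hausdorff_outer R k N X.
Proof.
move=> l0 fl; apply: H_le => d d0.
have dl0 : (0 < d / l)%R by rewrite divr_gt0.
apply: (@le_trans _ _ ((l ^+ k)%:E * @hausdorff_pre N (d / l) X)); last first.
  by rewrite lee_wpmul2l ?le_Hd_H// lee_fin exprn_ge0// ltW.
apply: lee_mul_ltP; first exact: exprn_gt0.
  exact: outer_measure_ge0.
move=> M /Hd_lt[F [XF FM Ffin]].
apply: (@le_trans _ _ (\sum_(j <oo) cost0 (@diam_cost R k N' d) (f @` (F j `&` X)))).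
  apply: Hd_cover => _ [x Xx <-]; have [j _ Fx] := XF _ Xx.
  by exists j => //; exists x.
apply: (@le_trans _ _ (\sum_(j <oo) (l ^+ k)%:E * cost0 (@diam_cost R k N (d / l)) (F j))).
  apply: lee_nneseries => [j _ _|j _]; first exact: cost0_ge0.
  have [F0|/set0P F0] := eqVneq (F j) set0.
    by rewrite F0 set0I image_set0 /cost0 !asboolT// mule0.
  have [r [r0 rd Fr ->]] := diam_cost_elim F0 (Ffin j).
  rewrite -EFinM mulrCA -exprMn mulrA.
  apply: diam_cost_le; first by rewrite mulr_ge0// ltW.
    by rewrite mulrC -ler_pdivlMr.
  move=> _ _ [x [Fx Xx] <-] [y [Fy Xy] <-]; apply: le_trans (fl _ _ Xx Xy) _.
  by rewrite ler_pM2l// Fr.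
rewrite nneseriesZl; last by move=> j _; exact: cost0_ge0.
by rewrite (EFinM _ M) lee_wpmul2l ?(ltW FM)// lee_fin exprn_ge0// ltW.
Qed.

(** A set of diameter at most [r] projects into a cube of side [2 * r], whose volume is
    [4 ^ k * (r / 2) ^ k]; the cost in the Hausdorff measure is [omega * (r / 2) ^ k]. *)
Lemma leb_le_hausdorff {N} (p : 'cV[R]_N -> 'cV[R]_k) (X : set 'cV[R]_N) :
  (forall x y, `|p x - p y| <= frob (x - y))%R ->
  lebesgue_outer (p @` X) <= (4 ^+ k / omega)%:E * @hausdorff_outer R k N X.
Proof.
move=> pl; have c0 : (0 < 4 ^+ k / omega)%R by rewrite divr_gt0 ?omega_gt0// exprn_gt0.
apply: (@le_trans _ _ ((4 ^+ k / omega)%:E * @hausdorff_pre N 1 X)); last first.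
  by rewrite lee_wpmul2l ?le_Hd_H// lee_fin ltW.
apply: lee_mul_ltP => //; first exact: outer_measure_ge0.
move=> M /Hd_lt[F [XF FM Ffin]].
apply: (@le_trans _ _ (\sum_(j <oo) lebesgue_outer (p @` F j))).
  by apply: outer_measure_cover => _ [x Xx <-]; have [j _ Fx] := XF _ Xx; exists j => //; exists x.
apply: (@le_trans _ _ (\sum_(j <oo) (4 ^+ k / omega)%:E * cost0 (@diam_cost R k N 1%R) (F j))).
  apply: lee_nneseries => [j _ _|j _]; first exact: outer_measure_ge0.
  have [F0|/set0P F0] := eqVneq (F j) set0.
    by rewrite F0 image_set0 outer_measure0 /cost0 asboolT// mule0.
  have [r [r0 rd Fr ->]] := diam_cost_elim F0 (Ffin j).
  move: F0 => [x Fx].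
  have sub : p @` F j `<=` cbox (p x - const_mx r)%R (p x + const_mx r)%R.
    move=> _ [y Fy <-] i; rewrite !mxE.
    have := le_trans (entry_le_norm (p y - p x)%R i 0%R) (le_trans (pl _ _) (Fr _ _ Fy Fx)).
    by rewrite !mxE ler_norml => /andP[? ?]; apply/andP; split; lra.
  apply: le_trans (le_outer_measure _ _ _ sub) _.
  apply: le_trans (leb_cbox_le _) _; first by move=> i; rewrite !mxE; lra.
  rewrite -EFinM lee_fin /vol (eq_bigr (fun=> 2 * r)%R) ?prodr_const ?card_ord; last first.
    by move=> i _; rewrite !mxE; ring.
  rewrite mulrA divfK ?gt_eqF ?omega_gt0// -exprMn le_eqVlt; apply/orP; left; apply/eqP.
  by congr (_ ^+ _)%R; field.
rewrite nneseriesZl; last by move=> j _; exact: cost0_ge0.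
by rewrite (EFinM _ M) lee_wpmul2l ?(ltW FM)// lee_fin ltW.
Qed.

(** A cube of side [s] has an image of diameter at most [l * s]. Filling a box with such cubes costs
    [omega * (l / 2) ^+ k] times the volume of the box with all sides longer by [s], and [s] tends
    to 0 below the mesh [d / l]. *)
Lemma hausdorff_le_leb {N} (f : 'cV[R]_k -> 'cV[R]_N) (l : R) (X : set 'cV[R]_k) :
  (0 < l)%R -> (forall x y, frob (f x - f y) <= l * `|x - y|)%R ->
  @hausdorff_outer R k N (f @` X) <= (omega * (l / 2) ^+ k)%:E * lebesgue_outer X.
Proof.
move=> l0 fl; apply: H_le => d d0.
have c0 : (0 < omega * (l / 2) ^+ k)%R by rewrite mulr_gt0 ?omega_gt0// exprn_gt0// divr_gt0.
apply: lee_mul_ltP => //; first exact: outer_measure_ge0.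
move=> M /(leb_coverP k0)[a [b [ab Xab SM]]].
have box j : @hausdorff_pre N d (f @` obox (a j) (b j)) <=
    (omega * (l / 2) ^+ k)%:E * (vol (a j) (b j))%:E.
  pose p : {poly R} := ((omega * (l / 2) ^+ k) *: \prod_i ((b j i 0 - a j i 0)%:P + 'X))%R.
  have pE t : (p.[t] = omega * (l / 2) ^+ k * \prod_i (b j i 0%R - a j i 0%R + t))%R.
    by rewrite hornerZ horner_prod_addX.
  have step s : (0 < s)%R -> (l * s <= d)%R ->
      @hausdorff_pre N d (f @` obox (a j) (b j)) <= (p.[s])%:E.
    move=> s0 sd.
    pose n i := (Num.truncn ((b j i 0 - a j i 0) / s)%R).+1.
    have [|x i|c [cn cP]] := @grid_cover _ _ (a j) (const_mx s) n (obox (a j) (b j)).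
    - by move=> i; rewrite mxE.
    - move=> /(_ i)/andP[h1 h2]; rewrite mxE (ltW h1)/=; apply: lt_trans h2 _.
      by rewrite -ltrBlDl -ltr_pdivrMr// truncnS_gt.
    apply: (@le_trans _ _ (\sum_(q <- c) (omega * (l * s / 2) ^+ k)%:E)).
      apply: le_trans (_ : _ <= \sum_(q <- c) @hausdorff_pre N d (f @` cbox q (q + const_mx s)%R)) _.
        apply: outer_measure_fin => _ [x /cP[q qc qx] <-]; exists q; first by rewrite qc.
        by exists x => // i; have := qx i; rewrite !mxE.
      apply: lee_sum => q _.
      apply: le_trans (cover_outer_le1 (diam_cost_ge0 d) (@subset_refl _ _)) _.
      have [z zq] : f @` cbox q (q + const_mx s)%R !=set0.
        by exists (f q), q => // i; rewrite !mxE lexx lerDl ltW.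
      rewrite -[X in X <= _](_ : cost0 (@diam_cost R k N d) (f @` cbox q (q + const_mx s)%R) = _); last first.
        by rewrite /cost0 asboolF// => E; move: zq; rewrite E.
      apply: diam_cost_le => //; first by rewrite mulr_ge0 ?ltW.
      move=> _ _ [x xq <-] [y yq <-]; apply: le_trans (fl _ _) _.
      rewrite ler_pM2l//; apply/mx_norm_leP; first exact: ltW.
      move=> i i'; rewrite ord1; have := xq i; have := yq i; rewrite !mxE ler_norml.
      by move=> /andP[? ?] /andP[? ?]; apply/andP; split; lra.
    rewrite sumEFin lee_fin sum_cst_seq cn pE -[X in (X <= _)%R]mulr_natl.
    rewrite mulrCA -[X in (_ <= X)%R]mulrA ler_pM2l ?omega_gt0//.
    have -> : (l * s / 2 = l / 2 * s)%R by rewrite mulrAC.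
    rewrite exprMn mulrCA ler_pM2l ?exprn_gt0 ?divr_gt0// natr_prod.
    rewrite -[X in (_ * _ ^+ X)%R](card_ord k) -prodr_const -big_split /=.
    apply: ler_prod => i _; apply/andP; split; first by rewrite mulr_ge0// ltW.
    have bai : (0 <= b j i 0 - a j i 0)%R by rewrite subr_ge0.
    have /andP[h _] := truncn_itv (divr_ge0 bai (ltW s0)).
    by rewrite /n -natr1 mulrDl mul1r lerD2r -ler_pdivlMr.
  have dl0 : (0 < d / l)%R by rewrite divr_gt0.
  have fin : @hausdorff_pre N d (f @` obox (a j) (b j)) \is a fin_num.
    rewrite ge0_fin_numE ?outer_measure_ge0//; apply: le_lt_trans (step _ dl0 _) (ltry _).
    by rewrite mulrCA divff ?mulr1 ?gt_eqF.
  rewrite -(fineK fin) -EFinM lee_fin.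
  have -> : (omega * (l / 2) ^+ k * vol (a j) (b j) = p.[0])%R.
    by rewrite pE; congr (_ * _)%R; apply: eq_bigr => i _; rewrite addr0.
  apply: le_horner0 => e e0; exists (Num.min (e / 2) (d / l))%R; split.
  - by rewrite lt_min dl0 divr_gt0.
  - by rewrite gt_min; apply/orP; left; rewrite ltr_pdivrMr// ltr_pMr ?ltr1n.
  - rewrite -lee_fin fineK//; apply: step; first by rewrite lt_min dl0 divr_gt0.
    by rewrite mulrC -ler_pdivlMr// ge_min lexx orbT.
apply: (@le_trans _ _ (\sum_(j <oo) @hausdorff_pre N d (f @` obox (a j) (b j)))).
  by apply: outer_measure_cover => _ [x /Xab[j _ xj] <-]; exists j => //; exists x.
apply: (@le_trans _ _ (\sum_(j <oo) (omega * (l / 2) ^+ k)%:E * (vol (a j) (b j))%:E)).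
  by apply: lee_nneseries => [j _ _|j _]; [exact: outer_measure_ge0|exact: box].
rewrite nneseriesZl; last by move=> j _; rewrite lee_fin vol_ge0.
by rewrite (EFinM _ M) lee_wpmul2l ?(ltW SM)// lee_fin ltW.
Qed.

End hausdorff_measure.

(** * Comparison of integrals through distributions *)

Section distribution_comparison.
Local Open Scope ereal_scope.
Context {R : realType}.

Lemma integral_distribution d (T : measurableType d)
    (mu : {measure set T -> \bar R}) (Y : set T) (g : T -> R)
    (mY : measurable Y) (mg : measurable_fun setT (g \_ Y)) :
  (forall y, Y y -> (0 <= g y)%R) ->
  \int[mu]_(y in Y) (g y)%:E =
  \int[pushforward (mrestr mu mY) (g \_ Y)]_t (`|t|%R)%:E.
Proof.
move=> g0.
rewrite (@eq_measure_integral _ _ _ _ (mrestr mu mY)); last first.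
  by move=> A mA AY; rewrite /= /mrestr setIidl.
rewrite ge0_integral_pushforward//; last first.
  by apply/measurable_EFinP; exact: normr_measurable.
rewrite preimage_setT [LHS]integral_mkcond; apply: eq_integral => x _ /=.
rewrite !patchE; case: ifPn => [/set_mem Yx|_]; last by rewrite normr0.
by rewrite ger0_norm// g0.
Qed.

(** Both integrals become integrals of the absolute value against image measures on the line, where
    domination of one measure by a multiple of the other suffices. A set inequality such as
    Lipschitz contraction of Hausdorff measure thus passes to integrals without a change of
    variables. *)
Lemma ge0_le_integral_distribution d d' (S : measurableType d) (T : measurableType d')
    (mu : {measure set S -> \bar R}) (nu : {measure set T -> \bar R})
    (X : set S) (Y : set T) (f : S -> R) (g : T -> R) (c : R) :
  (0 <= c)%R -> measurable X -> measurable Y ->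
  measurable_fun X f -> measurable_fun Y g ->
  (forall x, X x -> (0 <= f x)%R) -> (forall y, Y y -> (0 <= g y)%R) ->
  (forall B, measurable B -> nu (Y `&` g @^-1` B) <= c%:E * mu (X `&` f @^-1` B)) ->
  \int[nu]_(y in Y) (g y)%:E <= c%:E * \int[mu]_(x in X) (f x)%:E.
Proof.
move=> c0 mX mY mf mg f0 g0 H.
have mf' : measurable_fun setT (f \_ X) by apply/(measurable_restrictT _ mX).1.
have mg' : measurable_fun setT (g \_ Y) by apply/(measurable_restrictT _ mY).1.
rewrite (integral_distribution nu mY mg' g0) (integral_distribution mu mX mf' f0).
rewrite -[c]/((NngNum c0)%:num) -ge0_integral_mscale//; last first.
  by apply/measurable_EFinP; exact: normr_measurable.
apply: ge0_le_measure_integral => //; last first.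
  by apply/measurable_EFinP; exact: normr_measurable.
move=> B mB.
have E (U : Type) (h : U -> R) (Z : set U) : (h \_ Z) @^-1` B `&` Z = Z `&` h @^-1` B.
  apply/seteqP; split => z /=; rewrite patchE.
    by move=> [+ Zz]; rewrite mem_set.
  by move=> [Zz hz]; rewrite mem_set.
have := H B mB; rewrite -!E; exact.
Qed.

End distribution_comparison.

(** * Borel sets and continuous functions *)

Section caratheodory_continuity.
Context {R : realType} {V : normedModType R}.
Variable mu : {outer_measure set V -> \bar R}.
Hypothesis mu_open : forall O : set V, open O -> mu.-caratheodory O.

Lemma measurable_fun_gt (T : Type) (nu : {outer_measure set V -> \bar R})
  (D : set (caratheodory_type nu)) (f : caratheodory_type nu -> R) :
  (forall a, nu.-caratheodory (D `&` f @^-1` `]a, +oo[%classic)) ->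
  measurable_fun D f.
Proof.
move=> h mD; apply: (measurability _ (RGenOInfty.measurableE R)) => //.
by move=> _ [_ [a ->] <-]; exact: h.
Qed.

Lemma continuous_cara_measurable (U : set V) (f : V -> R) :
  open U -> (forall x, U x -> {for x, continuous f}) ->
  measurable_fun (U : set (caratheodory_type mu)) (f : caratheodory_type mu -> R).
Proof.
move=> oU fc; apply: (@measurable_fun_gt unit) => a; apply: mu_open.
rewrite openE => x [Ux fx]; apply: filterI; first exact: open_nbhs_nbhs.
apply: (fc x Ux); move: fx => /=; rewrite in_itv/= andbT => ax.
by apply: open_nbhs_nbhs; split; [exact: interval_open|rewrite /= in_itv/= ax].
Qed.

Lemma borel_caratheodory (A : set V) : <<s open >> A -> mu.-caratheodory A.
Proof.
apply: smallest_sub; last exact: mu_open.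
split.
- exact: caratheodory_measurable_set0.
- by move=> B mB; rewrite setTD; exact: caratheodory_measurable_setC.
- by move=> F mF; exact: caratheodory_measurable_bigcup.
Qed.

End caratheodory_continuity.

Lemma borel_preimage {R : realType} {V W : normedModType R} (f : V -> W) (A : set W) :
  continuous f -> <<s open >> A -> <<s open >> (f @^-1` A).
Proof.
move=> fc; pose G := [set B : set W | <<s open >> (f @^-1` B)].
suff : <<s open >> `<=` G by apply.
apply: smallest_sub; last first.
  move=> O oO; apply: sub_sigma_algebra.
  by apply: open_comp => // x _; exact: fc.
split.
- by rewrite /G /= preimage_set0; exact: sigma_algebra0.
- by move=> B GB; rewrite /G /= setTD -preimage_setC; exact: sigma_algebraC.
- by move=> F GF; rewrite /G /= preimage_bigcup; exact: sigma_algebra_bigcup.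
Qed.

Section hausdorff_integral.
Local Open Scope ereal_scope.
Context {R : realType} {k N N' : nat}.
Hypothesis k0 : (0 < k)%N.

Lemma hausdorff_integral_lip (f : 'cV[R]_N -> 'cV[R]_N') (X : set 'cV[R]_N)
    (Y : set 'cV[R]_N') (phi : 'cV[R]_N' -> R) (l : R) :
  (0 < l)%R -> (@hausdorff_outer R k N).-caratheodory X ->
  (@hausdorff_outer R k N').-caratheodory Y ->
  (forall x y, X x -> X y -> frob (f x - f y) <= l * frob (x - y))%R ->
  Y `<=` f @` X -> continuous f -> continuous phi -> (forall y, 0 <= phi y)%R ->
  \int[hausdorff R k N']_(y in Y) (phi y)%:E <=
  (l ^+ k)%:E * \int[hausdorff R k N]_(x in X) (phi (f x))%:E.
Proof.
move=> l0 mX mY fl YfX fc pc p0.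
have oN : forall O, open O -> (@hausdorff_outer R k N).-caratheodory O.
  by move=> O; exact: hausdorff_open_measurable.
have oN' : forall O, open O -> (@hausdorff_outer R k N').-caratheodory O.
  by move=> O; exact: hausdorff_open_measurable.
apply: ge0_le_integral_distribution => //.
- by rewrite exprn_ge0// ltW.
- apply: (measurable_funS _ (subsetT _)); first exact: measurableT.
  apply: (continuous_cara_measurable oN openT) => x _.
  by apply: continuous_comp; [exact: fc|exact: pc].
- apply: (measurable_funS _ (subsetT _)); first exact: measurableT.
  by apply: (continuous_cara_measurable oN' openT) => x _; exact: pc.
- move=> B mB.
  apply: le_trans (hausdorff_lip k0 l0 (f := f) (X := X `&` (fun x => phi (f x)) @^-1` B) _).
    apply: le_outer_measure => y [Yy By]; have [x Xx fx] := YfX _ Yy.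
    by exists x => //; split => //=; rewrite fx.
  by move=> x y [Xx _] [Xy _]; exact: fl.
Qed.

End hausdorff_integral.

(** * Lipschitz graphs *)

Section graph_map.
Context {R : realType} {m n : nat}.
Hypothesis m0 : (0 < m)%N.
Notation leb := (@lebesgue_outer R m).
Notation H := (@hausdorff_outer R m (m + n)).

Definition gr (v : 'cV[R]_m -> 'cV[R]_n) (x : 'cV[R]_m) : 'cV[R]_(m + n) :=
  col_mx x (v x).

Lemma usub_gr v x : usubmx (gr v x) = x. Proof. exact: col_mxKu. Qed.

Lemma norm_usub_le (z : 'cV[R]_(m + n)) : `|usubmx z| <= `|z|.
Proof. by apply/mx_norm_leP => // i j; rewrite mxE; exact: entry_le_norm. Qed.

Lemma usub_lip (z w : 'cV[R]_(m + n)) : `|usubmx z - usubmx w| <= 1 * `|z - w|.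
Proof. by rewrite mul1r -linearB norm_usub_le. Qed.

Lemma usub_continuous : continuous (usubmx : 'cV[R]_(m + n) -> 'cV[R]_m).
Proof. exact: lipschitz_continuous usub_lip. Qed.

Lemma usub_frob_le (z w : 'cV[R]_(m + n)) : `|usubmx z - usubmx w| <= frob (z - w).
Proof. by rewrite -linearB; exact: le_trans (norm_usub_le _) (norm_le_frob _). Qed.

Lemma norm_col_mx_le (x : 'cV[R]_m) (y : 'cV[R]_n) c :
  `|x| <= c -> `|y| <= c -> `|col_mx x y| <= c.
Proof.
move=> xc yc; have c0 : 0 <= c by exact: le_trans xc.
apply/mx_norm_leP => // i j; rewrite mxE; case: (fintype.split i) => k.
  exact: le_trans (entry_le_norm _ _ _) xc.
exact: le_trans (entry_le_norm _ _ _) yc.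
Qed.

Section lipschitz_graph.
Variables (v : 'cV[R]_m -> 'cV[R]_n) (L : R).
Hypothesis L0 : 0 <= L.
Hypothesis vL : forall x y, `|v x - v y| <= L * `|x - y|.

Definition gr_lip : R := ((m + n) * 1)%:R * (1 + L).

Lemma gr_lip_gt0 : 0 < gr_lip.
Proof. by rewrite mulr_gt0 ?ltr_pwDl// ltr0n muln1 addn_gt0 m0. Qed.

Lemma gr_norm_lip x y : `|gr v x - gr v y| <= (1 + L) * `|x - y|.
Proof.
rewrite /gr opp_col_mx add_col_mx; apply: norm_col_mx_le.
  by rewrite mulrDl mul1r lerDl mulr_ge0.
by apply: le_trans (vL _ _) _; rewrite ler_wpM2r// lerDr.
Qed.

Lemma gr_continuous : continuous (gr v).
Proof. exact: lipschitz_continuous gr_norm_lip. Qed.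

Lemma gr_frob_lip x y : frob (gr v x - gr v y) <= gr_lip * `|x - y|.
Proof.
apply: le_trans (frob_le_norm _) _; rewrite /gr_lip -mulrA ler_wpM2l//.
exact: gr_norm_lip.
Qed.

(** A piece of the graph is the whole graph, which is closed, cut by the cylinder over its base;
    measurability is read off this form. *)
Lemma gr_imageE (D : set 'cV[R]_m) :
  gr v @` D = [set y | `|y - gr v (usubmx y)| <= 0] `&` usubmx @^-1` D.
Proof.
apply/seteqP; split => [_ [x Dx <-]|y [yv Dy]].
  by split; rewrite /= usub_gr ?subrr ?normr0.
exists (usubmx y) => //; apply/eqP; rewrite eq_sym -subr_eq0 -normr_eq0.
by rewrite eq_le yv normr_ge0.
Qed.

Lemma graph_closed : closed [set y : 'cV[R]_(m + n) | `|y - gr v (usubmx y)| <= 0].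
Proof.
apply: closed_norm_le; apply: continuousBf; first by move=> y; exact: cvg_id.
move=> y; apply: continuous_comp; first exact: usub_continuous.
exact: gr_continuous.
Qed.

Lemma gr_image_closed (D : set 'cV[R]_m) : closed D -> closed (gr v @` D).
Proof.
move=> cD; rewrite gr_imageE; apply: closedI; first exact: graph_closed.
by apply: closed_comp => // y _; exact: usub_continuous.
Qed.

Lemma gr_image_open_measurable (D : set 'cV[R]_m) : open D -> H.-caratheodory (gr v @` D).
Proof.
move=> oD; rewrite gr_imageE; apply: caratheodory_measurable_setI.
  by apply: hausdorff_closed_measurable => //; exact: graph_closed.
apply: hausdorff_open_measurable => //.
by apply: open_comp => // y _; exact: usub_continuous.
Qed.

Lemma gr_image_closed_measurable (D : set 'cV[R]_m) : closed D -> H.-caratheodory (gr v @` D).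
Proof. by move=> cD; apply: hausdorff_closed_measurable => //; exact: gr_image_closed. Qed.

Definition cHL : R := ball_volume R m * (gr_lip / 2) ^+ m.

Lemma cHL_gt0 : 0 < cHL.
Proof. by rewrite mulr_gt0 ?omega_gt0// exprn_gt0// divr_gt0// gr_lip_gt0. Qed.

Lemma hausdorff_gr_le (D : set 'cV[R]_m) : (H (gr v @` D) <= cHL%:E * leb D)%E.
Proof. by apply: hausdorff_le_leb => //; [exact: gr_lip_gt0|exact: gr_frob_lip]. Qed.

Definition cLH : R := 4 ^+ m / ball_volume R m.

Lemma cLH_gt0 : 0 < cLH.
Proof. by rewrite divr_gt0 ?omega_gt0// exprn_gt0. Qed.

Lemma leb_le_hausdorff_gr (D : set 'cV[R]_m) : (leb D <= cLH%:E * H (gr v @` D))%E.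
Proof.
have := leb_le_hausdorff m0 (p := usubmx) (gr v @` D) usub_frob_le.
rewrite (_ : usubmx @` _ = D)//; apply/seteqP; split => [_ [_ [x Dx <-] <-]|x Dx].
  by rewrite usub_gr.
by exists (gr v x); [exists x|rewrite usub_gr].
Qed.

Lemma gr_preimage_null (Z : set 'cV[R]_(m + n)) : H Z = 0%E -> leb (gr v @^-1` Z) = 0%E.
Proof.
move=> Z0; apply/eqP; rewrite eq_le leb_ge0 andbT.
apply: le_trans (leb_le_hausdorff_gr _) _.
rewrite (@null_subset _ _ H _ Z) ?mule0//.
by move=> _ [x Zx <-].
Qed.

(* E has a Borel hull in H on bounded pieces; the error is null for H, hence
   its trace on the graph is null for the Lebesgue measure. *)
Lemma gr_preimage_measurable (E : set 'cV[R]_(m + n)) :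
  H.-caratheodory E -> leb.-caratheodory (gr v @^-1` E).
Proof.
move=> mE; pose Q (j : nat) : set 'cV[R]_m := [set x | `|x| <= j%:R].
have cQ j : closed (Q j) by apply: (@closed_norm_le _ _ _ id) => x; exact: cvg_id.
have -> : gr v @^-1` E = \bigcup_j gr v @^-1` (E `&` gr v @` Q j).
  apply/seteqP; split => [x Ex|x [j _ [Ex _]]//].
  exists (Num.truncn `|x|).+1 => //; split => //; exists x => //.
  exact/ltW/truncnS_gt.
apply: caratheodory_measurable_bigcup => j.
have mEj : H.-caratheodory (E `&` gr v @` Q j).
  by apply: caratheodory_measurable_setI => //; exact: gr_image_closed_measurable.
have bQ : bounded_set (Q j) by apply/bounded_setP; exists j%:R.
have Ejfin : (H (E `&` gr v @` Q j) < +oo)%E.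
  apply: (@le_lt_trans _ _ (H (gr v @` Q j))); first by apply: le_outer_measure => x [].
  apply: le_lt_trans (hausdorff_gr_le _) _.
  by rewrite lte_mul_pinfty ?lee_fin ?(ltW cHL_gt0)// leb_bounded.
have [B [bB EB HB]] := hausdorff_hull m0 Ejfin.
set Ej := E `&` _ in mEj Ejfin EB HB *.
have BE0 : H (B `\` Ej) = 0%E.
  have E1 := mEj B; rewrite setIidr// HB -/(setD B Ej) in E1.
  have f1 : H Ej \is a fin_num by rewrite ge0_fin_numE ?outer_measure_ge0.
  have f2 : H (B `\` Ej) \is a fin_num.
    rewrite ge0_fin_numE ?outer_measure_ge0//; apply: le_lt_trans Ejfin.
    by rewrite -HB; apply: le_outer_measure => x [].
  move: E1; rewrite -(fineK f1) -(fineK f2) -EFinD => -[h].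
  by congr (_%:E); move: h; lra.
have -> : gr v @^-1` Ej = gr v @^-1` B `\` gr v @^-1` (B `\` Ej).
  apply/seteqP; split => x /=.
    by move=> Ex; split; [exact: EB|move=> []].
  by move=> [Bx nBE]; apply: contrapT => nE; apply: nBE.
apply: caratheodory_measurable_setD.
  apply: borel_caratheodory; first exact: leb_open_measurable.
  apply: borel_preimage => //; exact: gr_continuous.
by apply: null_caratheodory; exact: gr_preimage_null.
Qed.

End lipschitz_graph.

(** Provides a closed set with density at [x] on which the increments of [v] between any two nearby
    points, not only those from [x], are linear up to [e]: this makes the graph map over [E] almost
    isometric to its linearization. *)
Lemma good_piece (v : 'cV[R]_m -> 'cV[R]_n) (L : R) x A e :
  (forall x y, `|v x - v y| <= L * `|x - y|) ->
  lip_good v x -> diff_at v x A -> 0 < e ->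
  exists E d, [/\ closed E, density_point E x, 0 < d &
    forall a b, E a -> E b -> `|b - a| < d -> `|v b - v a - A *m (b - a)| <= e * `|b - a| ].
Proof.
move=> vL [_ gx] dx e0.
(* Half of [e] is for the approximation by a rational matrix on [E], the other half for returning
   from that matrix to [A]. *)
pose j := Num.truncn (2 / e).
have j0 : 0 < j.+1%:R^-1 :> R by rewrite invr_gt0.
have je : j.+1%:R^-1 <= e / 2 :> R.
  rewrite invf_ple ?posrE ?divr_gt0// invf_div; exact/ltW/truncnS_gt.
have j20 : 0 < j.+1%:R^-1 / 2 :> R by rewrite divr_gt0.
have [d d0 dxd] := dx _ j20.
pose k := Num.truncn d^-1.
have kd : k.+1%:R^-1 <= d by rewrite invf_ple ?posrE//; apply/ltW/truncnS_gt.
have mm : 0 < m%:R :> R by rewrite ltr0n.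
have ym0 : 0 < j.+1%:R^-1 / 2 / m%:R :> R by rewrite divr_gt0.
have [y yA] := rat_mx_approx A ym0.
have AyB (h : 'cV[R]_m) : `|(A - map_mx ratr y) *m h| <= j.+1%:R^-1 / 2 * `|h|.
  apply: le_trans (norm_mulmx_le _ _) _; rewrite ler_wpM2r//.
  by rewrite mulrC -ler_pdivlMr// ltW.
have xE : lin_approx v (map_mx ratr y) j.+1%:R^-1 k.+1%:R^-1 x.
  move=> h hk; have := dxd h (lt_le_trans hk kd) => h1.
  rewrite (_ : _ - _ - _ = (v (x + h) - v x - A *m h) + (A - map_mx ratr y) *m h).
    apply: le_trans (ler_normD _ _) _; apply: le_trans (lerD h1 (AyB h)) _.
    by rewrite -mulrDl -splitr.
  by rewrite mulmxBl addrA subrK.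
exists (lin_approx v (map_mx ratr y) j.+1%:R^-1 k.+1%:R^-1), k.+1%:R^-1; split.
- exact: lin_approx_closed vL _ _ _.
- exact: (gx y j k).2.
- by rewrite invr_gt0.
- move=> a b Ea _ ab; have h1 := Ea _ ab; rewrite [a + (b - a)]addrC subrK in h1.
  have h2 := AyB (b - a).
  rewrite (_ : v b - v a - A *m (b - a) = (v b - v a - map_mx ratr y *m (b - a)) -
     (A - map_mx ratr y) *m (b - a)); last by rewrite mulmxBl opprB addrA subrK.
  apply: le_trans (ler_normB _ _) _; apply: le_trans (lerD h1 h2) _.
  rewrite -mulrDl ler_wpM2r//; apply: le_trans (_ : _ <= e / 2 + e / 2) _.
    by rewrite lerD//; apply: le_trans je; rewrite ler_pdivrMr// ler_peMr// ?ler1n// ltW.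
  by rewrite -splitr.
Qed.

End graph_map.

(** * Blow-up of a graph and its approximate tangent plane *)

Section integral_bounds.
Local Open Scope ereal_scope.
Context d (T : measurableType d) (R : realType) (mu : {measure set T -> \bar R}).

(** On [Z] only the sup bound [B] is used; in the blow-up [Y] is the part of the graph over the good
    set and [Z] a part of small measure. *)
Lemma integral_split_le (G Y Z : set T) (f : T -> R) (B : R) :
  measurable G -> measurable Y -> measurable Z -> Y `<=` G -> (0 <= B)%R ->
  measurable_fun setT f -> (forall x, 0 <= f x)%R -> (forall x, f x <= B)%R ->
  (forall x, G x -> f x != 0%R -> Y x \/ Z x) ->
  \int[mu]_(x in G) (f x)%:E <= \int[mu]_(x in Y) (f x)%:E + B%:E * mu Z.
Proof.
move=> mG mY mZ YG B0 mf f0 fB fYZ.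
have mGY : measurable (G `\` Y) by exact: measurableD.
have mE D : measurable_fun D (fun x => (f x)%:E).
  by apply: measurable_funTS; exact/measurable_EFinP.
rewrite -[X in integral _ X _](setDUK YG) ge0_integral_setU//; last 2 first.
- by move=> x _; rewrite lee_fin.
- by apply/disj_setPS => x [? []].
rewrite leeD2l//.
apply: (@le_trans _ _ (\int[mu]_(x in G `\` Y) (B%:E * (\1_Z x)%:E))).
  apply: ge0_le_integral => //.
  - by move=> x _; rewrite lee_fin.
  - by apply/measurable_funTS; apply: measurable_funeM; exact/measurable_EFinP.
  - move=> x [Gx Yx]; rewrite -EFinM lee_fin indicE.
    have [->|fx] := eqVneq (f x) 0%R; first by rewrite mulr_ge0.
    by have [//|Zx] := fYZ _ Gx fx; rewrite mem_set// mulr1.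
rewrite ge0_integralZl//; last by apply/measurable_funTS; exact/measurable_EFinP.
by rewrite lee_wpmul2l ?lee_fin// integral_indic// le_measure ?inE//; exact: measurableI.
Qed.

Lemma integral_perturb_le (X : set T) (f g : T -> R) (e : R) :
  measurable X -> (0 <= e)%R -> measurable_fun setT f -> measurable_fun setT g ->
  (forall x, 0 <= f x)%R -> (forall x, 0 <= g x)%R ->
  (forall x, X x -> f x <= g x + e)%R ->
  \int[mu]_(x in X) (f x)%:E <= \int[mu]_(x in X) (g x)%:E + e%:E * mu X.
Proof.
move=> mX e0 mf mg f0 g0 fg; rewrite -integral_cst// -ge0_integralD//; last 2 first.
- by move=> x _; rewrite lee_fin.
- by apply: measurable_funTS; exact/measurable_EFinP.
apply: ge0_le_integral => //.
- by move=> x _; rewrite lee_fin.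
- by apply: measurable_funTS; exact/measurable_EFinP.
- by apply: emeasurable_funD => //; apply: measurable_funTS; exact/measurable_EFinP.
Qed.

Lemma integral_sub_le (X Y : set T) (f : T -> R) :
  measurable X -> measurable Y -> X `<=` Y -> measurable_fun setT f ->
  (forall x, 0 <= f x)%R ->
  \int[mu]_(x in X) (f x)%:E <= \int[mu]_(x in Y) (f x)%:E.
Proof.
move=> mX mY XY mf f0; apply: ge0_subset_integral => //.
  by apply: measurable_funTS; exact/measurable_EFinP.
by move=> x _; rewrite lee_fin.
Qed.

End integral_bounds.

Section blowup.
Context {R : realType} {m n : nat}.
Hypothesis m0 : (0 < m)%N.
Notation leb := (@lebesgue_outer R m).
Notation N := (m + n)%N.
Notation H := (@hausdorff_outer R m N).
Notation HH := (hausdorff R m N).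
Variables (v : 'cV[R]_m -> 'cV[R]_n) (L : R) (Omega : set 'cV[R]_m).
Variables (x : 'cV[R]_m) (A : 'M[R]_(n, m)).
Hypothesis L0 : 0 <= L.
Hypothesis vL : forall x y, `|v x - v y| <= L * `|x - y|.
Hypothesis oO : open Omega.
Hypothesis Ox : Omega x.
Hypothesis gx : lip_good v x.
Hypothesis dx : diff_at v x A.

Let vA : 'cV[R]_m -> 'cV[R]_n := mulmx A.
(** A common Lipschitz constant for [v] and for its linearization, so that the same measure constant
    [c] serves both graphs. *)
Let L' := L + m%:R * `|A|.

Let L'0 : 0 <= L'. Proof. by rewrite addr_ge0// mulr_ge0. Qed.

Let vL' y z : `|v y - v z| <= L' * `|y - z|.
Proof. by apply: le_trans (vL _ _) _; rewrite ler_wpM2r// lerDl mulr_ge0. Qed.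

Let vAL' y z : `|vA y - vA z| <= L' * `|y - z|.
Proof.
rewrite /vA -mulmxBr; apply: le_trans (norm_mulmx_le _ _) _.
by rewrite ler_wpM2r// lerDr.
Qed.

Variables (phi : 'cV[R]_N -> R) (M B : R).
Hypothesis M0 : 0 < M.
Hypothesis phi_cont : continuous phi.
Hypothesis phi0 : forall y, 0 <= phi y.
Hypothesis phiB : forall y, phi y <= B.
Hypothesis phiM : forall y, M <= `|y| -> phi y = 0.
Hypothesis phi_unif : forall e, 0 < e -> exists2 d, 0 < d &
  forall y z, `|y - z| < d -> `|phi y - phi z| <= e.

Let c := @cHL R m n L'.
Let c0 : 0 < c. Proof. exact: cHL_gt0. Qed.
(** [C1] bounds the measure of the rescaled graph where [phi] can be nonzero, and multiplies the
    oscillation of [phi]; [C2] is the sup of [phi] times the measure scale of the part outside the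
    density set. Neither depends on [e] or [r]. *)
Let C1 := c * (2 * M) ^+ m.
Let C2 := B * (c * M ^+ m).
Let B0 : 0 <= B. Proof. exact: le_trans (phi0 0) (phiB 0). Qed.

Let J (r : R) : \bar R :=
  \int[HH]_(y in gr v @` Omega) (phi (r^-1 *: (y - gr v x)))%:E.
Let I0 : \bar R := \int[HH]_(y in gr vA @` setT) (phi y)%:E.

Let mcont (f : 'cV[R]_N -> R) : continuous f ->
  measurable_fun setT (f : caratheodory_type H -> R).
Proof.
move=> fc; apply: (continuous_cara_measurable _ openT) => [U oU|y _].
  exact: hausdorff_open_measurable.
exact: fc.
Qed.

Let resc r y := r^-1 *: (y - gr v x).

Let resc_cont r : continuous (resc r).
Proof.
apply: continuousZl; apply: continuousBf; first by move=> y; exact: cvg_id.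
by move=> y; exact: cst_continuous.
Qed.

Let phir_cont r : continuous (fun y => phi (resc r y)).
Proof. by move=> y; apply: continuous_comp; [exact: resc_cont|exact: phi_cont]. Qed.

(** Over the density set [E] the rescaled graph and the plane are images of each other under maps
    with Lipschitz constant [1 + e], up to the scaling, and [phi] changes by at most [e] between
    corresponding points. Outside [E] both measures are small by density. Both inequalities are kept
    because each direction of the map yields only one. *)
Lemma blowup_bounds (e : R) : 0 < e -> exists2 d, 0 < d & forall r, 0 < r -> r < d ->
  (J r <= (r ^+ m)%:E * (((1 + e) ^+ m)%:E * (I0 + (e * C1)%:E) + (e * C2)%:E))%E /\
  (I0 <= ((1 + e) ^+ m)%:E * ((r ^- m)%:E * J r + (e * C1)%:E) + (e * C2)%:E)%E.
Proof.
move=> e0.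
(* The divisor pays for passing from the maximum norm to the Frobenius norm on [R^n]. *)
have e1 : 0 < e / n.+1%:R by rewrite divr_gt0.
have [E [d1 [cE dE d10 Elip]]] := good_piece m0 vL gx dx e1.
have frobE a b : E a -> E b -> `|b - a| < d1 ->
    frob (v b - v a - A *m (b - a)) <= e * `|b - a|.
  move=> Ea Eb ab; apply: le_trans (frob_le_norm _) _; rewrite muln1.
  apply: le_trans (ler_wpM2l _ (Elip _ _ Ea Eb ab)) _ => //.
  rewrite mulrA ler_wpM2r// mulrCA ler_piMr ?(ltW e0)// ler_pdivrMr// mul1r.
  by rewrite ler_nat.
have [rho rho0 phirho] := phi_unif e0.
(* Differentiability at [x] on the ball of radius [M * r] then keeps rescaled points within
   [rho / 2] of the plane, below the modulus of continuity [rho] of [phi]. *)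
have eM : 0 < rho / (2 * M) by rewrite divr_gt0// mulr_gt0.
have [d2 d20 dxd] := dx eM.
have [d3 d30 dEd] := dE _ e0.
have /nbhs_ballP[d4 /= d40 xO] := open_nbhs_nbhs (conj oO Ox).
pose dd := Num.min (Num.min (d1 / 2) d2) (Num.min d3 d4).
have dd0 : 0 < dd by rewrite !lt_min divr_gt0// d20 d30.
exists (dd / (2 * M)); first by rewrite divr_gt0// mulr_gt0.
move=> r r0 rd.
have Mr0 : 0 < M * r by rewrite mulr_gt0.
have : M * r < dd by move: rd; rewrite ltr_pdivlMr ?mulr_gt0//; move: Mr0; lra.
rewrite /dd !lt_min => /andP[/andP[Mr1 Mr2] /andP[Mr3 Mr4]].
pose K : set 'cV[R]_m := [set y | `|y - x| <= M * r].
have cK : closed K.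
  apply: closed_norm_le; apply: continuousBf; first by move=> y; exact: cvg_id.
  by move=> y; exact: cst_continuous.
have KO : K `<=` Omega.
  by move=> y Ky; apply: xO; rewrite -ball_normE /= distrC; exact: le_lt_trans Mr4.
pose E' := E `&` K.
have cE' : closed E' by exact: closedI.
pose sc (xi : 'cV[R]_m) := x + r *: xi.
have scK y : sc (r^-1 *: (y - x)) = y.
  by rewrite /sc scalerA divff ?gt_eqF// scale1r addrC subrK.
have scc : continuous sc.
  apply: (@lipschitz_continuous _ _ _ _ r) => y z.
  by rewrite /sc opprD addrACA subrr add0r -scalerBr normrZ gtr0_norm.
have scB y z : sc y - sc z = r *: (y - z).
  by rewrite /sc opprD addrACA subrr add0r scalerBr.
pose E'' := sc @^-1` E'.
have cE'' : closed E'' by apply: closed_comp => // y _; exact: scc.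
(* The part of the relevant ball missing from [E]; it is open, so its graph is measurable, and small
   by density. *)
pose D := ball x (M * r) `\` E.
have oD : open D by apply: openI; [exact: ball_open|exact: closed_openC].
have lebD : (leb D < (e * (M * r) ^+ m)%:E)%E by exact: dEd.
pose D' := sc @^-1` D.
have oD' : open D' by apply: open_comp => // y _; exact: scc.
have lebD' : (leb D' <= (e * M ^+ m)%:E)%E.
  apply: le_trans (leb_affine_preimage m0 _ r0 lebD) _.
  by rewrite lee_fin exprMn mulrA mulfK// gt_eqF// exprn_gt0.
have HD : (B%:E * H (gr v @` D) <= (r ^+ m)%:E * (e * C2)%:E)%E.
  apply: le_trans (_ : _ <= B%:E * (c%:E * (e * (M * r) ^+ m)%:E))%E _.
    rewrite lee_wpmul2l ?lee_fin//.
    apply: le_trans (hausdorff_gr_le m0 L'0 vL' D) _.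
    by rewrite lee_wpmul2l ?(ltW lebD)// lee_fin ltW.
  by rewrite -!EFinM lee_fin exprMn /C2 le_eqVlt; apply/orP; left; apply/eqP; ring.
have HD' : (B%:E * H (gr vA @` D') <= (e * C2)%:E)%E.
  apply: le_trans (_ : _ <= B%:E * (c%:E * (e * M ^+ m)%:E))%E _.
    rewrite lee_wpmul2l ?lee_fin//.
    apply: le_trans (hausdorff_gr_le m0 L'0 vAL' D') _.
    by rewrite lee_wpmul2l// lee_fin ltW.
  by rewrite -!EFinM lee_fin /C2 le_eqVlt; apply/orP; left; apply/eqP; ring.
have lebK : (leb K <= ((2 * M * r) ^+ m)%:E)%E.
  have sub : K `<=` cbox (x - const_mx (M * r)) (x + const_mx (M * r)).
    move=> y Ky i; have := le_trans (entry_le_norm _ i 0) Ky; rewrite !mxE ler_norml.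
    by move=> /andP[? ?]; apply/andP; split; lra.
  apply: le_trans (le_outer_measure _ _ _ sub) _.
  apply: le_trans (leb_cbox_le _) _; first by move=> i; rewrite !mxE; lra.
  rewrite lee_fin /vol (eq_bigr (fun=> 2 * M * r)) ?prodr_const ?card_ord//.
  by move=> i _; rewrite !mxE; ring.
have HY : (e%:E * H (gr v @` E') <= (r ^+ m)%:E * (e * C1)%:E)%E.
  apply: le_trans (_ : _ <= e%:E * (c%:E * ((2 * M * r) ^+ m)%:E))%E _.
    rewrite lee_wpmul2l ?lee_fin ?(ltW e0)//.
    apply: le_trans (hausdorff_gr_le m0 L'0 vL' E') _.
    rewrite lee_wpmul2l ?lee_fin ?(ltW c0)//; apply: le_trans lebK.
    by apply: le_outer_measure => y [].
  by rewrite -!EFinM lee_fin exprMn /C1 le_eqVlt; apply/orP; left; apply/eqP; ring.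
have HX : (e%:E * H (gr vA @` E'') <= (e * C1)%:E)%E.
  apply: le_trans (_ : _ <= e%:E * (c%:E * ((2 * M) ^+ m)%:E))%E _.
    rewrite lee_wpmul2l ?lee_fin ?(ltW e0)//.
    apply: le_trans (hausdorff_gr_le m0 L'0 vAL' E'') _.
    rewrite lee_wpmul2l ?lee_fin ?(ltW c0)//.
    have sub : E'' `<=` cbox (0 - const_mx M) (0 + const_mx M).
      move=> y [_]; rewrite /K /= /sc addrAC subrr add0r normrZ gtr0_norm// mulrC.
      rewrite ler_pM2r// => My i.
      have := le_trans (entry_le_norm _ i 0) My; rewrite !mxE ler_norml.
      by move=> /andP[? ?]; apply/andP; split; lra.
    apply: le_trans (le_outer_measure _ _ _ sub) _.
    apply: le_trans (leb_cbox_le _) _.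
      by move=> i; rewrite !mxE sub0r add0r ge0_cp// ltW.
    rewrite lee_fin /vol (eq_bigr (fun=> 2 * M)) ?prodr_const ?card_ord//.
    by move=> i _; rewrite !mxE; ring.
  by rewrite -!EFinM lee_fin /C1 mulrA.
have near_phi y : E' y -> `|phi (resc r (gr v y)) - phi (gr vA (r^-1 *: (y - x)))| <= e.
  move=> [_ Ky]; apply: phirho.
  have -> : resc r (gr v y) - gr vA (r^-1 *: (y - x)) =
      r^-1 *: col_mx 0 (v y - v x - A *m (y - x)).
    rewrite /resc /gr /vA -scalemxAr -scale_col_mx -scalerBr; congr (_ *: _).
    by rewrite !opp_col_mx !add_col_mx subrr.
  rewrite normrZ gtr0_norm ?invr_gt0// mulrC ltr_pdivrMr//.
  apply: (@le_lt_trans _ _ (rho / (2 * M) * `|y - x|)).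
    apply: norm_col_mx_le; first by rewrite normr0 mulr_ge0// ltW.
    have := dxd (y - x); rewrite [x + _]addrC subrK; apply.
    by apply: le_lt_trans Mr2.
  apply: (@le_lt_trans _ _ (rho / (2 * M) * (M * r))).
    by rewrite ler_wpM2l// ltW.
  rewrite (_ : _ * _ = rho * r / 2); last by field; rewrite gt_eqF.
  by rewrite ltr_pdivrMr// ltr_pMr ?ltr1n// mulr_gt0.
have supp1 y : (gr v @` Omega) y -> phi (resc r y) != 0 ->
    (gr v @` E') y \/ (gr v @` D) y.
  move=> [y' Oy <-] nz; have yM : `|y' - x| < M * r.
    rewrite ltNge; apply/negP => h; move: nz; rewrite phiM ?eqxx//.
    apply: le_trans (norm_usub_le _); rewrite /resc linearZ linearB /= !usub_gr.
    by rewrite normrZ gtr0_norm ?invr_gt0// mulrC ler_pdivlMr.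
  have [Ey|Ey] := pselect (E y'); [left|right]; exists y' => //.
    by split => //; exact: ltW.
  by split => //; rewrite -ball_normE /= distrC.
have supp2 y : (gr vA @` setT) y -> phi y != 0 ->
    (gr vA @` E'') y \/ (gr vA @` D') y.
  move=> [xi _ <-] nz; have xM : `|xi| < M.
    rewrite ltNge; apply/negP => h; move: nz; rewrite phiM ?eqxx//.
    by apply: le_trans (norm_usub_le _); rewrite usub_gr.
  have sx : `|sc xi - x| < M * r.
    by rewrite /sc addrAC subrr add0r normrZ gtr0_norm// mulrC ltr_pM2r.
  have [Ey|Ey] := pselect (E (sc xi)); [left|right]; exists xi => //.
    by split => //; exact: ltW.
  by split => //; rewrite -ball_normE /= distrC.
have close a b : E' a -> E' b -> `|b - a| < d1.
  move=> [_ Ka] [_ Kb]; rewrite -(subrKA x); apply: le_lt_trans (ler_normD _ _) _.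
  move: Ka Kb; rewrite /K /= [`|x - a|]distrC; move: Mr1; rewrite ltr_pdivlMr//; lra.
have frob0mx (w : 'cV[R]_n) : frob (col_mx 0 w : 'cV[R]_N) = frob w.
  rewrite /frob !mxdotE big_split_ord /= big1 ?add0r => [|i _].
    by congr Num.sqrt; apply: eq_bigr => i _; apply: eq_bigr => j _; rewrite !col_mxEd.
  by rewrite big1// => j _; rewrite col_mxEu mxE mul0r.
(* The increment of the graph is [r] times the increment of the plane plus a vertical error, and the
   error is at most [e * r] times the horizontal part of the increment of the plane. *)
have lip1 y z : (gr vA @` E'') y -> (gr vA @` E'') z ->
    frob (gr v (sc (usubmx y)) - gr v (sc (usubmx z))) <= r * (1 + e) * frob (y - z).
  move=> [a Ea <-] [b Eb <-]; rewrite !usub_gr.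
  have -> : gr v (sc a) - gr v (sc b) = r *: (gr vA a - gr vA b) +
      col_mx 0 (v (sc a) - v (sc b) - A *m (sc a - sc b)).
    rewrite /gr /vA !opp_col_mx !add_col_mx scale_col_mx add_col_mx scB addr0.
    by congr col_mx; rewrite -scalemxAr mulmxBr [RHS]addrC subrK.
  apply: le_trans (ler_frobD _ _) _; rewrite frobZ gtr0_norm// frob0mx.
  rewrite mulrDr mulr1 mulrDl lerD2l.
  apply: le_trans (frobE _ _ Eb.1 Ea.1 (close _ _ Eb Ea)) _.
  rewrite scB normrZ gtr0_norm// mulrCA mulrA ler_wpM2l ?mulr_ge0 ?(ltW r0) ?(ltW e0)//.
  by have := usub_frob_le (gr vA a) (gr vA b); rewrite !usub_gr.
have lip2 y z : (gr v @` E') y -> (gr v @` E') z ->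
    frob (gr vA (r^-1 *: (usubmx y - x)) - gr vA (r^-1 *: (usubmx z - x))) <=
    (1 + e) / r * frob (y - z).
  move=> [a Ea <-] [b Eb <-]; rewrite !usub_gr.
  have -> : gr vA (r^-1 *: (a - x)) - gr vA (r^-1 *: (b - x)) =
      r^-1 *: ((gr v a - gr v b) - col_mx 0 (v a - v b - A *m (a - b))).
    rewrite /gr /vA !opp_col_mx !add_col_mx scale_col_mx oppr0 addr0.
    have ab : r^-1 *: (a - x) - r^-1 *: (b - x) = r^-1 *: (a - b).
      by rewrite -scalerBr opprB addrA subrK.
    by congr col_mx => //; rewrite -mulmxBr ab -scalemxAr; congr (_ *: _); rewrite opprB [RHS]addrC subrK.
  rewrite frobZ gtr0_norm ?invr_gt0// [(1 + e) / r]mulrC -mulrA ler_pM2l ?invr_gt0//.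
  apply: le_trans (ler_frobD _ _) _; rewrite frobN frob0mx mulrDl mul1r lerD2l.
  apply: le_trans (frobE _ _ Eb.1 Ea.1 (close _ _ Eb Ea)) _.
  rewrite ler_wpM2l ?(ltW e0)//.
  by have := usub_frob_le (gr v a) (gr v b); rewrite !usub_gr.
have mG : H.-caratheodory (gr v @` Omega) by exact: gr_image_open_measurable L'0 vL' _ oO.
have mY : H.-caratheodory (gr v @` E') by exact: gr_image_closed_measurable L'0 vL' _ cE'.
have mD : H.-caratheodory (gr v @` D) by exact: gr_image_open_measurable L'0 vL' _ oD.
have mP : H.-caratheodory (gr vA @` setT) by apply: gr_image_open_measurable L'0 vAL' _ openT.
have mX : H.-caratheodory (gr vA @` E'') by exact: gr_image_closed_measurable L'0 vAL' _ cE''.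
have mD' : H.-caratheodory (gr vA @` D') by exact: gr_image_open_measurable L'0 vAL' _ oD'.
have phA0 : continuous (fun y : 'cV[R]_N => phi (gr vA (r^-1 *: (usubmx y - x)))).
  move=> y; apply: continuous_comp; last exact: phi_cont.
  apply: continuous_comp; last exact: gr_continuous L'0 vAL' _.
  move: y; apply: continuousZl; apply: continuousBf; first exact: usub_continuous.
  by move=> y; exact: cst_continuous.
have scu : continuous (fun y : 'cV[R]_N => gr v (sc (usubmx y))).
  move=> y; apply: continuous_comp; last exact: gr_continuous L'0 vL' _.
  by apply: continuous_comp; [exact: usub_continuous|exact: scc].
have J0 : (0 <= J r)%E by apply: integral_ge0 => y _; rewrite lee_fin.
have I00 : (0 <= I0)%E by apply: integral_ge0 => y _; rewrite lee_fin.
have C10 : 0 <= e * C1 by rewrite mulr_ge0 ?(ltW e0)// mulr_ge0 ?(ltW c0)// exprn_ge0// mulr_ge0// ltW.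
have re0 : 0 < r * (1 + e) by rewrite mulr_gt0// addr_gt0.
have er0 : 0 < (1 + e) / r by rewrite divr_gt0// addr_gt0.
have C20 : 0 <= e * C2.
  apply: mulr_ge0; first exact: ltW.
  by apply: mulr_ge0 => //; apply: mulr_ge0; [exact: ltW|apply: exprn_ge0; exact: ltW].
have pe0 : 0 <= (1 + e) ^+ m by rewrite exprn_ge0// addr_ge0// ltW.
have mr0 : (0 <= (r ^+ m)%:E)%E by rewrite lee_fin exprn_ge0// ltW.
have cs : continuous (fun y : 'cV[R]_N => phi (resc r (gr v (sc (usubmx y))))).
  move=> y; apply: (@continuous_comp _ _ _ (fun y : 'cV[R]_N => gr v (sc (usubmx y)))
    (fun y => phi (resc r y))); [exact: scu|exact: phir_cont].
have sub1 : gr v @` E' `<=` (fun y : 'cV[R]_N => gr v (sc (usubmx y))) @` (gr vA @` E'').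
  move=> _ [y Ey <-]; exists (gr vA (r^-1 *: (y - x))); last by rewrite usub_gr scK.
  by exists (r^-1 *: (y - x)) => //; rewrite /E'' /= scK.
have sub2 : gr vA @` E'' `<=`
    (fun y : 'cV[R]_N => gr vA (r^-1 *: (usubmx y - x))) @` (gr v @` E').
  move=> _ [xi Exi <-]; exists (gr v (sc xi)); first by exists (sc xi).
  rewrite usub_gr /sc addrAC subrr add0r scalerA mulVf ?gt_eqF// scale1r.
  by [].
have cA : continuous (fun y : 'cV[R]_N => gr vA (r^-1 *: (usubmx y - x))).
  move=> y; apply: continuous_comp; last exact: gr_continuous L'0 vAL' _.
  move: y; apply: continuousZl; apply: continuousBf; first exact: usub_continuous.
  by move=> y; exact: cst_continuous.
have YG : gr v @` E' `<=` gr v @` Omega.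
  by move=> _ [y [_ Ky] <-]; exists y => //; exact: KO.
have XP : gr vA @` E'' `<=` gr vA @` setT by move=> _ [y _ <-]; exists y.
split.
- have h1 := integral_split_le HH mG mY mD YG B0 (mcont (@phir_cont r))
    (fun y => phi0 _) (fun y => phiB _) supp1.
  apply: le_trans h1 _.
  have q1 : (0 <= ((1 + e) ^+ m)%:E * (I0 + (e * C1)%:E))%E.
    by apply: mule_ge0; [rewrite lee_fin|apply: adde_ge0 => //; rewrite lee_fin].
  have q2 : (0 <= (e * C2)%:E)%E by rewrite lee_fin.
  rewrite (ge0_muleDr _ q1 q2).
  apply: (leeD _ HD).
  apply: le_trans (hausdorff_integral_lip m0 re0 mX mY lip1 sub1 scu (@phir_cont r) (fun y => phi0 _)) _.
  rewrite exprMn EFinM -muleA lee_wpmul2l// lee_wpmul2l ?lee_fin//.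
  apply: le_trans (integral_perturb_le HH mX (ltW e0) (mcont cs) (mcont phi_cont) (fun y => phi0 _) phi0 _) _.
    move=> _ [xi Exi <-]; rewrite usub_gr.
    have := near_phi _ Exi; rewrite ler_norml => /andP[_].
    rewrite {2}/sc addrAC subrr add0r scalerA mulVf ?gt_eqF// scale1r.
    by rewrite lerBlDl.
  exact: leeD (integral_sub_le HH mX mP XP (mcont phi_cont) phi0) HX.
- apply: le_trans (integral_split_le HH mP mX mD' XP B0 (mcont phi_cont)
    phi0 phiB supp2) _.
  apply: (leeD _ HD').
  apply: le_trans (hausdorff_integral_lip m0 er0 mY mX lip2 sub2 cA phi_cont phi0) _.
  rewrite exprMn exprVn EFinM -muleA lee_wpmul2l ?lee_fin//.
  apply: (@le_trans _ _ ((r ^- m)%:E * (J r + (r ^+ m)%:E * (e * C1)%:E))%E); last first.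
    have q2 : (0 <= (r ^+ m)%:E * (e * C1)%:E)%E by rewrite mule_ge0// lee_fin.
    rewrite (ge0_muleDr _ J0 q2).
    by rewrite leeD2l// -!EFinM mulrA mulVf ?mul1r// gt_eqF// exprn_gt0.
  rewrite lee_wpmul2l ?lee_fin ?invr_ge0 ?exprn_ge0 ?(ltW r0)//.
  apply: le_trans (integral_perturb_le HH mY (ltW e0) (mcont phA0) (mcont (@phir_cont r)) (fun y => phi0 _) (fun y => phi0 _) _) _.
    move=> _ [y Ey <-]; rewrite usub_gr.
    by have := near_phi _ Ey; rewrite ler_norml => /andP[+ _]; lra.
  exact: leeD (integral_sub_le HH mY mG YG (mcont (@phir_cont r)) (fun y => phi0 _)) HY.
Qed.

End blowup.

(** * Orthogonal projection onto a graph *)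

Section graph_projection.
Context {R : realType} {m n : nat}.

Definition gmx (A : 'M[R]_(n, m)) : 'M[R]_(m + n, m) := col_mx 1%:M A.

Definition gram (A : 'M[R]_(n, m)) : 'M[R]_m := (gmx A)^T *m gmx A.

(** The least-squares formula for the orthogonal projection onto the column space of [gmx A]. *)
Definition tproj (A : 'M[R]_(n, m)) : 'M[R]_(m + n) :=
  gmx A *m invmx (gram A) *m (gmx A)^T.

Lemma gramE A : gram A = 1%:M + A^T *m A.
Proof. by rewrite /gram /gmx tr_col_mx mul_row_col trmx1 mulmx1. Qed.

(** A row [w] in the kernel satisfies [|w|^2 + |A w^t|^2 = 0]. *)
Lemma gram_unit A : gram A \in unitmx.
Proof.
rewrite -row_free_unit -kermx_eq0; apply/eqP/row_matrixP => i; rewrite row0.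
set w := row i _; have : w *m gram A = 0 by rewrite -row_mul mulmx_ker row0.
move=> /(congr1 (fun B => B *m w^T)); rewrite mul0mx gramE mulmxDr mulmx1 mulmxDl.
move=> /(congr1 mxtrace); rewrite mxtraceD mxtrace0 => h.
have h1 : \tr (w *m w^T) = frob w^T ^+ 2 by rewrite frob_sqr /mxdot trmxK.
have h2 : \tr (w *m (A^T *m A) *m w^T) = frob (A *m w^T) ^+ 2.
  by rewrite frob_sqr /mxdot trmx_mul trmxK !mulmxA.
rewrite h1 h2 in h.
have : frob w^T ^+ 2 = 0.
  by apply/le_anti; rewrite sqr_ge0 andbT; have := sqr_ge0 (frob (A *m w^T)); lra.
by move=> /eqP; rewrite sqrf_eq0 => /eqP/frob_eq0/(congr1 trmx); rewrite trmxK trmx0.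
Qed.

Lemma tproj_gmx A : tproj A *m gmx A = gmx A.
Proof. by rewrite /tproj -mulmxA -/(gram A) mulmxKV// gram_unit. Qed.

Lemma tproj_tr A : (tproj A)^T = tproj A.
Proof.
rewrite /tproj !trmx_mul trmxK trmx_inv mulmxA; congr (_ *m invmx _ *m _).
by rewrite /gram trmx_mul trmxK.
Qed.

Lemma tproj_idem A : tproj A *m tproj A = tproj A.
Proof. by rewrite {2 3}/tproj !mulmxA tproj_gmx. Qed.

Lemma tproj_grass A : grass m (tproj A).
Proof.
split; [exact: tproj_tr|exact: tproj_idem|].
rewrite /tproj mxtrace_mulC mulmxA -/(gram A) mulmxV ?gram_unit//.
by rewrite mxtrace1.
Qed.

Lemma tproj_range A : [set y : 'cV[R]_(m + n) | tproj A *m y = y] =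
  gr (mulmx A) @` setT.
Proof.
have grE x : gr (mulmx A) x = gmx A *m x.
  by rewrite /gr /gmx mul_col_mx mul1mx.
apply/seteqP; split => [y /= <-|_ [x _ <-] /=].
  by exists (invmx (gram A) *m (gmx A)^T *m y) => //; rewrite grE !mulmxA.
by rewrite grE mulmxA tproj_gmx.
Qed.

End graph_projection.

(** * Compactly supported test functions *)

Section compactly_supported.
Context {R : realType} {N : nat}.

Lemma compact_supp_bound (phi : 'cV[R]_N -> R) :
  compact_supp setT phi -> exists2 M, 0 < M & forall y, M <= `|y| -> phi y = 0.
Proof.
move=> [cS _]; have /bounded_setP[M hM] : bounded_set (closure [set x | phi x != 0]).
  exact: compact_bounded.
exists (`|M| + 1); first by rewrite ltr_wpDl.
move=> y My; apply/eqP/negPn/negP => nz.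
have Sy : closure [set x | phi x != 0] y by apply: subset_closure.
have := hM y Sy; have := ler_norm M; lra.
Qed.

Lemma supported_unif (phi : 'cV[R]_N -> R) (M : R) :
  continuous phi -> 0 < M -> (forall y, M <= `|y| -> phi y = 0) ->
  (exists B, forall y, phi y <= B) /\
  (forall e, 0 < e -> exists2 d, 0 < d & forall y z, `|y - z| < d -> `|phi y - phi z| <= e).
Proof.
move=> pc M0 pM; pose K : set 'cV[R]_N := [set y | `|y| <= M + 1].
have cK : compact K.
  apply: cV_bounded_closed_compact; first by apply/bounded_setP; exists (M + 1).
  by apply: (@closed_norm_le _ _ _ id) => y; exact: cvg_id.
split.
  have : bounded_set (phi @` K).
    apply: compact_bounded; apply: continuous_compact => //.
    exact: continuous_subspaceT.
  move=> [B [_ hB]]; exists (`|B| + 1) => y.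
  have [yM|yM] := ltP `|y| M; last by rewrite pM// addr_ge0.
  apply: le_trans (ler_norm _) _; apply: (hB (`|B| + 1)).
    by apply: le_lt_trans (ler_norm _) _; rewrite ltrDl.
  by exists y => //; rewrite /K /=; lra.
move=> e e0.
pose P (d : R) (y : 'cV[R]_N) := forall z, `|y - z| < d -> `|phi y - phi z| <= e.
have : \forall d \near 0^'+, K `<=` P d.
  move: (cK) => /compact_near_coveringP; apply => y Ky.
  have e20 : 0 < e / 2 by rewrite divr_gt0.
  have /cvgrPdist_lt/(_ _ e20)/nbhs_ballP[d /= d0 hd] := pc y.
  have d20 : 0 < d / 2 by rewrite divr_gt0.
  near=> y' d' => z yz.
  have yy' : `|y - y'| < d / 2 by near: y'; apply/nbhs_ballP; exists (d / 2) => // w; rewrite -ball_normE.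
  have dd' : d' < d / 2 by near: d'; exact: nbhs_right_lt.
  have h1 : `|phi y - phi y'| < e / 2 by apply: hd; rewrite -ball_normE /=; lra.
  have h2 : `|phi y - phi z| < e / 2.
    apply: hd; rewrite -ball_normE /= -(subrKA y'); apply: le_lt_trans (ler_normD _ _) _.
    have := ltrD yy' (lt_trans yz dd'); rewrite -splitr; exact: le_lt_trans.
  rewrite -(subrKA (phi y)); apply: le_trans (ler_normD _ _) _.
  by move: h1; rewrite distrC; lra.
move=> Kd.
have [d [d0 d1 hd]] : exists d, [/\ 0 < d, d < 1 & K `<=` P d].
  near (0 : R)^'+ => d; exists d; split; last by near: d.
    by near: d; exact: nbhs_right_gt.
  by near: d; exact: nbhs_right_lt.
exists d => // y z yz; have [yK|yK] := pselect (K y); first exact: hd.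
have My : M + 1 < `|y| by rewrite ltNge; apply/negP.
rewrite !pM ?subrr ?normr0 ?ltW//; last by lra.
by have := ler_normD (y - z) z; rewrite subrK; lra.
Unshelve. all: by end_near. Qed.

End compactly_supported.

Lemma small_horner {R : realType} (p : {poly R}) (c : R) : p.[0] < c ->
  exists2 e, 0 < e & p.[e] < c.
Proof.
move=> pc; have c0 : 0 < c - p.[0] by rewrite subr_gt0.
have /cvgrPdist_lt/(_ _ c0)/nbhs_ballP[d /= d0 hd] := @continuous_horner _ p 0.
exists (d / 2); first by rewrite divr_gt0.
have := hd (d / 2); rewrite /ball/= sub0r normrN gtr0_norm ?divr_gt0//.
rewrite ltr_pdivrMr// ltr_pMr ?ltr1n// => /(_ isT); rewrite ltr_norml => /andP[? _]; lra.
Qed.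

(** * Convergence of the blow-ups *)

Section approximate_tangent.
Context {R : realType} {m n : nat}.
Hypothesis m0 : (0 < m)%N.
Notation leb := (@lebesgue_outer R m).
Notation N := (m + n)%N.
Notation H := (@hausdorff_outer R m N).
Notation HH := (hausdorff R m N).
Variables (v : 'cV[R]_m -> 'cV[R]_n) (L : R) (Omega : set 'cV[R]_m).
Variables (x : 'cV[R]_m) (A : 'M[R]_(n, m)).
Hypothesis L0 : 0 <= L.
Hypothesis vL : forall x y, `|v x - v y| <= L * `|x - y|.
Hypothesis oO : open Omega.
Hypothesis Ox : Omega x.
Hypothesis gx : lip_good v x.
Hypothesis dx : diff_at v x A.

Lemma mulmx_lip (y z : 'cV[R]_m) : `|A *m y - A *m z| <= m%:R * `|A| * `|y - z|.
Proof. by rewrite -mulmxBr; exact: norm_mulmx_le. Qed.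

Lemma blowup_limit (phi : 'cV[R]_N -> R) : continuous phi ->
  (forall y, 0 <= phi y) -> compact_supp setT phi ->
  let J r := (\int[HH]_(y in gr v @` Omega) (phi (r^-1 *: (y - gr v x)))%:E)%E in
  let I0 := (\int[HH]_(y in gr (mulmx A) @` setT) (phi y)%:E)%E in
  [/\ I0 \is a fin_num, (\forall r \near 0^'+, J r \is a fin_num) &
   (r ^+ m)^-1 * fine (J r) @[r --> 0^'+] --> fine I0].
Proof.
move=> pc p0 /compact_supp_bound[M M0 pM] J I0.
have [[B pB] punif] := supported_unif pc M0 pM.
have bounds := blowup_bounds m0 L0 vL oO Ox gx dx M0 pc p0 pB pM punif.
set C1 := @cHL R m n (L + m%:R * `|A|) * (2 * M) ^+ m in bounds.
set C2 := B * (@cHL R m n (L + m%:R * `|A|) * M ^+ m) in bounds.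
have J0 r : (0 <= J r)%E by apply: integral_ge0 => y _; rewrite lee_fin.
have I00 : (0 <= I0)%E by apply: integral_ge0 => y _; rewrite lee_fin.
have B0 : 0 <= B by apply: le_trans (p0 0) (pB 0).
have LA0 : 0 <= m%:R * `|A| by rewrite mulr_ge0.
have I0fin : I0 \is a fin_num.
  rewrite ge0_fin_numE//.
  have mc : measurable_fun setT (phi : caratheodory_type H -> R).
    apply: (continuous_cara_measurable _ openT) => [U oU|y _]; last exact: pc.
    exact: hausdorff_open_measurable.
  pose D : set 'cV[R]_m := ball 0 M.
  have oD : open D by exact: ball_open.
  have mP : H.-caratheodory (gr (mulmx A) @` setT).
    exact: gr_image_open_measurable LA0 mulmx_lip _ openT.
  have mD : H.-caratheodory (gr (mulmx A) @` D).
    exact: gr_image_open_measurable LA0 mulmx_lip _ oD.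
  apply: le_lt_trans (integral_split_le HH mP (@measurable0 _ _) mD (@sub0set _ _) B0 mc p0 pB _) _.
    move=> _ [xi _ <-] nz; right; exists xi => //; rewrite /D -ball_normE /= sub0r normrN.
    rewrite ltNge; apply/negP => h; move: nz; rewrite pM ?eqxx//.
    by apply: le_trans (norm_usub_le _); rewrite usub_gr.
  rewrite integral_set0 add0e lte_mul_pinfty ?lee_fin//.
  apply: le_lt_trans (hausdorff_gr_le m0 LA0 mulmx_lip D) _.
  rewrite lte_mul_pinfty ?lee_fin ?(ltW (cHL_gt0 _ _))//.
  by apply: le_lt_trans (leb_ball_le _ M0) (ltry _).
have Ub e : 0 < e -> exists2 d, 0 < d & forall r, 0 < r -> r < d ->
    J r \is a fin_num /\
    (r ^+ m)^-1 * fine (J r) <= (1 + e) ^+ m * (fine I0 + e * C1) + e * C2 /\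
    fine I0 <= (1 + e) ^+ m * ((r ^+ m)^-1 * fine (J r) + e * C1) + e * C2.
  move=> e0; have [d d0 hd] := bounds _ e0; exists d => // r r0 rd.
  have [h1 h2] := hd r r0 rd.
  rewrite -/(J r) -/I0 in h1 h2.
  have Jf : J r \is a fin_num.
    by rewrite ge0_fin_numE//; apply: le_lt_trans h1 _; rewrite -(fineK I0fin) -!(EFinM, EFinD) ltry.
  split => //.
  have rm0 : 0 < r ^+ m by rewrite exprn_gt0.
  have EI : I0 = (fine I0)%:E by rewrite fineK.
  have EJ : J r = (fine (J r))%:E by rewrite fineK.
  move: h1 h2; rewrite [in X in X -> _ -> _]EI [in X in X -> _ -> _]EJ [in X in _ -> X -> _]EI [in X in _ -> X -> _]EJ.
  move: (fine I0) (fine (J r)) => i j.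
  rewrite -!(EFinM, EFinD) !lee_fin => h1 h2; split => //.
  by rewrite mulrC ler_pdivrMr// mulrC.
split => //.
  have [d d0 hd] := Ub 1 ltr01; near=> r.
  have r0 : 0 < r by near: r; exact: nbhs_right_gt.
  have rd : r < d by near: r; exact: nbhs_right_lt.
  by have [] := hd r r0 rd.
apply/cvgrPdist_lt => eta eta0; set I := fine I0.
(* The bound of [Ub] as a polynomial in the error [e], with value [c] at [e = 0]: choosing [e] small
   makes it exceed [c] by as little as desired. *)
pose pp (c : R) : {poly R} := (1 + 'X) ^+ m * (c%:P + 'X * C1%:P) + 'X * C2%:P.
have ppE c e : (pp c).[e] = (1 + e) ^+ m * (c + e * C1) + e * C2.
  by rewrite /pp !hornerE.
have pp0 c : (pp c).[0] = c by rewrite ppE addr0 expr1n !mul0r !addr0 mul1r.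
pose qq : {poly R} := pp I - pp (I - eta).
have [e1 e10 he1] : exists2 e, 0 < e & (pp I).[e] < I + eta.
  by apply: small_horner; rewrite pp0 ltrDl.
have [e2 e20 he2] : exists2 e, 0 < e & (pp (I - eta)).[e] < I.
  by apply: small_horner; rewrite pp0 gtrDl oppr_lt0.
have [d1 d10 hd1] := Ub e1 e10; have [d2 d20 hd2] := Ub e2 e20.
near=> r.
have r0 : 0 < r by near: r; exact: nbhs_right_gt.
have rd1 : r < d1 by near: r; exact: nbhs_right_lt.
have rd2 : r < d2 by near: r; exact: nbhs_right_lt.
have [_ [u1 _]] := hd1 r r0 rd1.
have [_ [_ u2]] := hd2 r r0 rd2.
rewrite -ppE in u1; rewrite -/I in u2 *.
set j := _ * fine (J r) in u1 u2 *.
rewrite ltr_norml; apply/andP; split; first by move: (le_lt_trans u1 he1); lra.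
rewrite ltNge; apply/negP => h.
have jI : j <= I - eta by lra.
move: he2; rewrite ppE ltNge => /negP; apply.
apply: le_trans u2 _; rewrite lerD2r ler_wpM2l ?exprn_ge0 ?lerD2r//.
by rewrite addr_ge0// ltW.
Unshelve. all: by end_near. Qed.

End approximate_tangent.

Section tangent_of_graph.
Context {R : realType} {m n : nat}.
Hypothesis m0 : (0 < m)%N.
Notation leb := (@lebesgue_outer R m).
Notation N := (m + n)%N.
Notation H := (@hausdorff_outer R m N).
Notation HH := (hausdorff R m N).

Lemma compact_supp_norm (phi : 'cV[R]_N -> R) (M : R) :
  (forall y, M <= `|y| -> phi y = 0) -> compact_supp setT phi.
Proof.
move=> pM; split => //; pose K : set 'cV[R]_N := [set y | `|y| <= M].
have clK : closed K by apply: (@closed_norm_le _ _ _ id) => y; exact: cvg_id.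
apply: (subclosed_compact (@closed_closure _ _) (_ : compact K)).
  by apply: cV_bounded_closed_compact => //; apply/bounded_setP; exists M.
rewrite (iffLR (closure_id _) clK); apply: closure_subset => y /= nz.
by rewrite /K /= leNgt; apply/negP => h; move: nz; rewrite pM ?eqxx// ltW.
Qed.

(** Inclusion of ranges gives [Q P = P = P Q], so the squared norm of [Q - P] is [tr Q - tr P],
    which vanishes. *)
Lemma grass_range_inj (k : nat) (P Q : 'M[R]_N) : grass k P -> grass k Q ->
  (forall y : 'cV[R]_N, P *m y = y -> Q *m y = y) -> Q = P.
Proof.
move=> [Pt Pi Ptr] [Qt Qi Qtr] PQ.
have QP : Q *m P = P.
  apply: trmx_inj; apply/row_matrixP => j; rewrite -!tr_col; congr trmx.
  rewrite !colE -mulmxA; apply: PQ.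
  by rewrite mulmxA Pi.
have PQ' : P *m Q = P by have := congr1 trmx QP; rewrite trmx_mul Pt Qt.
apply/eqP; rewrite -subr_eq0; apply/eqP/frob_eq0/eqP; rewrite -sqrf_eq0 frob_sqr /mxdot.
rewrite [(Q - P)^T]linearB /= Pt Qt mulmxBl !mulmxBr Qi Pi QP PQ' subrr subr0.
by rewrite linearB /= Ptr Qtr subrr.
Qed.

Lemma bump_continuous (y0 : 'cV[R]_N) (rho : R) :
  continuous (fun y : 'cV[R]_N => Num.max 0 (rho - `|y - y0|)).
Proof.
apply: (@lipschitz_continuous _ _ _ _ 1) => y z; rewrite mul1r.
have h : `| `|y - y0| - `|z - y0| | <= `|y - z|.
  apply: le_trans (ler_dist_dist _ _) _.
  by rewrite opprB addrA subrK.
move: h; move: (`|y - y0|) (`|z - y0|) (`|y - z|) => a b e.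
by rewrite /Num.max; case: ifPn; case: ifPn; rewrite -?leNgt !ler_norml; lra.
Qed.

Lemma tproj_integral_gt0 (A : 'M[R]_(n, m)) (y0 : 'cV[R]_N) (rho : R) : 0 < rho ->
  tproj A *m y0 = y0 ->
  (0 < \int[HH]_(y in gr (mulmx A) @` setT) (Num.max 0 (rho - `|y - y0|))%:E)%E.
Proof.
move=> rho0 y0P.
have LA0 : 0 <= m%:R * `|A| by rewrite mulr_ge0.
have grl := gr_norm_lip LA0 (mulmx_lip A).
have : (gr (mulmx A) @` setT) y0 by rewrite -tproj_range.
move=> [x0 _ x0E].
have K0 : 0 < 1 + m%:R * `|A| by rewrite ltr_pwDl.
pose d := rho / 2 / (1 + m%:R * `|A|).
have d0 : 0 < d by rewrite !divr_gt0.
pose D : set 'cV[R]_m := ball x0 d.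
have oD : open D by exact: ball_open.
have mP : H.-caratheodory (gr (mulmx A) @` setT).
  exact: gr_image_open_measurable LA0 (mulmx_lip A) _ openT.
have mD : H.-caratheodory (gr (mulmx A) @` D).
  exact: gr_image_open_measurable LA0 (mulmx_lip A) _ oD.
have c := @bump_continuous y0 rho.
have mf : measurable_fun setT ((fun y => Num.max 0 (rho - `|y - y0|)) : caratheodory_type H -> R).
  apply: (continuous_cara_measurable _ openT) => [U oU|y _]; last exact: c.
  exact: hausdorff_open_measurable.
have lebD : (0 < leb D)%E.
  have s0 : 0 < d / 2 by rewrite divr_gt0.
  apply: lt_le_trans (_ : ((d / 2) ^+ m)%:E <= _)%E; first by rewrite lte_fin exprn_gt0.
  apply: le_trans (leb_cube_ge m0 x0 s0) _; apply: le_outer_measure => y hy.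
  rewrite /D -ball_normE /= distrC; apply: le_lt_trans (_ : d / 2 < d); last first.
    by rewrite ltr_pdivrMr// ltr_pMr ?ltr1n.
  apply/mx_norm_leP; first exact: ltW.
  move=> i j; rewrite !ord1; have := hy i; rewrite !mxE => /andP[h1 h2].
  by rewrite ger0_norm ?subr_ge0//; lra.
have HD : (0 < H (gr (mulmx A) @` D))%E.
  rewrite lt_neqAle outer_measure_ge0 andbT; apply/negP => /eqP h.
  by have := leb_le_hausdorff_gr m0 (mulmx A) D; rewrite -h mule0 leNgt lebD.
apply: (@lt_le_trans _ _ ((rho / 2)%:E * HH (gr (mulmx A) @` D))%E).
  by rewrite mule_gt0// lte_fin divr_gt0.
have mE (X : set (caratheodory_type H)) : measurable_fun X (fun y => (Num.max 0 (rho - `|y - y0|))%:E).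
  by apply: measurable_funTS; exact/measurable_EFinP.
rewrite -integral_cst//.
apply: (@le_trans _ _ (\int[HH]_(y in gr (mulmx A) @` D) (Num.max 0 (rho - `|y - y0|))%:E)%E).
  apply: ge0_le_integral => //.
  - by move=> y _; rewrite lee_fin divr_ge0// ltW.
  - move=> _ [x Dx <-]; rewrite lee_fin le_max; apply/orP; right.
    move: Dx; rewrite /D -ball_normE /= distrC ltr_pdivlMr// => Dx.
    have := grl x x0; rewrite x0E mulrC; lra.
apply: ge0_subset_integral => //.
- by move=> y _; rewrite lee_fin le_max lexx.
- by move=> _ [y _ <-]; exists y.
Qed.

Variables (v : 'cV[R]_m -> 'cV[R]_n) (L : R) (Omega : set 'cV[R]_m).
Hypothesis L0 : 0 <= L.
Hypothesis vL : forall x y, `|v x - v y| <= L * `|x - y|.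
Hypothesis oO : open Omega.

(** The blow-up limit is available for nonnegative functions; a signed [phi] is split into its
    positive and negative parts, both continuous with compact support. *)
Lemma is_approx_tangent_gr (x : 'cV[R]_m) (A : 'M[R]_(n, m)) :
  Omega x -> lip_good v x -> diff_at v x A ->
  is_approx_tangent m (gr v @` Omega) (gr v x) (tproj A).
Proof.
move=> Ox gx dx; split; first exact: tproj_grass.
move=> phi pc ps; have [M M0 pM] := compact_supp_bound ps.
rewrite tproj_range.
pose pp y := Num.max 0 (phi y); pose pn y := Num.max 0 (- phi y).
have ppc : continuous pp.
  by move=> y; apply: (@continuous_max _ _ (cst 0) phi y); [exact: cst_continuous|exact: pc].
have pnc : continuous pn.
  move=> y; apply: (@continuous_max _ _ (cst 0) (\- phi) y); first exact: cst_continuous.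
  exact: continuousN (pc y).
have ppM : compact_supp setT pp.
  by apply: (@compact_supp_norm _ M) => y /pM; rewrite /pp => ->; rewrite maxxx.
have pnM : compact_supp setT pn.
  by apply: (@compact_supp_norm _ M) => y /pM; rewrite /pn => ->; rewrite oppr0 maxxx.
have pp0 y : 0 <= pp y by rewrite le_max lexx.
have pn0 y : 0 <= pn y by rewrite le_max lexx.
have [fp np lp] := blowup_limit m0 L0 vL oO Ox gx dx ppc pp0 ppM.
have [fn nn ln] := blowup_limit m0 L0 vL oO Ox gx dx pnc pn0 pnM.
have split_int (f : 'cV[R]_N -> 'cV[R]_N) D :
    (\int[HH]_(y in D) (pp (f y))%:E)%E \is a fin_num ->
    (\int[HH]_(y in D) (pn (f y))%:E)%E \is a fin_num ->
    (\int[HH]_(y in D) phi (f y) = fine (\int[HH]_(y in D) (pp (f y))%:E)%E -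
      fine (\int[HH]_(y in D) (pn (f y))%:E)%E)%R.
  move=> h1 h2; rewrite /Rintegral integralE -fineB//.
  congr (fine (_ - _)%E); apply: eq_integral => y _.
    by rewrite funeposE /= /pp EFin_max maxC.
  by rewrite funenegE /= /pn EFin_max maxC.
rewrite (split_int id)//.
apply: cvg_trans (cvgB lp ln); apply: near_eq_cvg; near=> r => /=.
rewrite (split_int (fun y => r^-1 *: (y - gr v x))) ?mulrBr//.
- by near: r.
- by near: r.
Unshelve. all: by end_near. Qed.

(** [approx_tangent] picks some plane, so uniqueness is needed. If [y0] lay in the range of
    [tproj A] but not in that of the chosen [P], a bump at [y0] vanishing on the range of [P] would
    have a positive and a zero integral as limits of the same blow-ups. *)
Lemma approx_tangent_gr (x : 'cV[R]_m) (A : 'M[R]_(n, m)) :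
  Omega x -> lip_good v x -> diff_at v x A ->
  approx_tangent m (gr v @` Omega) (gr v x) = tproj A.
Proof.
move=> Ox gx dx; have tA := is_approx_tangent_gr Ox gx dx.
rewrite /approx_tangent; case: xgetP => [P _ tP|/(_ (tproj A))//].
apply: (grass_range_inj tA.1 tP.1) => y0 y0A; apply/eqP; apply: contraT => y0P.
have Pc : continuous (fun y : 'cV[R]_N => P *m y - y).
  apply: continuousBf; first exact: mulmx_continuous.
  by move=> y; exact: cvg_id.
have : closed [set y : 'cV[R]_N | `|P *m y - y| <= 0] by exact: closed_norm_le.
move=> /closed_openC oC.
have : (~` [set y : 'cV[R]_N | `|P *m y - y| <= 0]) y0.
  by move=> /=; rewrite normr_le0 subr_eq0; exact/negP.
move=> Cy0; have /nbhs_ballP[rho /= rho0 hrho] := open_nbhs_nbhs (conj oC Cy0).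
pose phi (y : 'cV[R]_N) := Num.max 0 (rho - `|y - y0|).
have pc : continuous phi by exact: bump_continuous.
have ps : compact_supp setT phi.
  apply: (@compact_supp_norm _ (rho + `|y0|)) => y h; apply/max_idPl.
  rewrite subr_le0; have := ler_normD (y - y0) y0; rewrite subrK; lra.
have phi0 y : 0 <= phi y by rewrite le_max lexx.
have [fp _ _] := blowup_limit m0 L0 vL oO Ox gx dx pc phi0 ps.
have := cvg_unique _ (tA.2 phi pc ps) (tP.2 phi pc ps).
rewrite tproj_range /Rintegral.
rewrite [X in _ = fine X](_ : _ = 0%E); last first.
  apply: integral0_eq => y /= yP; rewrite /phi; congr EFin; apply/max_idPl.
  rewrite subr_le0 leNgt; apply/negP => h.
  have /hrho : ball y0 rho y by rewrite -ball_normE /= distrC.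
  by apply; rewrite /= yP subrr normr0.
move=> h; have := tproj_integral_gt0 rho0 y0A.
by rewrite -(fineK fp) h ?ltxx//; exact: Rhausdorff.
Qed.

End tangent_of_graph.

(** * Calculus on the Grassmannian *)

Section gradient.
Context {R : realType}.

Lemma diff_mxgrad {a b} (F : 'M[R]_(a, b) -> R) (T X : 'M[R]_(a, b)) :
  differentiable F T -> 'd F T X = mxdot (mxgrad F T) X.
Proof.
move=> dF; rewrite {1}(matrix_sum_delta X) linear_sum mxdotE; apply: eq_bigr => i _.
rewrite linear_sum; apply: eq_bigr => j _.
by rewrite linearZ /= !mxE [RHS]mulrC.
Qed.

Lemma diff_segment {a b} (F : 'M[R]_(a, b) -> R) (S V : 'M[R]_(a, b)) (s : R) :
  differentiable F (S + s *: V) ->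
  is_derive s 1 (fun t => F (S + t *: V)) ('d F (S + s *: V) V).
Proof.
move=> dF; pose f := fun t : R => F (S + t *: V).
pose df : {linear R^o -> R^o} := [the {linear R^o -> R^o} of *:%R ('d F (S + s *: V) V : R)].
have [] // := @diff_intro R R^o R^o f df s.
- by move=> t; exact: scaler_continuous.
- move=> e e0; have V0 : 0 < `|V| + 1 by rewrite ltr_wpDl.
  have [d d0 hd] := diff_elim dF (divr_gt0 e0 V0).
  exists (d / (`|V| + 1)); first exact: divr_gt0.
  move=> h; rewrite ltr_pdivlMr// => hh.
  have hV : `|h *: V| <= `|h| * (`|V| + 1) by rewrite normrZ ler_wpM2l// lerDl.
  have := hd (h *: V) (le_lt_trans hV hh); rewrite -[S + _ + _]addrA -scalerDl linearZ => hd'.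
  have -> : df h = h *: 'd F (S + s *: V) V by exact: mulrC.
  apply: (le_trans hd').
  by rewrite mulrAC ler_pdivrMr// -mulrA ler_wpM2l// ltW.
move=> df1 df2; apply: DeriveDef; first exact: diff_derivable.
by rewrite deriveE// df2 /= [LHS]mulr1.
Qed.

Lemma grad_lipschitz {a b} (F : 'M[R]_(a, b) -> R) (c : R) :
  (forall T, differentiable F T) -> (forall T, frob (mxgrad F T) <= c) ->
  forall T S, `|F T - F S| <= c * frob (T - S).
Proof.
move=> dF cF T S.
have dS t := @diff_segment _ _ F S (T - S) t (dF _).
have [|t _] := @MVT R (fun t => F (S + t *: (T - S))) _ 0 1 ltr01 (fun t _ => dS t).
  apply: derivable_within_continuous => t _; have [+ _] := dS t; exact.
rewrite scale1r scale0r addr0 [S + _]addrC subrK subr0 mulr1 => ->.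
rewrite diff_mxgrad//; apply: le_trans (mxdot_absCS _ _) _.
by rewrite ler_wpM2r ?frob_ge0.
Qed.

End gradient.

(** * Curves in the Grassmannian *)

Section grassmann_curves.
Context {R : realType} {N : nat}.
Implicit Types (P T : 'M[R]_N) (a b : 'cV[R]_N).

Let sq a : a^T *m a = (frob a ^+ 2)%:M.
Proof.
by rewrite [LHS]mx11_scalar frob_sqr /mxdot /mxtrace big_ord_recl big_ord0 addr0.
Qed.

Lemma rank1_proj a (c : R) : c * frob a ^+ 2 = 1 -> grass 1 (c *: (a *m a^T)).
Proof.
move=> ca; split.
- by rewrite linearZ /= trmx_mul trmxK.
- rewrite -scalemxAl -scalemxAr scalerA mulmxA -[a *m a^T *m a]mulmxA sq mul_mx_scalar.
  by rewrite -scalemxAl scalerA -mulrA ca mulr1.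
- by rewrite mxtraceZ mxtrace_mulC sq mxtrace_scalar mulr1n ca.
Qed.

Lemma grass_swap (k : nat) T P Q : grass k T -> grass 1 P -> grass 1 Q ->
  T *m P = P -> (T - P) *m Q = 0 -> grass k (T - P + Q).
Proof.
move=> [Tt Ti Ttr] [Pt Pi Ptr] [Qt Qi Qtr] TP TPQ.
have PT : P *m T = P by have := congr1 trmx TP; rewrite trmx_mul Pt Tt.
have St : (T - P)^T = T - P by rewrite linearB /= Tt Pt.
have QTP : Q *m (T - P) = 0 by have := congr1 trmx TPQ; rewrite trmx_mul St Qt trmx0.
split; first by rewrite linearD /= St Qt.
- have : (T - P) *m (T - P) = T - P.
    by rewrite mulmxBl !mulmxBr Ti Pi TP PT subrr subr0.
  move: (T - P) TPQ QTP => S SQ QS SS.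
  by rewrite mulmxDl !mulmxDr SQ QS Qi SS addr0 add0r.
- by rewrite linearD linearB /= Ttr Ptr Qtr subrK.
Qed.

(* The plane [im T] is tilted from [a] towards [b]: the curve replaces the line
   through [a] by the line through [a + s b]. *)
Definition tilt T a b (s : R) : 'M[R]_N :=
  T - (frob a ^- 2) *: (a *m a^T) +
  (frob a ^+ 2 + s ^+ 2 * frob b ^+ 2)^-1 *: ((a + s *: b) *m (a + s *: b)^T).

Lemma tilt_grass (k : nat) T a b s : grass k T -> a != 0 -> T *m a = a -> T *m b = 0 ->
  grass k (tilt T a b s).
Proof.
move=> gT a0 Ta Tb; have [Tt Ti Ttr] := gT.
have fa : frob a ^+ 2 != 0.
  by rewrite sqrf_eq0; apply: contra a0 => /eqP/frob_eq0 ->.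
have abT : a^T *m b = 0 by rewrite -Ta trmx_mul Tt -mulmxA Tb mulmx0.
have baT : b^T *m a = 0 by have := congr1 trmx abT; rewrite trmx_mul trmxK trmx0.
have fw : frob (a + s *: b) ^+ 2 = frob a ^+ 2 + s ^+ 2 * frob b ^+ 2.
  rewrite frob_sqr /mxdot [(_ + _)^T]linearD /= [(s *: b)^T]linearZ /= mulmxDl !mulmxDr.
  rewrite -!scalemxAl -!scalemxAr abT baT !scaler0 addr0 add0r !sq scalerA.
  by rewrite linearD /= mxtraceZ !mxtrace_scalar !mulr1n expr2.
have fa2 : 0 < frob a ^+ 2 by rewrite lt_neqAle eq_sym fa sqr_ge0.
have w0 : frob a ^+ 2 + s ^+ 2 * frob b ^+ 2 != 0.
  by rewrite gt_eqF// ltr_pwDl// mulr_ge0// sqr_ge0.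
apply: grass_swap => //.
- by apply: rank1_proj; rewrite mulVf.
- by apply: rank1_proj; rewrite fw mulVf.
- by rewrite -scalemxAr mulmxA Ta.
- rewrite -scalemxAr mulmxA mulmxBl -[(_ *: _) *m _]scalemxAl.
  rewrite mulmxDr Ta -scalemxAr Tb scaler0 addr0 -mulmxA mulmxDr -scalemxAr abT scaler0 addr0.
  by rewrite sq mul_mx_scalar scalerA mulVf// scale1r subrr mul0mx scaler0.
Qed.

(** Clearing the denominator makes the expansion exact: up to the factor [frob a ^+ 2], the velocity
    at [s = 0] is [a b^t + b a^t], and the remainder carries an explicit factor [s]. *)
Lemma tiltE T a b s : a != 0 ->
  (frob a ^+ 2 + s ^+ 2 * frob b ^+ 2) *: (tilt T a b s - T) =
  s *: (a *m b^T + b *m a^T + s *: (b *m b^T - (frob b ^+ 2 / frob a ^+ 2) *: (a *m a^T))).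
Proof.
move=> a0.
have fa : frob a ^+ 2 != 0.
  by rewrite sqrf_eq0; apply: contra a0 => /eqP/frob_eq0 ->.
have fa2 : 0 < frob a ^+ 2 by rewrite lt_neqAle eq_sym fa sqr_ge0.
have w0 : frob a ^+ 2 + s ^+ 2 * frob b ^+ 2 != 0.
  by rewrite gt_eqF// ltr_pwDl// mulr_ge0// sqr_ge0.
rewrite /tilt [(_ + _)^T]linearD /= [(s *: b)^T]linearZ /= mulmxDl !mulmxDr.
rewrite -!scalemxAl -!scalemxAr.
move: (a *m a^T) (a *m b^T) (b *m a^T) (b *m b^T) => p q r t.
apply/matrixP => i j; rewrite !mxE.
by field; rewrite exprMn w0 andbT -sqrf_eq0.
Qed.

(** A function vanishing on the Grassmannian is constant along [tilt], so its differential vanishes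
    on the velocity of that curve. *)
Lemma tangent_diff0 (k : nat) (F : 'M[R]_N -> R) T a b : grass k T ->
  differentiable F T -> (forall P, grass k P -> F P = 0) ->
  T *m a = a -> T *m b = 0 -> 'd F T (a *m b^T + b *m a^T) = 0.
Proof.
move=> gT dF F0 Ta Tb; have [->|a0] := eqVneq a 0.
  by rewrite mul0mx trmx0 mulmx0 addr0 linear0.
set X := _ + _; set Q := b *m b^T - (frob b ^+ 2 / frob a ^+ 2) *: (a *m a^T).
have fa : frob a ^+ 2 != 0.
  by rewrite sqrf_eq0; apply: contra a0 => /eqP/frob_eq0 ->.
have fa2 : 0 < frob a ^+ 2 by rewrite lt_neqAle eq_sym fa sqr_ge0.
have key e : 0 < e -> `|'d F T X| <= e * (`|X| + `|Q| + `|'d F T Q|).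
  move=> e0; have [d d0 hd] := diff_elim dF e0.
  have b0 : 0 < `|X| + `|Q| + 1 by rewrite ltr_wpDl// addr_ge0.
  (* The bound 1 controls the remainder in the norm, the bound [e] makes its differential small, and
     the last one keeps the curve in the ball where the linear approximation holds. *)
  pose s := Num.min (Num.min 1 e) (d * frob a ^+ 2 / (`|X| + `|Q| + 1) / 2).
  have s0 : 0 < s by rewrite !lt_min ltr01 e0 !divr_gt0// mulr_gt0.
  have [s1 se] : s <= 1 /\ s <= e.
    by split; rewrite !ge_min lexx ?orbT.
  have sd : s * (`|X| + `|Q| + 1) < d * frob a ^+ 2.
    rewrite -ltr_pdivlMr//; apply: le_lt_trans (_ : _ <= d * frob a ^+ 2 / (`|X| + `|Q| + 1) / 2) _.
      by rewrite !ge_min lexx orbT.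
    by rewrite ltr_pdivrMr// ltr_pMr ?ltr1n// divr_gt0// mulr_gt0.
  pose w := frob a ^+ 2 + s ^+ 2 * frob b ^+ 2.
  have w1 : frob a ^+ 2 <= w by rewrite lerDl mulr_ge0// sqr_ge0.
  have w0 : 0 < w by apply: lt_le_trans w1.
  have hE : tilt T a b s - T = (s / w) *: (X + s *: Q).
    by rewrite mulrC -scalerA -(tiltE T b s a0) scalerA mulVf ?gt_eqF// scale1r.
  have XQ : `|X + s *: Q| <= `|X| + `|Q|.
    apply: le_trans (ler_normD _ _) _; rewrite lerD2l normrZ gtr0_norm//.
    by rewrite ler_piMl.
  have sw0 : 0 < s / w by rewrite divr_gt0.
  have hsmall : `|tilt T a b s - T| < d.
    rewrite hE normrZ gtr0_norm// mulrAC ltr_pdivrMr//.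
    apply: (@le_lt_trans _ _ (s * (`|X| + `|Q| + 1))).
      by rewrite ler_wpM2l ?(ltW s0)//; apply: le_trans XQ _; rewrite lerDl.
    by apply: lt_le_trans sd _; rewrite ler_wpM2l// ltW.
  have := hd _ hsmall; rewrite [T + _]addrC subrK !F0//; last exact: tilt_grass.
  rewrite subrr sub0r normrN hE linearZ /= [X in X <= _]normrM [X in _ <= _ * X]normrZ gtr0_norm//.
  rewrite mulrCA ler_pM2l// linearD linearZ /= => h.
  have -> : 'd F T X = ('d F T X + s *: 'd F T Q) - s *: 'd F T Q by rewrite addrK.
  apply: le_trans (ler_normB _ _) _; rewrite mulrDr; apply: lerD.
    by apply: le_trans h _; rewrite ler_wpM2l// ltW.
  by rewrite [X in X <= _]normrM gtr0_norm// ler_wpM2r.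
apply/eqP; rewrite -normr_le0; apply/ler_addgt0Pr => e e0; rewrite add0r.
have c0 : 0 < `|X| + `|Q| + `|'d F T Q| + 1 by rewrite ltr_wpDl// !addr_ge0.
apply: le_trans (key _ (divr_gt0 e0 c0)) _.
by rewrite mulrAC ler_pdivrMr// ler_pM2l// lerDl.
Qed.

End grassmann_curves.

Lemma continuous_reflect {R : realType} {V : normedModType R} (f : V -> R) (a : V) :
  continuous f -> continuous (fun y => - f (a - y)).
Proof.
move=> fc y; apply: continuousN.
apply: (@continuous_comp _ _ _ (fun y => a - y) f); last exact: fc.
by apply: continuousB; [exact: cst_continuous|exact: cvg_id].
Qed.

(** * The first variation matrices *)

Section first_variation.
Context {R : realType} {N : nat}.
Implicit Types (Phi Psi : 'M[R]_N -> R) (T S : 'M[R]_N).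

Definition sgrad Phi T : 'M[R]_N := mxgrad Phi T + (mxgrad Phi T)^T.

(** The matrix [anisoB] computed with a fixed extension [Phi] defined on all matrices, in place of
    the one selected by [xget]. *)
Definition bform Phi T : 'M[R]_N := Phi T *: T + perp T *m sgrad Phi T *m T.

Lemma sgrad_tr Phi T : (sgrad Phi T)^T = sgrad Phi T.
Proof. by rewrite /sgrad linearD /= trmxK addrC. Qed.

Lemma grass_perp (k l : nat) T : N = (k + l)%N -> grass k T -> grass l (perp T).
Proof.
move=> Nkl [Tt Ti Ttr]; split.
- by rewrite /perp linearB /= trmx1 Tt.
- by rewrite /perp mulmxBl !mulmxBr !mul1mx mulmx1 Ti subrr subr0.
- by rewrite /perp linearB /= mxtrace1 Ttr Nkl natrD [_ + l%:R]addrC addrK.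
Qed.

Lemma perpK T : perp (perp T) = T.
Proof. by rewrite /perp opprB addrC subrK. Qed.

Lemma mulmx_perp (k : nat) T : grass k T -> T *m perp T = 0 /\ perp T *m T = 0.
Proof.
by move=> [_ Ti _]; rewrite /perp mulmxBr mulmxBl mulmx1 mul1mx Ti subrr.
Qed.

(** The entry [(i, j)] pairs the gradient with [a b^t + b a^t], where [a] is a column of [T] and [b]
    a column of [perp T]. These are tangent directions, along which two extensions have the same
    derivative by [tangent_diff0]. *)
Lemma sgrad_extension (k : nat) Phi Phi' T : grass k T ->
  differentiable Phi T -> differentiable Phi' T ->
  (forall P, grass k P -> Phi P = Phi' P) ->
  perp T *m sgrad Phi T *m T = perp T *m sgrad Phi' T *m T.
Proof.
move=> gT d1 d2 PhiE; pose F P := Phi P - Phi' P.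
have dF : differentiable F T by exact: differentiableB.
have gF : mxgrad F T = mxgrad Phi T - mxgrad Phi' T.
  by apply/matrixP => i j; rewrite !mxE diffB.
apply/eqP; rewrite -subr_eq0; apply/eqP.
have -> : perp T *m sgrad Phi T *m T - perp T *m sgrad Phi' T *m T =
    perp T *m (mxgrad F T + (mxgrad F T)^T) *m T.
  by rewrite -mulmxBl -mulmxBr /sgrad gF [(_ - _)^T]linearB /= opprD addrACA.
apply/matrixP => i j; rewrite [RHS]mxE.
pose a := col j T; pose b := col i (perp T).
have [Tp pT] := mulmx_perp gT.
have Ta : T *m a = a by rewrite /a colE mulmxA; case: gT => _ -> _.
have Tb : T *m b = 0 by rewrite /b colE mulmxA Tp mul0mx.
have F0 P : grass k P -> F P = 0 by move=> /PhiE; rewrite /F => ->; rewrite subrr.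
have := tangent_diff0 gT dF F0 Ta Tb; rewrite diff_mxgrad//.
set G := mxgrad F T => h.
have -> : (perp T *m (G + G^T) *m T) i j = \tr (b^T *m (G + G^T) *m a).
  have bE : b^T = row i (perp T).
    by rewrite /b tr_col; case: gT => Tt _ _; rewrite /perp linearB /= trmx1 Tt.
  rewrite bE -!row_mul /mxtrace big_ord_recl big_ord0 addr0 /a.
  by rewrite !mxE; apply: eq_bigr => l _; rewrite mxE [X in _ = _ * X]mxE.
rewrite -h /mxdot mulmxDr !mulmxA [in RHS]mxtraceD.
rewrite mulmxDr mulmxDl mxtraceD addrC; congr (_ + _).
  by rewrite [RHS]mxtrace_mulC !mulmxA.
by rewrite [RHS]mxtrace_mulC -[LHS]mxtrace_tr !trmx_mul trmxK !mulmxA.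
Qed.

Lemma anisoBE (k : nat) Psi Phi T : C1_on setT Phi ->
  (forall P, grass k P -> Phi P = Psi P) -> grass k T ->
  anisoB k Psi T = bform Phi T.
Proof.
move=> C1 PhiPsi gT.
have ext : C1_extension k Psi Phi.
  split; first by exists setT; split => //; exact: openT.
  by move=> P; rewrite inE; exact: PhiPsi.
have E := PhiPsi _ gT.
suff h : perp T *m sgrad (xget Psi [set Phi | C1_extension k Psi Phi]) T *m T =
    perp T *m sgrad Phi T *m T.
  rewrite /bform E -h.
  reflexivity.
case: xgetP => [Phi' _ [[U [oU gU [dU _]]] Phi'E]|/(_ Phi)/(_ ext)[]].
apply: (@sgrad_extension k Phi' Phi T gT).
- exact/dU/gU.
- by apply: C1.1.
- by move=> P gP; rewrite Phi'E ?inE// PhiPsi.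
Qed.

Lemma anisoB0 (k : nat) Psi : anisoB k Psi 0 = 0.
Proof. by rewrite /anisoB scaler0 mulmx0 addr0. Qed.

Lemma diff_reflect Phi T : differentiable Phi (1%:M - T) ->
  differentiable (fun P => Phi (1%:M - P)) T /\
  forall X, 'd (fun P => Phi (1%:M - P)) T X = - 'd Phi (1%:M - T) X.
Proof.
move=> dP.
pose df : {linear 'M[R]_N -> R^o} := [the {linear _ -> _} of \- ('d Phi (1%:M - T) : _ -> R^o)].
have [] // := @diff_intro R 'M[R]_N R^o (fun P => Phi (1%:M - P)) df T.
- move=> X; apply: continuousN; exact: (diff_continuous dP).
- move=> e e0; have [d d0 hd] := diff_elim dP e0; exists d => // h hh.
  have := hd (- h); rewrite normrN => /(_ hh); rewrite linearN /=.
  by rewrite [- (T + h)]opprD [1%:M + (_ + _)]addrA.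
move=> h1 h2; split; first exact: h1.
by move=> X; exact: (congr1 (fun L : 'M[R]_N -> R^o => L X) h2).
Qed.

Lemma C1_reflect Phi : C1_on setT Phi -> C1_on setT (fun P => Phi (1%:M - P)).
Proof.
move=> [dP cP]; split => [T _|X T _].
  by have [] := diff_reflect (dP (1%:M - T) I).
have -> : (fun y => 'd (fun P => Phi (1%:M - P)) y X) =
    (fun y => - 'd Phi (1%:M - y) X).
  by apply/funext => y; exact: ((diff_reflect (dP (1%:M - y) I)).2 X).
by apply: (@continuous_reflect _ _ (fun y => 'd Phi y X) 1%:M) => y; exact: cP.
Qed.

(** This is [anisoB] of the dual function at [perp S], rewritten at [S]: the two projections change
    places, and the minus sign comes from differentiating [P |-> Phi (1%:M - P)]. *)
Definition bdual Phi S : 'M[R]_N := Phi S *: perp S - S *m sgrad Phi S *m perp S.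

Lemma anisoB_dual (k l : nat) Psi Phi S : N = (k + l)%N -> C1_on setT Phi ->
  (forall P, grass k P -> Phi P = Psi P) -> grass k S ->
  anisoB l (dual Psi) (perp S) = bdual Phi S.
Proof.
move=> Nkl C1 PhiPsi gS.
rewrite (@anisoBE l (dual Psi) (fun P => Phi (1%:M - P))).
- rewrite /bform perpK /bdual -[1%:M - perp S]/(perp (perp S)) perpK; congr (_ + _).
  rewrite -mulNmx -mulmxN; congr (_ *m _ *m _).
  rewrite /sgrad (_ : mxgrad _ _ = - mxgrad Phi S); first by rewrite linearN /= opprD.
  apply/matrixP => i j; rewrite mxE 2!mxE -[in RHS](perpK S).
  exact: ((@diff_reflect Phi (perp S) (C1.1 _ I)).2 (delta_mx i j)).
- exact: C1_reflect.
- move=> P gP; rewrite /dual; apply: PhiPsi; apply: grass_perp gP.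
  by rewrite addnC.
- exact: grass_perp gS.
Qed.

(** With [X = S D (perp S)] the product is [(f S + X)(f (perp S) - X)]. As [S (perp S)] and [X X]
    vanish and [S X = X = X (perp S)], the two mixed terms cancel. *)
Lemma bform_bdual (k : nat) Phi S : grass k S -> (bform Phi S)^T *m bdual Phi S = 0.
Proof.
move=> gS; have [Sp pS] := mulmx_perp gS; have [St Si _] := gS.
have pt : (perp S)^T = perp S by rewrite /perp linearB /= trmx1 St.
have pp : perp S *m perp S = perp S by rewrite {1}/perp mulmxBl mul1mx Sp subr0.
have -> : (bform Phi S)^T = Phi S *: S + S *m sgrad Phi S *m perp S.
  by rewrite /bform [(_ + _)^T]linearD /= [(_ *: S)^T]linearZ /= !trmx_mul sgrad_tr pt St mulmxA.
rewrite /bdual; move: (sgrad Phi S) (Phi S) => D f.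
set X := S *m D *m perp S.
have SX : S *m X = X by rewrite /X !mulmxA Si.
have Xp : X *m perp S = X by rewrite /X -mulmxA pp.
have XX : X *m X = 0 by rewrite -{1}Xp -mulmxA /X !mulmxA -[X in X *m _ *m _]mulmxA pS mulmx0 !mul0mx.
rewrite mulmxDl !mulmxBr -!scalemxAl -!scalemxAr Sp SX Xp XX.
by rewrite !scaler0 sub0r subr0 addNr.
Qed.

Lemma grass_frob (k : nat) T : grass k T -> frob T <= 1 + k%:R.
Proof.
move=> [Tt Ti Ttr]; rewrite -(@ler_pXn2r _ 2) ?nnegrE ?frob_ge0 ?addr_ge0//.
rewrite frob_sqr /mxdot Tt Ti Ttr sqrrD expr1n mul1r.
by rewrite -addrA ler_wpDl// mulr2n -addrA lerDl addr_ge0// sqr_ge0.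
Qed.

End first_variation.

Lemma ler_sum2 {R : realType} {a b : nat} (X : 'I_a -> 'I_b -> R) i j :
  (forall i j, 0 <= X i j) -> X i j <= \sum_i \sum_j X i j.
Proof.
move=> X0; rewrite (bigD1 i)//= (bigD1 j)//= -addrA lerDl addr_ge0//.
  by apply: sumr_ge0.
by do 2 (apply: sumr_ge0 => ? _).
Qed.

(** * Bounds from the C^2 norm *)

Section C2_bounds.
Context {R : realType} {N : nat}.
Implicit Types (Phi Psi : 'M[R]_N -> R) (T S : 'M[R]_N).

Definition C2_bound (K : R) Phi : Prop :=
  [/\ C2_on setT Phi, forall T, `|Phi T| <= K, forall T, frob (mxgrad Phi T) <= K &
      forall T, hess_norm Phi T <= K].

(** [C2_norm] is an infimum over extensions; asking for [K + 1] ensures that some extension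
    satisfies the bound. *)
Lemma C2_norm_extension (k : nat) Psi (K : R) : C2_norm k Psi = K%:E ->
  exists2 Phi, C2_bound (K + 1) Phi & forall P, grass k P -> Phi P = Psi P.
Proof.
move=> PsiK; have : (C2_norm k Psi < (K + 1)%:E)%E by rewrite PsiK lte_fin ltrDl.
move=> /ereal_inf_lt[_ [Phi [C2 PhiE] <-] /ltW].
rewrite /C2_norm_ambient; set s1 := ereal_sup _; set s2 := ereal_sup _; set s3 := ereal_sup _.
move=> le3.
have s1P T : (`|Phi T|%:E <= s1)%E by apply: ereal_sup_ubound; exists T.
have s2P T : ((frob (mxgrad Phi T))%:E <= s2)%E by apply: ereal_sup_ubound; exists T.
have s3P T : ((hess_norm Phi T)%:E <= s3)%E by apply: ereal_sup_ubound; exists T.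
have s10 : (0 <= s1)%E by apply: le_trans (s1P 0); rewrite lee_fin.
have s20 : (0 <= s2)%E by apply: le_trans (s2P 0); rewrite lee_fin frob_ge0.
have s30 : (0 <= s3)%E by apply: le_trans (s3P 0); rewrite lee_fin sqrtr_ge0.
have s123 : [/\ s1 <= (K + 1)%:E, s2 <= (K + 1)%:E & s3 <= (K + 1)%:E]%E.
  split; apply: le_trans le3.
  - by rewrite -addeA leeDl// adde_ge0.
  - by rewrite addeAC leeDr// adde_ge0.
  - by rewrite leeDr// adde_ge0.
case: s123 => h1 h2 h3; exists Phi; last by move=> P gP; rewrite PhiE ?inE.
split => // T; rewrite -lee_fin.
- exact: le_trans (s1P T) h1.
- exact: le_trans (s2P T) h2.
- exact: le_trans (s3P T) h3.
Qed.

Variables (K : R) (Phi : 'M[R]_N -> R).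
Hypothesis PhiK : C2_bound K Phi.

Lemma C2_bound_ge0 : 0 <= K.
Proof. by case: PhiK => _ /(_ 0) h _ _; apply: le_trans h. Qed.

Lemma sgrad_bound T : frob (sgrad Phi T) <= 2 * K.
Proof.
case: PhiK => _ _ /(_ T) h _; apply: le_trans (ler_frobD _ _) _.
by rewrite frob_tr; lra.
Qed.

Lemma C2_bound_lip T S : `|Phi T - Phi S| <= K * frob (T - S).
Proof.
case: PhiK => -[[dP _] _] _ h _; apply: grad_lipschitz => //.
by move=> ?; exact: dP.
Qed.

Lemma mxgrad_lip T S : frob (mxgrad Phi T - mxgrad Phi S) <= (N * N)%:R * K * frob (T - S).
Proof.
case: PhiK => -[_ C2] _ _ h; apply: le_trans (frob_le_norm _) _.
rewrite -mulrA ler_wpM2l//; apply/mx_norm_leP.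
  by rewrite mulr_ge0 ?C2_bound_ge0 ?frob_ge0.
move=> i j; rewrite !mxE.
apply: (@grad_lipschitz _ _ _ (fun P => 'd Phi P (delta_mx i j))) => P.
  by have [dP _] := C2 (delta_mx i j); exact: dP.
apply: le_trans (h P); rewrite -(@ger0_norm _ (frob _)) ?frob_ge0// -sqrtr_sqr.
rewrite /hess_norm ler_sqrt; last by do 2 (apply: sumr_ge0 => ? _); exact: sqr_ge0.
apply: (@ler_sum2 _ _ _ (fun i j =>
  frob (mxgrad (fun S => 'd Phi S (delta_mx i j)) P) ^+ 2)) => ? ?.
exact: sqr_ge0.
Qed.

Lemma sgrad_lip T S : frob (sgrad Phi T - sgrad Phi S) <= 2 * (N * N)%:R * K * frob (T - S).
Proof.
rewrite /sgrad opprD addrACA -linearB /=; apply: le_trans (ler_frobD _ _) _.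
by rewrite frob_tr; have := mxgrad_lip T S; lra.
Qed.

Definition tau : R := 1 + N%:R.

Lemma tau_ge1 : 1 <= tau. Proof. by rewrite /tau lerDl. Qed.

Let tau0 : 0 <= tau. Proof. exact: le_trans ler01 tau_ge1. Qed.

Lemma grass_tau (k : nat) T : (k <= N)%N -> grass k T -> frob T <= tau.
Proof. by move=> kN /grass_frob/le_trans; apply; rewrite lerD2l ler_nat. Qed.

Lemma frobM3 (A B C : 'M[R]_N) (a b c : R) : frob A <= a -> frob B <= b -> frob C <= c ->
  frob (A *m B *m C) <= a * b * c.
Proof.
move=> Aa Bb Cc; apply: le_trans (frobM _ _) _; apply: ler_pM => //; rewrite ?frob_ge0//.
by apply: le_trans (frobM _ _) _; apply: ler_pM => //; rewrite ?frob_ge0.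
Qed.

Section plane_bounds.
Variables (k l : nat).
Hypothesis Nkl : N = (k + l)%N.

Let kN : (k <= N)%N. Proof. by rewrite Nkl leq_addr. Qed.
Let lN : (l <= N)%N. Proof. by rewrite Nkl leq_addl. Qed.

Let perp_tau T : grass k T -> frob (perp T) <= tau.
Proof. by move=> gT; apply: (grass_tau lN); exact: grass_perp Nkl gT. Qed.

Definition cB : R := K * tau + 2 * K * tau ^+ 2.

Lemma cB_ge0 : 0 <= cB.
Proof.
have K0 := C2_bound_ge0; rewrite addr_ge0 ?mulr_ge0//; exact: exprn_ge0.
Qed.

Let frobZ_le (c : R) (A : 'M[R]_N) (a b : R) : `|c| <= a -> frob A <= b -> frob (c *: A) <= a * b.
Proof. by move=> ca Ab; rewrite frobZ ler_pM// frob_ge0. Qed.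

Lemma bform_bound T : grass k T -> frob (bform Phi T) <= cB.
Proof.
move=> gT; apply: le_trans (ler_frobD _ _) _; apply: lerD.
  by apply: frobZ_le; [case: PhiK|exact: grass_tau kN gT].
apply: le_trans (frobM3 (perp_tau gT) (sgrad_bound T) (grass_tau kN gT)) _.
by rewrite le_eqVlt; apply/orP; left; apply/eqP; ring.
Qed.

Lemma bdual_bound T : grass k T -> frob (bdual Phi T) <= cB.
Proof.
move=> gT; apply: le_trans (ler_frobD _ _) _; apply: lerD.
  by apply: frobZ_le; [case: PhiK|exact: perp_tau gT].
rewrite frobN; apply: le_trans (frobM3 (grass_tau kN gT) (sgrad_bound T) (perp_tau gT)) _.
by rewrite le_eqVlt; apply/orP; left; apply/eqP; ring.
Qed.

(** One contribution per term of the telescoping sum in [bform_lip]: [K * tau + K] from the scalar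
    part, [4 * K * tau] from varying either projection, and the term with [tau ^+ 2] from varying
    the gradient. *)
Definition cBL : R := K * tau + K + 4 * K * tau + 2 * (N * N)%:R * K * tau ^+ 2.

Lemma bform_lip T S : grass k T -> grass k S ->
  frob (bform Phi T - bform Phi S) <= cBL * frob (T - S).
Proof.
move=> gT gS; have K0 := C2_bound_ge0.
have -> : bform Phi T - bform Phi S = (Phi T - Phi S) *: T + Phi S *: (T - S) +
    ((perp T - perp S) *m sgrad Phi T *m T + perp S *m (sgrad Phi T - sgrad Phi S) *m T +
     perp S *m sgrad Phi S *m (T - S)).
  rewrite /bform; move: (perp T) (perp S) (sgrad Phi T) (sgrad Phi S) => p q d e.
  rewrite [(p - q) *m _]mulmxBl [(p *m d - _) *m _]mulmxBl [q *m (d - e)]mulmxBr.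
  rewrite [(q *m d - _) *m _]mulmxBl [q *m e *m (T - S)]mulmxBr scalerBl scalerBr.
  move: (_ *: T) (_ *: T) (_ *: S) (p *m d *m T) (q *m d *m T) (q *m e *m T) (q *m e *m S).
  by move=> *; apply/matrixP => i j; rewrite !mxE; ring.
have dp : frob (perp T - perp S) <= frob (T - S).
  by rewrite /perp opprB addrC addrA subrK frob_distC.
set D := frob (T - S); have D0 : 0 <= D by exact: frob_ge0.
have Tt := grass_tau kN gT; have pS := perp_tau gS.
have e1 : frob ((Phi T - Phi S) *: T) <= K * D * tau.
  by apply: frobZ_le => //; exact: C2_bound_lip.
have e2 : frob (Phi S *: (T - S)) <= K * D by apply: frobZ_le => //; case: PhiK.
have e3 := frobM3 dp (sgrad_bound T) Tt.
have e4 := frobM3 pS (sgrad_lip T S) Tt.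
have e5 := frobM3 pS (sgrad_bound S) (lexx D).
apply: le_trans (ler_frobD _ _) _.
apply: le_trans (lerD (ler_frobD _ _) (ler_frobD _ _)) _.
apply: le_trans (lerD (lerD e1 e2) (lerD (ler_frobD _ _) e5)) _.
apply: le_trans (lerD (lexx _) (lerD (lerD e3 e4) (lexx _))) _.
by rewrite -/D /cBL le_eqVlt; apply/orP; left; apply/eqP; ring.
Qed.

End plane_bounds.
End C2_bounds.

(** * Pointwise estimates *)

Section pointwise.
Context {R : realType} {m n : nat}.
Notation N := (m + n)%N.

Lemma frob_col_mx0 (w : 'cV[R]_n) : frob (col_mx (0 : 'cV[R]_m) w) = frob w.
Proof.
rewrite /frob !mxdotE big_split_ord /= big1 ?add0r => [|i _].
  by congr Num.sqrt; apply: eq_bigr => i _; apply: eq_bigr => j _; rewrite !col_mxEd.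
by rewrite big1// => j _; rewrite col_mxEu mxE mul0r.
Qed.

Lemma frob_row_mx_le (p q r : nat) (A : 'M[R]_(p, q)) (B : 'M[R]_(p, r)) :
  frob (row_mx A B) <= frob A + frob B.
Proof.
rewrite -(@ler_pXn2r _ 2) ?nnegrE ?addr_ge0 ?frob_ge0//.
apply: (@le_trans _ _ (frob A ^+ 2 + frob B ^+ 2)); last first.
  by rewrite sqrrD lerD2r lerDl mulrn_wge0// mulr_ge0 ?frob_ge0.
rewrite !frob_sqr !mxdotE -big_split /=; apply: ler_sum => i _.
rewrite big_split_ord /= le_eqVlt; apply/orP; left; apply/eqP.
by congr (_ + _); apply: eq_bigr => j _; rewrite ?row_mxEl ?row_mxEr.
Qed.

Lemma frob1_le (p : nat) : frob (1%:M : 'M[R]_p) <= 1 + p%:R.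
Proof.
apply: grass_frob; split; [exact: trmx1|exact: mulmx1|exact: mxtrace1].
Qed.

(* [J - A] is the image of the graph map of [J] under the operator vanishing on
   the graph of [A]. *)
Lemma slope_diff_le (J A : 'M[R]_(n, m)) :
  frob (J - A) <= (1 + n%:R + frob A) * (1 + m%:R + frob J) * frob (tproj J - tproj A).
Proof.
pose V : 'M[R]_(n, N) := row_mx (- A) 1%:M.
have VJ (B : 'M[R]_(n, m)) : V *m gmx B = B - A.
  by rewrite /V /gmx mul_row_col mulmx1 mul1mx addrC.
have VA : V *m tproj A = 0 by rewrite /tproj !mulmxA VJ subrr !mul0mx.
have -> : J - A = V *m (tproj J - tproj A) *m gmx J.
  by rewrite mulmxBr VA subr0 -mulmxA tproj_gmx VJ.
have hV : frob V <= 1 + n%:R + frob A.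
  apply: le_trans (frob_row_mx_le _ _) _; rewrite frobN addrC lerD2r.
  exact: frob1_le.
have hJ : frob (gmx J) <= 1 + m%:R + frob J.
  rewrite -frob_tr /gmx tr_col_mx trmx1; apply: le_trans (frob_row_mx_le _ _) _.
  by rewrite frob_tr lerD2r; exact: frob1_le.
apply: le_trans (frobM _ _) _; rewrite mulrAC; apply: ler_pM => //; rewrite ?frob_ge0//.
by apply: le_trans (frobM _ _) _; rewrite ler_wpM2r ?frob_ge0.
Qed.

Lemma bdual_graph (Phi : 'M[R]_N -> R) (A : 'M[R]_(n, m)) (x : 'cV[R]_m) (y : 'cV[R]_n) :
  bdual Phi (tproj A) *m col_mx x y = bdual Phi (tproj A) *m col_mx 0 (y - A *m x).
Proof.
have -> : col_mx x y = gmx A *m x + col_mx 0 (y - A *m x).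
  by rewrite /gmx mul_col_mx mul1mx add_col_mx addr0 addrC subrK.
rewrite mulmxDr mulmxA (_ : _ *m gmx A = 0) ?mul0mx ?add0r//.
have p0 : perp (tproj A) *m gmx A = 0 by rewrite /perp mulmxBl mul1mx tproj_gmx subrr.
by rewrite /bdual mulmxBl -scalemxAl p0 scaler0 -[_ *m gmx A]mulmxA p0 mulmx0 subrr.
Qed.

Variables (K C : R) (Phi Psi : 'M[R]_N -> R).
Hypothesis C0 : 0 < C.
Hypothesis PhiK : C2_bound K Phi.
Hypothesis PhiPsi : forall P, grass m P -> Phi P = Psi P.
Hypothesis usacP : usac C Psi.

(** [usac] speaks of distinct planes only; at [T = S] both sides vanish by [bform_bdual]. *)
Lemma usac_bform (T S : 'M[R]_N) : grass m T -> grass m S ->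
  C * frob (T - S) ^+ 2 <= mxdot (bform Phi T) (bdual Phi S).
Proof.
move=> gT gS; have [C2 _ _ _] := PhiK.
have [->|TS] := eqVneq T S.
  by rewrite subrr frob0 expr0n mulr0 /mxdot (bform_bdual _ gS) mxtrace0.
have := usacP gT gS (elimN eqP TS).
by rewrite (anisoBE C2.1 PhiPsi gT) (anisoB_dual (erefl _) C2.1 PhiPsi gS).
Qed.

(* The rank-one part of the test matrix only sees [B(T) - B(S)], which is of the
   order of [T - S]; Young's inequality then absorbs it. *)
Lemma test_matrix_ge (T S : 'M[R]_N) (eta X : R) (W xi : 'cV[R]_N) :
  grass m T -> grass m S -> 0 <= eta -> frob xi <= X ->
  C / 2 * eta ^+ 2 * frob (T - S) ^+ 2 <=
  mxdot (bform Phi T) (eta ^+ 2 *: bdual Phi S + (bdual Phi S *m W) *m (eta *: xi)^T) +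
  (cBL K (N := N) * cB K (N := N) * X) ^+ 2 / (2 * C) * frob W ^+ 2.
Proof.
move=> gT gS eta0 xiX; have h1 := usac_bform gT gS.
set M := bdual Phi S in h1 *; set c := cBL K (N := N) * _ * X.
have BM : mxdot (bform Phi T) (M *m W *m (eta *: xi)^T) =
    eta * mxdot (bform Phi T - bform Phi S) (M *m W *m xi^T).
  have -> : (eta *: xi)^T = eta *: xi^T by rewrite linearZ.
  rewrite -scalemxAr mxdotZr mxdotBl [mxdot (bform Phi S) _](_ : _ = 0) ?subr0//.
  by rewrite /mxdot !mulmxA (bform_bdual _ gS) !mul0mx mxtrace0.
have h2 : - (c * frob (T - S) * frob W) <= mxdot (bform Phi T - bform Phi S) (M *m W *m xi^T).
  have h := mxdot_absCS (bform Phi T - bform Phi S) (M *m W *m xi^T).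
  have X0 : 0 <= X by apply: le_trans xiX; exact: frob_ge0.
  have hl := bform_lip PhiK (erefl _) gT gS.
  have hM : frob (M *m W *m xi^T) <= cB K (N := N) * frob W * X.
    apply: le_trans (frobM _ _) _; rewrite frob_tr; apply: ler_pM; rewrite ?frob_ge0//.
    apply: le_trans (frobM _ _) _; rewrite ler_wpM2r ?frob_ge0//.
    exact: (bdual_bound PhiK (erefl _) gS).
  have := le_trans h (ler_pM (frob_ge0 _) (frob_ge0 _) hl hM).
  rewrite ler_norml => /andP[+ _]; apply: le_trans.
  by rewrite lerN2 /c le_eqVlt; apply/orP; left; apply/eqP; ring.
rewrite mxdotDr mxdotZr BM.
have t0 := frob_ge0 (T - S); move: (frob (T - S)) t0 h1 h2 => t t0 h1 h2.
have w0 := frob_ge0 W; move: (frob W) w0 h2 => w w0 h2.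
have e2 : 0 <= eta ^+ 2 by exact: sqr_ge0.
have g1 := ler_wpM2l e2 h1; have g2 := ler_wpM2l eta0 h2.
have sq := sqr_ge0 (C * eta * t - c * w).
have g3 : C * eta * t * (c * w) <= C ^+ 2 * (eta * t) ^+ 2 / 2 + (c * w) ^+ 2 / 2.
  by move: sq; rewrite sqrrB; lra.
have g4 : eta * t * (c * w) <= C / 2 * (eta * t) ^+ 2 + c ^+ 2 / (2 * C) * w ^+ 2.
  rewrite -(ler_pM2l C0).
  have -> : C * (C / 2 * (eta * t) ^+ 2 + c ^+ 2 / (2 * C) * w ^+ 2) =
    C ^+ 2 * (eta * t) ^+ 2 / 2 + (c * w) ^+ 2 / 2 by field; rewrite gt_eqF.
  by move: g3; lra.
by move: g1 g2 g4; move: (mxdot _ _) (mxdot _ _) => p q; lra.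
Qed.

(** Young's inequality with the weight [r], which gives the two integrals of the final estimate
    their powers of [r]. *)
Lemma forcing_le (S : 'M[R]_N) (eta r : R) (W h : 'cV[R]_N) : grass m S ->
  0 <= eta <= 1 -> 0 < r ->
  `|mxdot h (eta ^+ 2 *: (bdual Phi S *m W))| <=
  cB K (N := N) * (r ^+ 2 * frob h ^+ 2 + frob W ^+ 2 / r ^+ 2).
Proof.
move=> gS /andP[eta0 eta1] r0; rewrite mxdotZr normrM ger0_norm ?sqr_ge0//.
have cB0 := cB_ge0 PhiK.
apply: (@le_trans _ _ (1 * (frob h * (cB K (N := N) * frob W)))).
  apply: ler_pM => //; first exact: sqr_ge0.
    by rewrite expr_le1.
  apply: le_trans (mxdot_absCS _ _) _; rewrite ler_wpM2l ?frob_ge0//.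
  apply: le_trans (frobM _ _) _; rewrite ler_wpM2r ?frob_ge0//.
  exact: (bdual_bound PhiK (erefl _) gS).
rewrite mul1r mulrCA ler_wpM2l//.
have sq := sqr_ge0 (r * frob h - frob W / r).
have rw : r * frob h * (frob W / r) = frob h * frob W by field; rewrite gt_eqF.
move: sq; rewrite sqrrB rw !exprMn exprVn.
by have := mulr_ge0 (frob_ge0 h) (frob_ge0 W); lra.
Qed.

End pointwise.

(** * Test field *)

Section cutoff.
Context {R : realType}.

Lemma is_derive_eps (f : R -> R) (t d : R) :
  (forall e, 0 < e -> exists2 r, 0 < r &
     forall h, `|h| < r -> `|f (t + h) - f t - h * d| <= e * `|h|) ->
  is_derive t 1 f d.
Proof.
move=> H; pose df : {linear R^o -> R^o} := [the {linear R^o -> R^o} of *:%R d].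
have [] // := @diff_intro R R^o R^o f df t.
- by move=> x; exact: scaler_continuous.
- move=> e e0; have [r r0 hr] := H _ e0; exists r => // h hh.
  have -> : df h = h * d by exact: mulrC.
  exact: hr.
move=> df1 df2; apply: DeriveDef; first exact: diff_derivable.
by rewrite deriveE// df2 /= [LHS]mulr1.
Qed.

(** The square of the positive part, the simplest C^1 function that vanishes on a half-line without
    vanishing identically. *)
Definition posq (t : R) : R := Num.max 0 t ^+ 2.

Lemma is_derive_posq (t : R) : is_derive t 1 posq (2 * Num.max 0 t).
Proof.
apply: is_derive_eps => e e0; exists e => // h he.
apply: (@le_trans _ _ (`|h| * `|h|)); last by rewrite ler_wpM2r// ltW.
rewrite -normrM ger0_norm -?expr2 ?sqr_ge0// /posq ler_norml.
by rewrite /Num.max; case: ifPn; case: ifPn; rewrite -?leNgt; nra.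
Qed.

(** A cutoff equal to 1 up to 2 and to 0 from 3 on. [eta] is not C^1 at 3, but its square [zeta] is,
    and [dzeta] still contains a factor [eta], which is what lets the gradient term be absorbed by
    the coercive one. *)
Definition eta (t : R) : R := Num.max 0 (1 - posq (t - 2)).
Definition zeta (t : R) : R := posq (1 - posq (t - 2)).
Definition dzeta (t : R) : R := - (4 * eta t * Num.max 0 (t - 2)).

Lemma zetaE t : zeta t = eta t ^+ 2. Proof. by []. Qed.

Lemma posq_ge0 t : 0 <= posq t. Proof. exact: sqr_ge0. Qed.

Lemma eta_ge0 t : 0 <= eta t. Proof. by rewrite /eta le_max lexx. Qed.

Lemma eta_le1 t : eta t <= 1.
Proof. by rewrite /eta ge_max ler01 gerBl posq_ge0. Qed.

Lemma eta_eq1 t : t <= 2 -> eta t = 1.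
Proof.
move=> t2; rewrite /eta /posq (max_idPl (_ : t - 2 <= 0)) ?subr_le0//.
by rewrite expr0n subr0; apply/max_idPr.
Qed.

Lemma eta_eq0 t : 3 <= t -> eta t = 0.
Proof.
move=> t3; rewrite /eta /posq (max_idPr (_ : 0 <= t - 2)); last by lra.
by apply/max_idPl; nra.
Qed.

Lemma is_derive_shift (t : R) : is_derive t 1 (fun t : R => t - 2) 1.
Proof.
apply: is_derive_eps => e e0; exists 1 => // h _.
by rewrite (_ : _ - h * 1 = 0) ?normr0 ?mulr_ge0 ?(ltW e0)//; ring.
Qed.

Lemma is_derive_inner (t : R) :
  is_derive t 1 (fun t => 1 - posq (t - 2)) (- (2 * Num.max 0 (t - 2))).
Proof.
have d2 := @is_derive1_comp _ posq (fun t : R => t - 2) t _ _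
  (is_derive_posq (t - 2)) (is_derive_shift t).
have d3 : is_derive (posq (t - 2)) 1 (fun t : R => 1 - t) (- 1).
  apply: is_derive_eps => e e0; exists 1 => // h _.
  by rewrite (_ : _ - h * -1 = 0) ?normr0 ?mulr_ge0 ?(ltW e0)//; ring.
have d4 := @is_derive1_comp _ (fun t : R => 1 - t) (posq \o (fun t : R => t - 2)) t _ _ d3 d2.
by apply: is_derive_eq d4 _; ring.
Qed.

Lemma is_derive_zeta (t : R) : is_derive t 1 zeta (dzeta t).
Proof.
have d5 := @is_derive1_comp _ posq (fun t : R => 1 - posq (t - 2)) t _ _
  (is_derive_posq (1 - posq (t - 2))) (is_derive_inner t).
by apply: is_derive_eq d5 _; rewrite /dzeta /eta; ring.
Qed.

Lemma is_derive_continuous (f : R -> R) (t d : R) : is_derive t 1 f d -> {for t, continuous f}.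
Proof. by move=> [/derivable1_diffP/differentiable_continuous]. Qed.

Lemma max0_continuous : continuous (Num.max 0 : R -> R).
Proof.
move=> t; apply: (@continuous_max _ _ (cst 0) id t); first exact: cst_continuous.
exact: cvg_id.
Qed.

Lemma diff_zeta (t h : R) : differentiable zeta t /\ 'd zeta t h = h * dzeta t.
Proof.
have [d1 d2] := is_derive_zeta t.
have d3 : differentiable zeta t by apply/derivable1_diffP.
by split => //; rewrite diff1E// derive1E d2.
Qed.

Lemma zeta_continuous : continuous zeta.
Proof. by move=> t; have [/differentiable_continuous] := diff_zeta t 0. Qed.

Lemma compf_continuous (S T U : topologicalType) (f : S -> T) (g : T -> U) :
  continuous f -> continuous g -> continuous (fun t => g (f t)).
Proof. by move=> fc gc t; apply: continuous_comp; [exact: fc|exact: gc]. Qed.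

Lemma dzeta_continuous : continuous dzeta.
Proof.
have sc : continuous (fun t : R => t - 2).
  by move=> t; exact: is_derive_continuous (is_derive_shift t).
have ec : continuous eta.
  apply: (compf_continuous _ max0_continuous) => t.
  exact: is_derive_continuous (is_derive_inner t).
have mc := compf_continuous sc max0_continuous.
have -> : dzeta = (fun t => (- 4 * eta t) *: (Num.max 0 (t - 2) : R^o)).
  by apply/funext => t; rewrite /dzeta -!mulNr.
move=> t; apply: (@cvgZ _ R^o); last exact: mc.
by apply: (@cvgM R); [exact: cvg_cst|exact: ec].
Qed.

End cutoff.

Section scaled_linear.
Context {R : realType} {V W : normedModType R}.

Lemma continuousZf (f : V -> R) (L : V -> W) : continuous f -> continuous L ->
  continuous (fun z => f z *: L z).
Proof. by move=> fc Lc z; apply: cvgZ; [exact: fc|exact: Lc]. Qed.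

Lemma diff_scaled_linear (f : V -> R) (L : {linear V -> W}) (c : R) (z0 z : V) :
  (forall h, `|L h| <= c * `|h|) -> differentiable f z ->
  differentiable (fun z => f z *: L (z - z0)) z /\
  forall h, 'd (fun z => f z *: L (z - z0)) z h = 'd f z h *: L (z - z0) + f z *: L h.
Proof.
move=> Lc df.
have c0 : 0 <= `|c| by [].
have Lc' h : `|L h| <= `|c| * `|h|.
  by apply: le_trans (Lc h) _; rewrite ler_wpM2r// ler_norm.
pose D (h : V) : W := 'd f z h *: L (z - z0) + f z *: L h.
have Dlin : linear D.
  move=> a x y; rewrite /D.
  have -> : 'd f z (a *: x + y) = a * 'd f z x + 'd f z y by exact: linearP.
  rewrite [L (a *: x + y)]linearP scalerDl !scalerDr -scalerA addrACA.
  by congr (_ + _ + _); rewrite scalerA mulrC -scalerA.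
pose DL : {linear V -> W} := HB.pack D (GRing.isLinear.Build _ _ _ _ _ Dlin).
have Lcont : continuous L.
  by apply: (@lipschitz_continuous _ _ _ _ `|c|) => x y; rewrite -linearB.
have Dcont : continuous DL.
  have k1 : continuous (cst (L (z - z0)) : V -> W) by move=> h; exact: cst_continuous.
  have k2 : continuous (cst (f z) : V -> R) by move=> h; exact: cst_continuous.
  have k3 : continuous ('d f z) by exact: (diff_continuous df).
  have c1 := @continuousZf _ _ k3 k1.
  have c2 := @continuousZf _ _ k2 Lcont.
  by move=> h; exact: (cvgD (c1 h) (c2 h)).
have [] // := @diff_intro R V W (fun z => f z *: L (z - z0)) DL z Dcont.
  move=> e e0.
  pose k := `|L (z - z0)| + `|c| + 1.
  have k0 : 0 < k by rewrite ltr_wpDl// addr_ge0.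
  have [d1 d10 h1] := diff_elim df (divr_gt0 e0 k0).
  have := differentiable_continuous df; move=> /cvgrPdist_lt/(_ _ (divr_gt0 e0 k0)).
  move=> /nbhs_ballP[d2 /= d20 h2].
  exists (Num.min d1 d2); first by rewrite lt_min d10.
  move=> h; rewrite lt_min => /andP[hd1 hd2].
  have g1 := h1 _ hd1.
  have g2 : `|f (z + h) - f z| <= e / k.
    rewrite distrC ltW//; apply: h2; rewrite -ball_normE /= opprD addrA subrr add0r.
    by rewrite normrN.
  have -> : f (z + h) *: L (z + h - z0) - f z *: L (z - z0) - DL h =
      (f (z + h) - f z - 'd f z h) *: L (z - z0) + (f (z + h) - f z) *: L h.
    rewrite [z + h - z0]addrAC linearD /= /D.
    move: (L (z - z0)) (L h) (f (z + h)) (f z) ('d f z h) => p q a b x.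
    by rewrite scalerDr !scalerBl opprD (addrAC (a *: p)) addrA (addrAC (a *: p - b *: p)) -addrA.
  apply: le_trans (ler_normD _ _) _; rewrite !normrZ.
  apply: (@le_trans _ _ (e / k * `|h| * `|L (z - z0)| + e / k * (`|c| * `|h|))).
    by apply: lerD; [rewrite ler_wpM2r|apply: ler_pM].
  rewrite -[X in _ <= X * _](@divfK _ k) ?gt_eqF// [e / k * k * _]mulrAC.
  rewrite (_ : _ + _ = e / k * `|h| * (`|L (z - z0)| + `|c|)); last by ring.
  apply: ler_wpM2l; last by rewrite /k lerDl.
  by apply: mulr_ge0 => //; exact: ltW (divr_gt0 e0 k0).
move=> d1 d2; split; first exact: d1.
by move=> h; exact: (congr1 (fun F : V -> W => F h) d2).
Qed.

End scaled_linear.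

Section test_field.
Context {R : realType} {N : nat}.
Variables (P M : 'M[R]_N) (z0 : 'cV[R]_N).
Implicit Types z h : 'cV[R]_N.

Definition quad z : R := frob (P *m (z - z0)) ^+ 2.

Lemma diff_quad z : differentiable quad z /\
  forall h, 'd quad z h = 2 * mxdot (P *m (z - z0)) (P *m h).
Proof.
pose D h : R^o := 2 * mxdot (P *m (z - z0)) (P *m h).
have Dlin : linear D.
  by move=> a x y; rewrite /D [P *m (_ *: x + y)]mulmxDr -scalemxAr mxdotDr mxdotZr mulrDr mulrCA.
pose DL : {linear 'cV[R]_N -> R^o} := HB.pack D (GRing.isLinear.Build _ _ _ _ _ Dlin).
have quadD h : quad (z + h) - quad z - D h = frob (P *m h) ^+ 2.
  rewrite /quad /D [z + h - z0]addrAC mulmxDr !frob_sqr mxdotDl !mxdotDr.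
  by rewrite [mxdot (P *m h) (P *m (z - z0))]mxdotC; ring.
pose c := 2 * (frob (P *m (z - z0)) * (frob P * (N * 1)%:R)).
have c0 : 0 <= c by rewrite !mulr_ge0 ?frob_ge0.
have PhE h : frob (P *m h) <= frob P * (N * 1)%:R * `|h|.
  apply: le_trans (frobM _ _) _; rewrite -mulrA ler_wpM2l ?frob_ge0//.
  exact: frob_le_norm.
have Dcont : continuous DL.
  apply: (@lipschitz_continuous _ _ _ _ c) => x y; rewrite -linearB /=.
  rewrite /D normrM gtr0_norm// /c -!mulrA ler_pM2l//.
  apply: le_trans (mxdot_absCS _ _) _; rewrite ler_wpM2l ?frob_ge0//.
  by apply: le_trans (PhE _) _; rewrite !mulrA.
have [] // := @diff_intro R 'cV[R]_N R^o quad DL z Dcont.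
  move=> e e0; pose k := frob P * (N * 1)%:R.
  have k0 : 0 <= k by rewrite mulr_ge0 ?frob_ge0.
  have k1 : 0 < k ^+ 2 + 1 by rewrite ltr_wpDl ?sqr_ge0.
  exists (e / (k ^+ 2 + 1)); first exact: divr_gt0.
  move=> h; rewrite ltr_pdivlMr// => hh; rewrite quadD ger0_norm ?sqr_ge0//.
  apply: (@le_trans _ _ ((k * `|h|) ^+ 2)).
    by apply: lerXn2r; [rewrite nnegrE frob_ge0|rewrite nnegrE mulr_ge0|exact: PhE].
  rewrite exprMn [`|h| ^+ 2]expr2 mulrA ler_wpM2r//.
  by rewrite mulrC; apply: le_trans (ltW hh); rewrite ler_wpM2l// lerDl.
move=> d1 d2; split; first exact: d1.
by move=> h; exact: (congr1 (fun F : 'cV[R]_N -> R^o => F h) d2).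
Qed.

Lemma quad_continuous : continuous quad.
Proof. by move=> z; have [/differentiable_continuous] := diff_quad z. Qed.

Definition test_field z : 'cV[R]_N := zeta (quad z) *: (M *m (z - z0)).

Let diff_cut z : differentiable (zeta \o quad) z /\
  forall h, 'd (zeta \o quad) z h = dzeta (quad z) * (2 * mxdot (P *m (z - z0)) (P *m h)).
Proof.
have [dq qE] := diff_quad z.
have dz c := diff_zeta (quad z) c.
split; first exact: (differentiable_comp dq (dz 0).1).
move=> h; rewrite (diff_comp dq (dz 0).1) /= (dz _).2 mulrC; congr (_ * _).
exact: qE.
Qed.

Lemma diff_test_field z : differentiable test_field z /\
  forall h, 'd test_field z h =
    (dzeta (quad z) * (2 * mxdot (P *m (z - z0)) (P *m h))) *: (M *m (z - z0)) +
    zeta (quad z) *: (M *m h).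
Proof.
have [d1 d1E] := diff_cut z.
have lM h : `|mulmx M h| <= N%:R * `|M| * `|h| by exact: norm_mulmx_le.
have [d2 d2E] := @diff_scaled_linear R 'cV[R]_N 'cV[R]_N (zeta \o quad)
  [the {linear 'cV[R]_N -> 'cV[R]_N} of mulmx M] _ z0 z lM d1.
by split; [exact: d2|move=> h; rewrite -d1E; exact: d2E].
Qed.

Lemma test_field_C1 : C1_on setT test_field.
Proof.
split => [z _|h z _]; first by have [] := diff_test_field z.
have -> : (fun y => 'd test_field y h) =
    (fun z => (dzeta (quad z) * (2 * mxdot (P *m (z - z0)) (P *m h))) *: (M *m (z - z0)) +
    zeta (quad z) *: (M *m h)).
  by apply/funext => y; exact: (diff_test_field y).2.
have sc : continuous (fun z : 'cV[R]_N => z - z0).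
  apply: (@continuousBf _ _ _ id (cst z0)) => w; [exact: cvg_id|exact: cst_continuous].
have Mc : continuous (fun z : 'cV[R]_N => M *m (z - z0)).
  exact: compf_continuous sc (@mulmx_continuous _ _ _ _ M).
have Pc : continuous (fun z : 'cV[R]_N => P *m (z - z0)).
  exact: compf_continuous sc (@mulmx_continuous _ _ _ _ P).
have dc : continuous (fun z : 'cV[R]_N => 2 * mxdot (P *m (z - z0)) (P *m h)).
  apply: (@lipschitz_continuous _ _ _ _ (2 * ((N * 1)%:R * (N%:R * `|P|) * frob (P *m h)))) => x y.
  rewrite -mulrBr -mxdotBl -mulmxBr opprB addrA subrK normrM gtr0_norm// -!mulrA ler_pM2l//.
  apply: le_trans (mxdot_absCS _ _) _.
  rewrite [leRHS](_ : _ = (N * 1)%:R * (N%:R * `|P| * `|x - y|) * frob (P *m h)); last by ring.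
  rewrite ler_wpM2r ?frob_ge0//; apply: le_trans (frob_le_norm _) _.
  by rewrite ler_wpM2l//; exact: norm_mulmx_le.
have zc := compf_continuous quad_continuous zeta_continuous.
have dzc := compf_continuous quad_continuous dzeta_continuous.
have c1 := @continuousZf _ _ _ _ _ (@continuousZf _ _ (R^o) _ _ dzc dc) Mc.
have cM : continuous (cst (M *m h) : 'cV[R]_N -> 'cV[R]_N).
  by move=> y; exact: cst_continuous.
have c2 := @continuousZf _ _ _ _ _ zc cM.
exact: (cvgD (c1 z) (c2 z)).
Qed.

(** [eta] times this vector is the gradient of the cutoff [zeta \o quad]: the coefficient 8 combines
    the 4 of [dzeta] with the 2 from differentiating [quad]. *)
Definition test_slope z : 'cV[R]_N :=
  (- (8 * Num.max 0 (quad z - 2))) *: (P^T *m (P *m (z - z0))).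

Lemma jac_test_field z : jac test_field z =
  eta (quad z) ^+ 2 *: M + (M *m (z - z0)) *m (eta (quad z) *: test_slope z)^T.
Proof.
have dotE (u : 'cV[R]_N) j : mxdot u (delta_mx j 0) = u j 0.
  rewrite mxdotE (eq_bigr (fun i => u i 0 * (i == j)%:R)) => [|i _]; last first.
    by rewrite big_ord_recl big_ord0 addr0 mxE eqxx andbT.
  rewrite (bigD1 j)//= eqxx mulr1 big1 ?addr0// => i ij.
  by rewrite (negbTE ij) mulr0.
apply/matrixP => i j; rewrite mxE (diff_test_field z).2 mxdot_mulr dotE.
rewrite -colE zetaE mulmxA; move: (M *m (z - z0)) => u.
rewrite /test_slope mulmxA; move: (P^T *m P *m (z - z0)) => w.
rewrite !mxE big_ord_recl big_ord0 addr0 addrC !mxE; congr (_ + _).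
by rewrite /dzeta; ring.
Qed.

Lemma test_field_eq0 z : 3 <= quad z -> test_field z = 0.
Proof. by move=> q3; rewrite /test_field zetaE eta_eq0// expr0n scale0r. Qed.

Lemma test_field_supp (U : set 'cV[R]_N) : bounded_set [set z | quad z <= 3] ->
  [set z | quad z <= 3] `<=` U -> compact_supp U test_field.
Proof.
move=> bK KU; set K := [set z | quad z <= 3] in bK KU.
have clK : closed K.
  have -> : K = [set z | `|quad z| <= 3].
    by apply/seteqP; split => z /=; rewrite ger0_norm ?sqr_ge0.
  by apply: closed_norm_le; exact: quad_continuous.
have sub : closure [set z | test_field z != 0] `<=` K.
  rewrite [X in _ `<=` X](iffLR (closure_id _) clK); apply: closure_subset => z /= nz.
  by rewrite /K /= leNgt; apply/negP => h; move: nz; rewrite test_field_eq0 ?eqxx// ltW.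
split; last exact: subset_trans KU.
apply: (subclosed_compact (@closed_closure _ _) _ sub).
exact: cV_bounded_closed_compact.
Qed.

End test_field.

(** * Integration on the graph *)

Section graph_measurability.
Context {R : realType} {m n : nat}.
Hypothesis m0 : (0 < m)%N.
Notation leb := (@lebesgue_outer R m).
Notation LL := (lebesgue_mx R m).
Notation H := (@hausdorff_outer R m (m + n)).
Notation HH := (hausdorff R m (m + n)).
Variables (v : 'cV[R]_m -> 'cV[R]_n) (L : R).
Hypothesis L0 : 0 <= L.
Hypothesis vL : forall x y, `|v x - v y| <= L * `|x - y|.

(** A bounded measurable set is a countable union of compact sets up to a null set. The graph map
    sends compact sets to closed ones and, being Lipschitz, null sets to null sets. *)
Lemma gr_image_measurable (E : set 'cV[R]_m) :
  leb.-caratheodory E -> H.-caratheodory (gr v @` E).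
Proof.
move=> mE; pose Q (j : nat) : set 'cV[R]_m := [set x | `|x| <= j%:R].
have cQ j : closed (Q j) by apply: (@closed_norm_le _ _ _ id) => x; exact: cvg_id.
have -> : gr v @` E = \bigcup_j gr v @` (E `&` Q j).
  apply/seteqP; split => [_ [x Ex <-]|_ [j _ [x [Ex _] <-]]]; last by exists x.
  exists (Num.truncn `|x|).+1 => //; exists x => //; split => //.
  exact/ltW/truncnS_gt.
apply: caratheodory_measurable_bigcup => j.
set F := E `&` Q j.
have mF : leb.-caratheodory F.
  by apply: caratheodory_measurable_setI => //; exact: leb_closed_measurable.
have bF : bounded_set F by apply/bounded_setP; exists j%:R => x [_].
have Ffin : leb F \is a fin_num by rewrite ge0_fin_numE ?leb_ge0// leb_bounded.
have null_image (Z : set 'cV[R]_m) : leb Z = 0%E -> H.-caratheodory (gr v @` Z).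
  move=> Z0; apply: null_caratheodory; apply/eqP; rewrite eq_le outer_measure_ge0 andbT.
  by apply: le_trans (hausdorff_gr_le m0 L0 vL Z) _; rewrite Z0 mule0.
have [F0|F0] := eqVneq (leb F) 0%E; first exact: null_image.
have Fpos : 0 < fine (leb F).
  by rewrite fine_gt0// -ge0_fin_numE ?leb_ge0// Ffin andbT lt_neqAle eq_sym F0 leb_ge0.
have Kex (i : nat) : exists K, [/\ compact K, K `<=` F &
    ((fine (leb F) - i.+1%:R^-1)%:E < leb K)%E].
  apply: leb_inner_regular => //.
  by rewrite -[X in (_ < X)%E](fineK Ffin) lte_fin ltrBlDr ltrDl.
pose K i := projT1 (cid (Kex i)).
have KP i : [/\ compact (K i), K i `<=` F &
    ((fine (leb F) - i.+1%:R^-1)%:E < leb (K i))%E] by rewrite /K; case: cid.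
have cK i : closed (K i).
  by have [cKi _ _] := KP i; apply: compact_closed => //; exact: norm_hausdorff.
have -> : gr v @` F = (\bigcup_i gr v @` K i) `|` gr v @` (F `\` \bigcup_i K i).
  apply/seteqP; split => [_ [x Fx <-]|y].
    have [[i _ Kx]|nK] := pselect ((\bigcup_i K i) x); first by left; exists i => //; exists x.
    by right; exists x.
  case=> [[i _ [x Kx <-]]|[x [Fx _] <-]]; last by exists x.
  by exists x => //; have [_ + _] := KP i; apply.
apply: caratheodory_measurable_setU.
  by apply: caratheodory_measurable_bigcup => i; exact: (gr_image_closed_measurable m0 L0 vL).
apply: null_image; apply/eqP; rewrite eq_le leb_ge0 andbT.
apply/lee_addgt0Pr => e e0; rewrite add0e.
pose i := (Num.truncn e^-1); have ie : i.+1%:R^-1 < e.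
  by rewrite -[e]invrK ltf_pV2 ?posrE ?invr_gt0// truncnS_gt.
have [_ KF FK] := KP i.
apply: (@le_trans _ _ (leb (F `\` K i))).
  by apply: le_outer_measure => x [Fx nK]; split => // Kx; apply: nK; exists i.
have mK : leb.-caratheodory (K i) by exact: leb_closed_measurable.
have E1 := mK F; rewrite -/(setD F (K i)) (setIidr KF) in E1.
have Kfin : leb (K i) \is a fin_num.
  rewrite ge0_fin_numE ?leb_ge0//; apply: le_lt_trans (le_outer_measure _ _ _ KF) _.
  by rewrite -ge0_fin_numE ?leb_ge0.
have Dfin : leb (F `\` K i) \is a fin_num.
  rewrite ge0_fin_numE ?leb_ge0//.
  apply: le_lt_trans (_ : leb (F `\` K i) <= leb F)%E _.
    by apply: le_outer_measure => x [].
  by rewrite -ge0_fin_numE ?leb_ge0.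
move: E1 FK; rewrite -[in X in X -> _](fineK Ffin) -[in X in X -> _](fineK Kfin).
rewrite -[in X in X -> _](fineK Dfin) -EFinD -[X in (_ < X)%E](fineK Kfin) lte_fin => -[].
by rewrite -[X in (X <= _)%E](fineK Dfin) lee_fin; move: ie; move: (fine _) (fine _) (fine _) (i.+1%:R^-1) => ? ? ? ?; lra.
Qed.

Variable X : set 'cV[R]_m.
Hypothesis mX : leb.-caratheodory X.

Let graph_preimage (a : 'cV[R]_m -> R) (B : set R) :
  (gr v @` X) `&` (a \o usubmx) @^-1` B = gr v @` (X `&` a @^-1` B).
Proof.
apply/seteqP; split => [_ [[x Xx <-]] /=|_ [x [Xx Bx] <-]].
  by rewrite usub_gr => Bx; exists x.
by split; [exists x|rewrite /= usub_gr].
Qed.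

Lemma usub_measurable (a : 'cV[R]_m -> R) :
  measurable_fun (X : set (caratheodory_type leb)) (a : caratheodory_type leb -> R) ->
  measurable_fun (gr v @` X : set (caratheodory_type H)) (a \o usubmx).
Proof.
move=> ma _ B mB; rewrite graph_preimage; apply: gr_image_measurable.
exact: ma.
Qed.

Lemma graph_integral_le (a : 'cV[R]_m -> R) :
  measurable_fun (X : set (caratheodory_type leb)) (a : caratheodory_type leb -> R) ->
  (forall x, X x -> 0 <= a x) ->
  (\int[HH]_(z in gr v @` X) (a (usubmx z))%:E <=
   (@cHL R m n L)%:E * \int[LL]_(x in X) (a x)%:E)%E.
Proof.
move=> ma a0; apply: (@ge0_le_integral_distribution _ _ _ _ _ LL HH X (gr v @` X) a (a \o usubmx)) => //.
- exact/ltW/cHL_gt0.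
- exact: gr_image_measurable.
- exact: usub_measurable.
- by move=> _ [x Xx <-] /=; rewrite usub_gr; exact: a0.
- by move=> B mB; rewrite graph_preimage; exact: hausdorff_gr_le.
Qed.

Lemma integral_graph_le (a : 'cV[R]_m -> R) :
  measurable_fun (X : set (caratheodory_type leb)) (a : caratheodory_type leb -> R) ->
  (forall x, X x -> 0 <= a x) ->
  (\int[LL]_(x in X) (a x)%:E <=
   (@cLH R m)%:E * \int[HH]_(z in gr v @` X) (a (usubmx z))%:E)%E.
Proof.
move=> ma a0; apply: (@ge0_le_integral_distribution _ _ _ _ _ HH LL (gr v @` X) X (a \o usubmx) a) => //.
- exact/ltW/cLH_gt0.
- exact: gr_image_measurable.
- exact: usub_measurable.
- by move=> _ [x Xx <-] /=; rewrite usub_gr; exact: a0.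
- by move=> B mB; rewrite graph_preimage; exact: leb_le_hausdorff_gr.
Qed.

Lemma graph_pullback_measurable (h : 'cV[R]_(m + n) -> R) :
  measurable_fun (gr v @` X : set (caratheodory_type H)) (h : caratheodory_type H -> R) ->
  measurable_fun (X : set (caratheodory_type leb)) (h \o gr v : caratheodory_type leb -> R).
Proof.
move=> mh _ B mB.
have -> : X `&` (h \o gr v) @^-1` B = gr v @^-1` ((gr v @` X) `&` h @^-1` B).
  apply/seteqP; split => x /=; first by move=> [Xx hx]; split => //; exists x.
  by move=> [[y Xy /(congr1 usubmx)]]; rewrite !usub_gr => <- hx.
apply: (gr_preimage_measurable m0 L0 vL); apply: mh => //.
exact: gr_image_measurable.
Qed.

End graph_measurability.

(** * Lower integrals *)

Section lower_integral.
Local Open Scope ereal_scope.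
Context d (T : measurableType d) (R : realType) (mu : {measure set T -> \bar R}).
Import HBNNSimple.

(* The integral of a nonnegative function that need not be measurable is its
   lower integral, which is monotone. *)
Lemma ge0_le_lower_integral (D : set T) (f g : T -> \bar R) :
  (forall x, D x -> 0 <= f x) -> (forall x, D x -> f x <= g x) ->
  \int[mu]_(x in D) f x <= \int[mu]_(x in D) g x.
Proof.
move=> f0 fg; have g0 x : D x -> 0 <= g x by move=> Dx; exact: le_trans (f0 x Dx) (fg x Dx).
rewrite !ge0_integralE//; apply: ereal_sup_le => _ [h hf <-].
exists h => // x; apply: le_trans (hf x) _; rewrite !patchE.
by case: ifPn => // /set_mem; exact: fg.
Qed.

Lemma le_lower_integral (D : set T) (f g : T -> \bar R) :
  (forall x, D x -> f x <= g x) -> \int[mu]_(x in D) f x <= \int[mu]_(x in D) g x.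
Proof.
move=> fg; rewrite integralE [leRHS]integralE; apply: leeB.
  apply: ge0_le_lower_integral => x Dx; first exact: funepos_ge0.
  by rewrite !funeposE ge_max !le_max lexx orbT (fg x Dx).
apply: ge0_le_lower_integral => x Dx; first exact: funeneg_ge0.
by rewrite !funenegE ge_max !le_max lexx orbT leeN2 (fg x Dx).
Qed.

(** An integral that is a supremum over simple minorants can be estimated one minorant at a time,
    and a null set removed from each. In the sequel [f] is the squared slope deviation and [h] a
    measurable substitute for it. *)
Lemma lower_integral_sup (D Z : set T) (f : T -> R) (M : \bar R) :
  measurable D -> measurable Z -> mu Z = 0 -> (forall x, 0 <= f x)%R ->
  (forall h : T -> R, measurable_fun setT h -> (forall x, 0 <= h x)%R ->
     (forall x, (D `\` Z) x -> h x <= f x)%R ->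
     \int[mu]_(x in D `\` Z) (h x)%:E <= M) ->
  \int[mu]_(x in D) (f x)%:E <= M.
Proof.
move=> mD mZ Z0 f0 H; rewrite ge0_integralE; last by move=> x _; rewrite lee_fin.
apply: ge_ereal_sup => _ [h hf <-].
have mh : measurable_fun setT h by [].
have mhE (Y : set T) : measurable_fun Y (fun x => (h x)%:E).
  by apply/measurable_EFinP; exact: measurable_funTS.
have h0 x : (0 <= h x)%R by exact: fun_ge0.
have hD x : ~ D x -> h x = 0%R.
  move=> nD; have := hf x; rewrite patchE memNset// lee_fin => hx.
  by apply/eqP; rewrite eq_le hx h0.
rewrite -integralT_nnsfun.
have -> : \int[mu]_x (h x)%:E = \int[mu]_(x in D) (h x)%:E.
  rewrite [RHS]integral_mkcond; apply: eq_integral => x _; rewrite patchE.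
  by case: ifPn => // /negP nD; rewrite hD// => Dx; apply: nD; exact: mem_set.
rewrite (@ge0_negligible_integral _ _ _ mu D Z)//; last by move=> x _; rewrite lee_fin.
apply: H => // x [Dx _].
by have := hf x; rewrite patchE mem_set// lee_fin.
Qed.

(** [b] is the first variation integrand, coercive up to the error [e], and [c] the forcing,
    dominated by [e']. As [b] may fail to be measurable, its integral is not split; it is only
    compared with those of measurable functions on either side. *)
Lemma weak_balance (G : set T) (s e e' b c k : T -> R) : measurable G ->
  measurable_fun G s -> measurable_fun G e -> measurable_fun G e' ->
  measurable_fun G c -> measurable_fun G k ->
  (forall x, G x -> 0 <= s x)%R -> (forall x, G x -> 0 <= e x)%R ->
  (forall x, G x -> `|c x| <= e' x)%R ->
  (forall x, G x -> s x <= b x + e x)%R -> (forall x, G x -> b x <= k x)%R ->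
  (forall x, G x -> 0 <= k x)%R ->
  \int[mu]_(x in G) (s x)%:E < +oo -> \int[mu]_(x in G) (e x)%:E < +oo ->
  \int[mu]_(x in G) (e' x)%:E < +oo -> \int[mu]_(x in G) (k x)%:E < +oo ->
  (\int[mu]_(x in G) b x = - \int[mu]_(x in G) c x)%R ->
  \int[mu]_(x in G) (s x)%:E <= \int[mu]_(x in G) (e x)%:E + \int[mu]_(x in G) (e' x)%:E.
Proof.
move=> mG ms me me' mc mk s0 e0 ce' sbe bk k0 fs fe fe' fk bc.
have E (f : T -> R) : measurable_fun G f -> (forall x, G x -> 0 <= f x)%R ->
    \int[mu]_(x in G) (f x)%:E < +oo -> mu.-integrable G (EFin \o f).
  move=> mf f0 ff; apply/integrableP; split; first exact/measurable_EFinP.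
  rewrite (eq_integral (fun x => (f x)%:E))// => x /set_mem Gx.
  by rewrite /= ger0_norm// f0.
have e'0 x : G x -> (0 <= e' x)%R by move=> Gx; apply: le_trans (ce' x Gx).
have is_ := E _ ms s0 fs; have ie := E _ me e0 fe; have ie' := E _ me' e'0 fe'.
have ik := E _ mk k0 fk.
have le1 : \int[mu]_(x in G) ((EFin \o s) \- (EFin \o e)) x <= \int[mu]_(x in G) (b x)%:E.
  by apply: le_lower_integral => x Gx /=; rewrite -EFinB lee_fin lerBlDr sbe.
have le2 : \int[mu]_(x in G) (b x)%:E <= \int[mu]_(x in G) (EFin \o k) x.
  by apply: le_lower_integral => x Gx /=; rewrite lee_fin bk.
have fse := integrable_fin_num mG (integrableB mG is_ ie).
have fkk := integrable_fin_num mG ik.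
(* The integral of [b] lies between those of [s - e] and of [k], both finite. This is needed because
   a real-valued integral equation says nothing about infinite integrals. *)
have fb : \int[mu]_(x in G) (b x)%:E \is a fin_num.
  rewrite fin_numE; apply/andP; split; apply/eqP => h; move: le1 le2; rewrite h.
    by rewrite leeNy_eq => /eqP h'; move: fse; rewrite h'.
  by rewrite leye_eq => _ /eqP h'; move: fkk; rewrite h'.
move: le1; rewrite integralB// -(fineK fb) -[fine _]/(\int[mu]_(x in G) b x)%R bc.
have cabs : (`|\int[mu]_(x in G) c x|%R)%:E <= \int[mu]_(x in G) (e' x)%:E.
  have ic : mu.-integrable G (EFin \o c).
    apply: le_integrable ie' => //; first exact/measurable_EFinP.
    by move=> x Gx /=; rewrite lee_fin (ger0_norm (e'0 x Gx)) ce'.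
  apply: (@le_trans _ _ (\int[mu]_(x in G) `|(c x)%:E|)).
    have fc := integrable_fin_num mG ic.
    rewrite /Rintegral -abse_EFin fineK//; apply: le_abse_integral => //.
    exact/measurable_EFinP.
  by apply: ge0_le_lower_integral => x Gx //=; rewrite lee_fin ce'.
rewrite leeBlDr; last exact: integrable_fin_num.
move=> /le_trans; apply; rewrite [leRHS]addeC; apply: leeD => //; apply: le_trans cabs.
by rewrite lee_fin; apply: le_trans (ler_norm _) _; rewrite normrN.
Qed.

End lower_integral.

(** * Euclidean balls *)

Section euclidean_balls.
Context {R : realType} {m : nat}.
Hypothesis m0 : (0 < m)%N.
Notation leb := (@lebesgue_outer R m).
Implicit Types x : 'cV[R]_m.

Lemma eball_open x (r : R) : open (eball x r).
Proof.
have c : continuous (fun y : 'cV[R]_m => r - frob (y - x)).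
  apply: (@lipschitz_continuous _ _ _ _ (m * 1)%:R) => y z.
  rewrite (_ : _ - _ = frob (z - x) - frob (y - x)); last by ring.
  by apply: le_trans (frob_lipschitz _ _) _; rewrite opprB addrA subrK distrC.
have -> : eball x r = (fun y : 'cV[R]_m => r - frob (y - x)) @^-1` [set t | 0 < t].
  by apply/seteqP; split => y; rewrite /eball /= subr_gt0.
by apply: open_comp => [y _|]; [exact: c|exact: open_gt].
Qed.

Lemma leb_eball_fin x (r : R) : 0 < r -> leb (eball x r) \is a fin_num.
Proof.
move=> r0; rewrite ge0_fin_numE ?leb_ge0// leb_bounded//; apply/bounded_setP.
exists (r + `|x|) => y /ltW yr; rewrite -(subrK x y); apply: le_trans (ler_normD _ _) _.
by rewrite lerD2r; apply: le_trans (norm_le_frob _) yr.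
Qed.

Lemma leb_eball_gt0 x (r : R) : 0 < r -> 0 < fine (leb (eball x r)).
Proof.
move=> r0; pose s := r / (m%:R + 1).
have m1 : 0 < m%:R + 1 :> R by rewrite ltr_wpDl.
have s0 : 0 < s by rewrite divr_gt0.
have h : ((s ^+ m)%:E <= leb (eball x r))%E.
  apply: le_trans (leb_cube_ge m0 x s0) _; apply: le_outer_measure => y hy.
  rewrite /eball /=; apply: le_lt_trans (frob_le_norm _) _.
  apply: (@le_lt_trans _ _ (m%:R * s)).
    rewrite muln1 ler_wpM2l//; apply/mx_norm_leP; first exact: ltW.
    move=> i j; rewrite !ord1; have := hy i; rewrite !mxE => /andP[h1 h2].
    by rewrite ger0_norm ?subr_ge0//; lra.
  by rewrite /s mulrA ltr_pdivrMr// mulrC ltr_pM2l// ltrDl.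
rewrite -lte_fin fineK ?leb_eball_fin//; apply: lt_le_trans h.
by rewrite lte_fin exprn_gt0.
Qed.

Lemma leb_eball_scale x (k r : R) : 0 < k -> 0 < r ->
  fine (leb (eball x (k * r))) <= k ^+ m * fine (leb (eball x r)).
Proof.
move=> k0 r0; have kr0 : 0 < k * r by rewrite mulr_gt0.
apply/ler_addgt0Pr => e e0.
have km0 : 0 < k ^+ m by rewrite exprn_gt0.
have ki0 : 0 < k^-1 by rewrite invr_gt0.
have lt_M : (leb (eball x r) < (fine (leb (eball x r)) + e / k ^+ m)%:E)%E.
  by rewrite -[X in (X < _)%E]fineK ?leb_eball_fin// lte_fin ltrDl divr_gt0.
have := leb_affine_preimage m0 (x - k^-1 *: x) ki0 lt_M.
rewrite (_ : [set y | _] = eball x (k * r)); last first.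
  have E y : x - k^-1 *: x + k^-1 *: y - x = k^-1 *: (y - x).
    by rewrite scalerBr addrC !addrA addNr add0r addrC.
  by apply/seteqP; split => y; rewrite /eball /= E frobZ gtr0_norm// [k^-1 * _]mulrC ltr_pdivrMr// [r * k]mulrC.
rewrite -[X in (X <= _)%E -> _]fineK ?leb_eball_fin// lee_fin => /le_trans; apply.
by rewrite exprVn invrK mulrDl divfK ?gt_eqF// mulrC.
Qed.

End euclidean_balls.

(** * Lipschitz constant and gradient bound *)

Section statement_data.
Context {R : realType} {m n : nat}.
Hypothesis m0 : (0 < m)%N.

(** [L + 1] exceeds the infimum, hence some admissible constant lies below it; the factor [m]
    converts the Frobenius norm on the right to the maximum norm. *)
Lemma lip_const_le (X : set 'cV[R]_m) (u : 'cV[R]_m -> 'cV[R]_n) (L : R) :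
  lip_const X u = L%:E -> 0 <= L /\ forall x y, X x -> X y ->
    `|u x - u y| <= (L + 1) * m%:R * `|x - y|.
Proof.
move=> uL; split.
  rewrite -lee_fin -uL; apply: le_ereal_inf_tmp => _ [l [l0 _] <-].
  by rewrite lee_fin.
have : (lip_const X u < (L + 1)%:E)%E by rewrite uL lte_fin ltrDl.
move=> /ereal_inf_lt[_ [l [l0 hl] <-]]; rewrite lte_fin => /ltW lL x y Xx Xy.
apply: le_trans (norm_le_frob _) _; apply: le_trans (hl x y Xx Xy) _.
apply: (@le_trans _ _ ((L + 1) * frob (x - y))); first by rewrite ler_wpM2r ?frob_ge0.
rewrite -mulrA ler_wpM2l ?(le_trans l0)//.
by apply: le_trans (frob_le_norm _) _; rewrite muln1.
Qed.

Lemma jac_bound (v : 'cV[R]_m -> 'cV[R]_n) (l : R) x J : 0 <= l ->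
  (forall x y, `|v x - v y| <= l * `|x - y|) -> diff_at v x J ->
  frob J <= (n * m)%:R * l.
Proof.
move=> l0 vl dJ; apply: le_trans (frob_le_norm _) _.
by rewrite ler_wpM2l//; exact: diff_at_bound dJ.
Qed.

Lemma ess_sup_grad_le (Omega : set 'cV[R]_m) (u v : 'cV[R]_m -> 'cV[R]_n) (l : R) :
  open Omega -> (forall x, Omega x -> u x = v x) -> 0 <= l ->
  (forall x y, `|v x - v y| <= l * `|x - y|) ->
  (ess_sup_grad Omega u <= ((n * m)%:R * l)%:E)%E.
Proof.
move=> oO uv l0 vl; apply/ess_supP.
exists (~` lip_good v); split.
- by apply: null_caratheodory; exact: (lip_good_ae m0 vl).
- exact: (lip_good_ae m0 vl).
- move=> x /= nle gx; apply: nle; rewrite patchE; case: ifPn => [/set_mem Ox|_].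
    have [J dJ] := lip_good_diff m0 vl gx.
    have [_ ->] := diff_at_jac (diff_at_local oO Ox uv dJ).
    by rewrite lee_fin; exact: jac_bound dJ.
  by rewrite lee_fin mulr_ge0.
Qed.

End statement_data.

(** * Cylindrical cutoff *)

Section cylinder.
Context {R : realType} {m n : nat}.
Notation N := (m + n)%N.
Variables (x0 : 'cV[R]_m) (y0 : 'cV[R]_n) (r e : R).
Hypotheses (r0 : 0 < r) (e0 : 0 < e).

(** Horizontal lengths are measured in units of [r] and vertical ones in units of [e^-1], the two
    scales being chosen independently. *)
Definition cylmx : 'M[R]_N := block_mx (r^-1)%:M 0 0 e%:M.

Lemma cylmx_col (x : 'cV[R]_m) (y : 'cV[R]_n) :
  cylmx *m (col_mx x y - col_mx x0 y0) = col_mx (r^-1 *: (x - x0)) (e *: (y - y0)).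
Proof.
rewrite /cylmx opp_col_mx add_col_mx mul_block_col !mul0mx addr0 add0r.
by rewrite !mul_scalar_mx.
Qed.

Lemma frob_col_mx p q (a : 'cV[R]_p) (b : 'cV[R]_q) :
  frob (col_mx a b) ^+ 2 = frob a ^+ 2 + frob b ^+ 2.
Proof.
rewrite !frob_sqr !mxdotE big_split_ord /=; congr (_ + _); apply: eq_bigr => i _.
  by apply: eq_bigr => j _; rewrite !col_mxEu.
by apply: eq_bigr => j _; rewrite !col_mxEd.
Qed.

Lemma quad_cyl (x : 'cV[R]_m) (y : 'cV[R]_n) :
  quad cylmx (col_mx x0 y0) (col_mx x y) =
  (frob (x - x0) / r) ^+ 2 + (e * frob (y - y0)) ^+ 2.
Proof.
rewrite /quad cylmx_col frob_col_mx !frobZ !gtr0_norm ?invr_gt0//.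
by rewrite [_ / r]mulrC.
Qed.

Lemma quad_cyl_le3 (x : 'cV[R]_m) (y : 'cV[R]_n) :
  quad cylmx (col_mx x0 y0) (col_mx x y) <= 3 ->
  frob (x - x0) < 2 * r /\ frob (y - y0) <= 2 / e.
Proof.
rewrite quad_cyl => q3.
have h (a b : R) : 0 <= a -> a ^+ 2 + b ^+ 2 <= 3 -> a < 2.
  by move=> a0 ab; rewrite ltNge; apply/negP => a2; have := sqr_ge0 b; nra.
split.
  have := h _ _ _ q3; rewrite ltr_pdivrMr//; apply.
  by rewrite divr_ge0 ?frob_ge0// ltW.
rewrite addrC in q3; have := h _ _ _ q3; rewrite mulrC -ltr_pdivlMr// => hh.
by apply/ltW/hh; rewrite mulr_ge0 ?frob_ge0// ltW.
Qed.

Lemma quad_cyl_bounded :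
  bounded_set [set z | quad cylmx (col_mx x0 y0) z <= 3].
Proof.
apply/bounded_setP; exists (2 * r + `|x0| + (2 / e + `|y0|)) => z.
rewrite -[z]vsubmxK => /= /quad_cyl_le3[h1 h2].
have g1 : `|usubmx z| <= 2 * r + `|x0|.
  rewrite -(subrK x0 (usubmx z)); apply: le_trans (ler_normD _ _) _.
  by rewrite lerD2r; apply: le_trans (norm_le_frob _) _; exact: ltW.
have g2 : `|dsubmx z| <= 2 / e + `|y0|.
  rewrite -(subrK y0 (dsubmx z)); apply: le_trans (ler_normD _ _) _.
  by rewrite lerD2r; apply: le_trans (norm_le_frob _) _.
apply: norm_col_mx_le; first by apply: le_trans g1 _; rewrite lerDl addr_ge0// divr_ge0// ltW.
by apply: le_trans g2 _; rewrite lerDr addr_ge0// mulr_ge0// ltW.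
Qed.

(** Where the cutoff acts, the horizontal part contributes [2 / r] and the vertical part
    [e ^+ 2 * Y <= 1 / r]; the coefficient 8 of [test_slope] makes [24 / r]. *)
Lemma test_slope_le (Y : R) (x : 'cV[R]_m) (y : 'cV[R]_n) :
  frob (y - y0) <= Y -> e ^+ 2 * Y <= r^-1 ->
  quad cylmx (col_mx x0 y0) (col_mx x y) <= 3 ->
  frob (test_slope cylmx (col_mx x0 y0) (col_mx x y)) <= 24 / r.
Proof.
move=> yY eY q3; have [h1 _] := quad_cyl_le3 q3.
rewrite /test_slope cylmx_col frobZ normrN normrM [`|8|]gtr0_norm//.
have -> : cylmx^T = cylmx by rewrite /cylmx tr_block_mx !trmx0 !tr_scalar_mx.
rewrite {1}/cylmx mul_block_col !mul0mx addr0 add0r !mul_scalar_mx !scalerA.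
set q := quad _ _ _ in q3 *.
have q1 : `|Num.max 0 (q - 2)| <= 1.
  by rewrite ger0_norm ?le_max ?lexx// ge_max ler01 /=; lra.
have f : frob (col_mx ((r^-1 * r^-1) *: (x - x0)) ((e * e) *: (y - y0))) <= 3 / r.
  apply: (@le_trans _ _ (frob ((r^-1 * r^-1) *: (x - x0)) + frob ((e * e) *: (y - y0)))).
    rewrite -(@ler_pXn2r _ 2) ?nnegrE ?addr_ge0 ?frob_ge0//.
    by rewrite frob_col_mx sqrrD lerD2r lerDl mulrn_wge0// mulr_ge0 ?frob_ge0.
  rewrite !frobZ !ger0_norm ?mulr_ge0 ?invr_ge0 ?(ltW r0) ?(ltW e0)//.
  have -> : 3 / r = r^-1 * r^-1 * (2 * r) + r^-1 by field; rewrite gt_eqF.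
  apply: lerD; first by rewrite ler_wpM2l ?mulr_ge0 ?invr_ge0 ?(ltW r0)// ltW.
  by apply: le_trans eY; rewrite expr2 ler_wpM2l// mulr_ge0// ltW.
have -> : 24 / r = 8 * 1 * (3 / r) by field; rewrite gt_eqF.
by apply: ler_pM => //; rewrite ?frob_ge0 ?mulr_ge0// ler_wpM2l.
Qed.

End cylinder.

Lemma integral_patch {R : realType} d (T : measurableType d)
    (mu : {measure set T -> \bar R}) (G A : set T) (f : T -> R) : A `<=` G ->
  (\int[mu]_(x in G) ((f \_ A) x)%:E = \int[mu]_(x in A) (f x)%:E)%E.
Proof.
move=> AG; rewrite -[in RHS](setIidr AG) integral_mkcondr.
by apply: eq_integral => x _; rewrite !patchE; case: ifPn.
Qed.

Lemma measurable_patch {R : realType} d (T : measurableType d) (G A : set T) (f : T -> R) :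
  measurable G -> measurable A -> A `<=` G -> measurable_fun A f ->
  measurable_fun G (f \_ A).
Proof.
move=> mG mA AG mf; apply/(measurable_restrict f mA mG).
by rewrite setIidr.
Qed.

Lemma patch_ge0 {R : realType} T (A : set T) (f : T -> R) : (forall x, A x -> 0 <= f x) ->
  forall x, 0 <= (f \_ A) x.
Proof. by move=> f0 x; rewrite patchE; case: ifPn => // /set_mem; exact: f0. Qed.

(** * Caccioppoli inequality *)

(** The closed form of [C3] below, with only the data on which the constant of the theorem may
    depend, so that it can be named before [u], [A] and [r] are introduced. *)
Definition energy_const {R : realType} (m n : nat) (K C ell cA : R) : R :=
  2 * ((1 + n%:R + cA) * (1 + m%:R + (n * m)%:R * ell)) ^+ 2 / C *
  @cLH R m * @cHL R m n ell *
  ((cBL K (N := m + n) * cB K (N := m + n) * 24) ^+ 2 / (2 * C) + cB K (N := m + n)).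

Section caccioppoli.
Context {R : realType} {m n : nat}.
Hypothesis m0 : (0 < m)%N.
Notation N := (m + n)%N.
Notation leb := (@lebesgue_outer R m).
Notation LL := (lebesgue_mx R m).
Notation HO := (@hausdorff_outer R m N).
Notation HH := (hausdorff R m N).
Variables (K C ell cA k r : R) (Phi Psi : 'M[R]_N -> R).
Variables (Omega : set 'cV[R]_m) (u v : 'cV[R]_m -> 'cV[R]_n).
Variables (H : 'cV[R]_N -> 'cV[R]_N) (A : 'M[R]_(n, m)) (x0 : 'cV[R]_m) (y0 : 'cV[R]_n).
Hypothesis C0 : 0 < C.
Hypothesis PhiK : C2_bound K Phi.
Hypothesis PhiPsi : forall P, grass m P -> Phi P = Psi P.
Hypothesis usacP : usac C Psi.
Hypothesis oO : open Omega.
Hypothesis uv : forall x, Omega x -> u x = v x.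
Hypothesis ell0 : 0 <= ell.
Hypothesis vell : forall x y, `|v x - v y| <= ell * `|x - y|.
Hypothesis AcA : frob A <= cA.
Hypothesis k2 : 2 <= k.
Hypothesis r0 : 0 < r.
Hypothesis BO : eball x0 (k * r) `<=` Omega.

Let G : set 'cV[R]_N := gr v @` Omega.
Let S := tproj A.
Let M := bdual Phi S.
Let z0 : 'cV[R]_N := col_mx x0 y0.
Let cb : R := cB K (N := N).
Let cl : R := cBL K (N := N).
Let w x : 'cV[R]_n := v x - y0 - A *m (x - x0).
(** A bound for [frob (v x - y0)] on [B]; the summand 1 makes it positive. *)
Let Y : R := n%:R * ell * (k * r) + frob (v x0 - y0) + 1.
(** Chosen so that both [(e * Y) ^+ 2 <= 1] and [e ^+ 2 * Y <= 1 / r] hold: the first keeps the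
    cutoff equal to 1 over [D], the second bounds its vertical slope. *)
Let e : R := Num.sqrt (Y ^+ 2 + r * Y)^-1.
Let P : 'M[R]_N := cylmx r e.
Let g : 'cV[R]_N -> 'cV[R]_N := test_field P M z0.
Let B : set 'cV[R]_m := eball x0 (k * r).
Let D : set 'cV[R]_m := eball x0 r.
Let Z : set 'cV[R]_m := ~` lip_good v.
Let b z : R := mxdot (anisoB m Psi (approx_tangent m G z)) (jac g z).
(** A crude bound for the first variation integrand over [B]. It enters only finiteness arguments
    and an integral over a null set, so its dependence on [Y] does not reach the final constant. *)
Let kap : R := cb * (cb + cb * (Y + cA * (k * r)) * (24 / r)).
Let q x : R := quad P z0 (gr v x).

Let k0 : 0 < k. Proof. exact: lt_le_trans k2. Qed.
Let kr0 : 0 < k * r. Proof. exact: mulr_gt0. Qed.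
Let cA0 : 0 <= cA. Proof. by apply: le_trans AcA; exact: frob_ge0. Qed.
Let cb0 : 0 <= cb. Proof. exact: cB_ge0 PhiK. Qed.
Let gS : grass m S. Proof. exact: tproj_grass. Qed.

Let Y0 : 0 < Y.
Proof.
rewrite ltr_wpDl// addr_ge0 ?frob_ge0// mulr_ge0 ?(ltW kr0)// mulr_ge0//.
Qed.

Let YrY0 : 0 < Y ^+ 2 + r * Y.
Proof. by rewrite addr_gt0 ?exprn_gt0 ?mulr_gt0. Qed.

Let e0 : 0 < e. Proof. by rewrite sqrtr_gt0 invr_gt0. Qed.

Let e2E : e ^+ 2 = (Y ^+ 2 + r * Y)^-1.
Proof. by rewrite sqr_sqrtr// invr_ge0 ltW. Qed.

Let eY2 : (e * Y) ^+ 2 <= 1.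
Proof.
by rewrite exprMn e2E mulrC ler_pdivrMr// mul1r lerDl mulr_ge0// ltW.
Qed.

Let eY : e ^+ 2 * Y <= r^-1.
Proof.
rewrite e2E mulrC ler_pdivrMr// mulrDr [_ * (r * Y)]mulrA mulVf ?gt_eqF// mul1r lerDr.
by rewrite mulr_ge0 ?invr_ge0 ?sqr_ge0// ltW.
Qed.

Let vY x : B x -> frob (v x - y0) <= Y.
Proof.
move=> /ltW Bx; rewrite -(subrKA (v x0)); apply: le_trans (ler_frobD _ _) _.
rewrite /Y -addrA; apply: lerD; last by rewrite lerDl.
apply: le_trans (frob_le_norm _) _; rewrite muln1 -mulrA ler_wpM2l//.
apply: le_trans (vell _ _) _; rewrite ler_wpM2l//.
exact: le_trans (norm_le_frob _) Bx.
Qed.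

Let wY x : B x -> frob (w x) <= Y + cA * (k * r).
Proof.
move=> Bx; apply: le_trans (ler_frobD _ _) _; rewrite frobN; apply: lerD; first exact: vY.
apply: le_trans (frobM _ _) _; apply: ler_pM; rewrite ?frob_ge0//.
exact: ltW.
Qed.

Let DB : D `<=` B.
Proof.
move=> x; rewrite /D /B /eball /= => /lt_le_trans; apply.
by rewrite ler_peMl ?(ltW r0)//; apply: le_trans k2; rewrite ler1n.
Qed.

(** The horizontal and the vertical part of [q] are each at most 1 over [D], which explains the
    threshold 2 in [eta_eq1]. *)
Let qD x : D x -> eta (q x) = 1.
Proof.
move=> Dx; apply: eta_eq1; rewrite /q /gr quad_cyl//.
have h1 : (frob (x - x0) / r) ^+ 2 <= 1.
  rewrite expr_le1// ?divr_ge0 ?frob_ge0 ?(ltW r0)//.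
  by rewrite ler_pdivrMr// mul1r ltW.
have h2 : (e * frob (v x - y0)) ^+ 2 <= 1.
  apply: le_trans eY2; apply: lerXn2r.
  - by rewrite nnegrE mulr_ge0 ?frob_ge0// ltW.
  - by rewrite nnegrE mulr_ge0// ltW.
  - by rewrite ler_wpM2l ?(ltW e0)// vY//; exact: DB.
lra.
Qed.

(** Where [q <= 3] the horizontal distance is below [2 * r], and [2 <= k]. *)
Let qB x : q x <= 3 -> B x.
Proof.
move=> q3; have [h _] := quad_cyl_le3 r0 e0 q3.
rewrite /B /eball /=; apply: lt_le_trans h _.
by rewrite ler_wpM2r// ltW.
Qed.

Let inB x : q x <= 3 -> (x \in B) = true.
Proof. by move=> q3; apply/mem_set; exact: qB. Qed.

Let M_gr x : M *m (gr v x - z0) = M *m col_mx 0 (w x).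
Proof. by rewrite /gr /z0 opp_col_mx add_col_mx /M /S bdual_graph. Qed.

Let jacE x : jac g (gr v x) = eta (q x) ^+ 2 *: M +
  (M *m col_mx 0 (w x)) *m (eta (q x) *: test_slope P z0 (gr v x))^T.
Proof. by rewrite /g jac_test_field M_gr. Qed.

(** Holds at every point: without an approximate tangent plane the default value of [approx_tangent]
    is 0, at which [anisoB] vanishes. *)
Let aniso_le z : frob (anisoB m Psi (approx_tangent m G z)) <= cb.
Proof.
rewrite /approx_tangent; case: xgetP => [T _ [gT _]|_]; last by rewrite anisoB0 frob0.
have [C2 _ _ _] := PhiK.
by rewrite (anisoBE C2.1 PhiPsi gT); exact: (bform_bound PhiK (erefl _)).
Qed.

Let frob_Mw x : B x -> frob (M *m col_mx 0 (w x)) <= cb * (Y + cA * (k * r)).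
Proof.
move=> Bx; apply: le_trans (frobM _ _) _; apply: ler_pM; rewrite ?frob_ge0//.
  exact: (bdual_bound PhiK (erefl _)).
by rewrite frob_col_mx0; exact: wY.
Qed.

Let slope_le x : q x <= 3 -> frob (test_slope P z0 (gr v x)) <= 24 / r.
Proof.
move=> q3; apply: (test_slope_le r0 e0 _ eY q3); apply: vY; exact: qB.
Qed.

Let b_le x : `|b (gr v x)| <= (cst kap \_ B) x.
Proof.
have eta0 := eta_ge0 (q x); have eta1 := eta_le1 (q x).
have kap0 : 0 <= kap.
  have h1 : 0 <= Y + cA * (k * r) by rewrite addr_ge0 ?(ltW Y0)// mulr_ge0// ltW.
  have h2 : 0 <= 24 / r by rewrite divr_ge0// ltW.
  by apply: mulr_ge0 => //; apply: addr_ge0 => //; apply: mulr_ge0 => //; exact: mulr_ge0.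
rewrite /b; apply: le_trans (mxdot_absCS _ _) _.
have [q3|q3] := leP (q x) 3; last first.
  rewrite jacE (eta_eq0 (ltW q3)) expr0n scale0r add0r scale0r trmx0 mulmx0 frob0 mulr0.
  by apply: patch_ge0.
rewrite patchE (inB q3) /kap.
apply: ler_pM; rewrite ?frob_ge0//.
rewrite jacE; apply: le_trans (ler_frobD _ _) _; apply: lerD.
  rewrite frobZ ger0_norm ?sqr_ge0// -[leRHS]mul1r; apply: ler_pM; rewrite ?frob_ge0 ?sqr_ge0//.
    by rewrite expr_le1.
  exact: (bdual_bound PhiK (erefl _)).
apply: le_trans (frobM _ _) _; apply: ler_pM; rewrite ?frob_ge0//.
  exact: frob_Mw (qB q3).
rewrite frob_tr frobZ ger0_norm// -[leRHS]mul1r; apply: ler_pM; rewrite ?frob_ge0//.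
exact: slope_le.
Qed.

(** The constant of [test_matrix_ge] for the slope bound [24 / r], with the factor [r^-2] split
    off. *)
Let c1 : R := (cl * cb * 24) ^+ 2 / (2 * C).

Let a : 'cV[R]_m -> R := (fun x => c1 / r ^+ 2 * frob (w x) ^+ 2) \_ B.

Let c10 : 0 <= c1.
Proof. by rewrite divr_ge0 ?sqr_ge0// mulr_ge0// ltW. Qed.

Let a0 x : 0 <= a x.
Proof.
apply: patch_ge0 => y _; apply: mulr_ge0; last exact: sqr_ge0.
by apply: divr_ge0 => //; exact: sqr_ge0.
Qed.

Let good_ge x J : Omega x -> lip_good v x -> diff_at v x J ->
  C / 2 * eta (q x) ^+ 2 * frob (tproj J - S) ^+ 2 <= b (gr v x) + a x.
Proof.
move=> Ox gx dJ; have [q3|q3] := leP (q x) 3; last first.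
  rewrite (eta_eq0 (ltW q3)) expr0n mulr0 mul0r /b jacE (eta_eq0 (ltW q3)).
  by rewrite expr0n scale0r add0r scale0r trmx0 mulmx0 /mxdot mulmx0 mxtrace0 add0r.
rewrite /b (approx_tangent_gr m0 ell0 vell oO Ox gx dJ).
have [C2 _ _ _] := PhiK; rewrite (anisoBE C2.1 PhiPsi (tproj_grass J)) jacE.
have h := test_matrix_ge C0 PhiK PhiPsi usacP (col_mx 0 (w x)) (tproj_grass J) gS
  (eta_ge0 (q x)) (slope_le q3).
apply: le_trans h _; rewrite lerD2l frob_col_mx0 /a patchE (inB q3).
rewrite -/cl -/cb -[X in _ <= X]/(c1 / r ^+ 2 * frob (w x) ^+ 2) /c1.
move: cl cb (frob (w x)) => p p' f.
by rewrite le_eqVlt; apply/orP; left; apply/eqP; field; rewrite !gt_eqF.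
Qed.

Let a' : 'cV[R]_m -> R := (fun x => cb * (r ^+ 2 * frob (H (gr v x)) ^+ 2 +
  frob (w x) ^+ 2 / r ^+ 2)) \_ B.

Let a'0 x : 0 <= a' x.
Proof.
apply: patch_ge0 => y _.
apply: mulr_ge0 => //; apply: addr_ge0; first by apply: mulr_ge0; exact: sqr_ge0.
by apply: divr_ge0; exact: sqr_ge0.
Qed.

Let forcing x : `|mxdot (H (gr v x)) (g (gr v x))| <= a' x.
Proof.
have [q3|q3] := leP (q x) 3; last first.
  by rewrite /g (test_field_eq0 _ (ltW q3)) /mxdot mulmx0 mxtrace0 normr0.
rewrite /g /test_field zetaE M_gr; apply: le_trans (forcing_le PhiK _ _ gS _ r0) _.
  by rewrite eta_ge0 eta_le1.
by rewrite frob_col_mx0 /a' patchE (inB q3).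
Qed.

Let mO : leb.-caratheodory Omega. Proof. exact: leb_open_measurable. Qed.
Let mB : leb.-caratheodory B. Proof. by apply: leb_open_measurable => //; exact: eball_open. Qed.
Let mD : leb.-caratheodory D. Proof. by apply: leb_open_measurable => //; exact: eball_open. Qed.
Let Z0 : leb Z = 0%E. Proof. exact: (lip_good_ae m0 vell). Qed.
Let mZ : leb.-caratheodory Z. Proof. exact: null_caratheodory. Qed.
Let mG : HO.-caratheodory G. Proof. exact: (gr_image_measurable m0 ell0 vell). Qed.

Let mw (X : set (caratheodory_type leb)) :
  measurable_fun X ((fun x => frob (w x) ^+ 2) : caratheodory_type leb -> R).
Proof.
apply: measurable_funX; apply: measurable_funTS.
apply: (continuous_cara_measurable _ openT) => [U oU|x _].
  exact: leb_open_measurable.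
move: x; apply: compf_continuous; last exact: frob_continuous.
apply: (@lipschitz_continuous _ _ _ _ (ell + m%:R * `|A|)) => x y.
have -> : w x - w y = (v x - v y) - A *m (x - y).
  by rewrite /w !mulmxBr; apply/matrixP => i j; rewrite !mxE; ring.
apply: le_trans (ler_normB _ _) _; rewrite mulrDl; apply: lerD; first exact: vell.
exact: norm_mulmx_le.
Qed.

Hypothesis mH : forall i, measurable_fun (G : set (caratheodory_type HO))
  ((fun z => H z i 0) : caratheodory_type HO -> R).

Let mHv (X : set (caratheodory_type leb)) : leb.-caratheodory X -> X `<=` Omega ->
  measurable_fun X ((fun x => frob (H (gr v x)) ^+ 2) : caratheodory_type leb -> R).
Proof.
move=> mX XO.
suff h : measurable_fun (Omega : set (caratheodory_type leb))
    ((fun x => frob (H (gr v x)) ^+ 2) : caratheodory_type leb -> R).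
  by move=> _ W mW; rewrite -(setIidl XO) -setIA; apply: caratheodory_measurable_setI => //; exact: h.
rewrite (_ : (fun x => _) = (fun x => \sum_(i < N) H (gr v x) i 0 ^+ 2)); last first.
  apply/funext => x; rewrite frob_sqr mxdotE; apply: eq_bigr => i _.
  by rewrite big_ord_recl big_ord0 addr0 expr2.
apply: measurable_sum => i; apply: measurable_funX.
exact: (graph_pullback_measurable m0 ell0 vell mO (mH i)).
Qed.

Let mc : measurable_fun (G : set (caratheodory_type HO))
  ((fun z => mxdot (H z) (g z)) : caratheodory_type HO -> R).
Proof.
rewrite (_ : (fun z => _) = (fun z => \sum_(i < N) H z i 0 * g z i 0)); last first.
  apply/funext => x; rewrite mxdotE; apply: eq_bigr => i _.
  by rewrite big_ord_recl big_ord0 addr0.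
apply: measurable_sum => i; apply: measurable_funM; first exact: mH.
apply: measurable_funTS; apply: (continuous_cara_measurable _ openT) => [U oU|x _].
  exact: hausdorff_open_measurable.
have gc : continuous g.
  by move=> z; have [/differentiable_continuous] := diff_test_field P M z0 z.
have ic : continuous (fun y : 'cV[R]_N => y i 0).
  apply: (@lipschitz_continuous _ _ _ _ 1) => y z; rewrite mul1r.
  by have := entry_le_norm (y - z) i 0; rewrite !mxE.
exact: (compf_continuous gc ic).
Qed.

Hypothesis weak_eq : forall g : 'cV[R]_N -> 'cV[R]_N, C1_on setT g ->
  compact_supp [set z : 'cV[R]_N | Omega (usubmx z)] g ->
  \int[HH]_(z in G) mxdot (anisoB m Psi (approx_tangent m G z)) (jac g z) =
  - \int[HH]_(z in G) mxdot (H z) (g z).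

Let weak_g : (\int[HH]_(z in G) b z = - \int[HH]_(z in G) mxdot (H z) (g z))%R.
Proof.
apply: weak_eq; first exact: test_field_C1.
apply: test_field_supp; first exact: quad_cyl_bounded.
move=> z; rewrite -[z]vsubmxK => /= /(quad_cyl_le3 r0 e0)[h _].
rewrite col_mxKu; apply: BO; apply: lt_le_trans h _.
by rewrite ler_wpM2r// ltW.
Qed.

Let cJ : R := (n * m)%:R * ell.
Let cV : R := (1 + n%:R + cA) * (1 + m%:R + cJ).

Let C3 : R := 2 * cV ^+ 2 / C * @cLH R m * @cHL R m n ell * (c1 + cb).

Let cJ0 : 0 <= cJ. Proof. by rewrite mulr_ge0. Qed.

Let cV0 : 0 < cV.
Proof. by rewrite mulr_gt0// ltr_pwDl// ltr_pwDl. Qed.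

Let jac_u x : Omega x -> lip_good v x -> exists2 J, diff_at v x J & jac u x = J.
Proof.
move=> Ox gx; have [J dJ] := lip_good_diff m0 vell gx.
by exists J => //; have [] := diff_at_jac (diff_at_local oO Ox uv dJ).
Qed.

Let slope_good x J : diff_at v x J ->
  frob (J - A) ^+ 2 <= cV ^+ 2 * frob (tproj J - S) ^+ 2.
Proof.
move=> dJ; rewrite -exprMn; apply: lerXn2r; rewrite ?nnegrE ?frob_ge0//.
  by rewrite mulr_ge0 ?frob_ge0// ltW.
apply: le_trans (slope_diff_le _ _) _; rewrite ler_wpM2r ?frob_ge0//.
apply: ler_pM; rewrite ?addr_ge0 ?frob_ge0// lerD2l//.
exact: jac_bound dJ.
Qed.

Let bounded_lt (X : set 'cV[R]_m) (f : 'cV[R]_m -> R) (c : R) : leb.-caratheodory X ->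
  X `<=` B -> measurable_fun (X : set (caratheodory_type leb)) (f : caratheodory_type leb -> R) ->
  (forall x, X x -> 0 <= f x) -> (forall x, X x -> f x <= c) ->
  (\int[LL]_(x in X) (f x)%:E < +oo)%E.
Proof.
move=> mX XB mf f0 fc.
apply: (@le_lt_trans _ _ (\int[LL]_(x in X) (`|c|)%:E)%E).
  apply: ge0_le_lower_integral => x Xx; rewrite lee_fin; first exact: f0.
  by apply: le_trans (fc x Xx) (ler_norm _).
rewrite integral_cst// lte_mul_pinfty ?lee_fin//.
apply: le_lt_trans (le_outer_measure _ _ _ XB) _.
by rewrite -ge0_fin_numE ?leb_ge0//; exact: leb_eball_fin.
Qed.

Let Iw : \bar R := \int[LL]_(x in B) (frob (w x) ^+ 2)%:E.
Let IH : \bar R := \int[LL]_(x in B) (frob (H (gr v x)) ^+ 2)%:E.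

Let Iw_fin : Iw \is a fin_num.
Proof.
rewrite ge0_fin_numE; last by apply: integral_ge0 => x _; rewrite lee_fin sqr_ge0.
apply: (@bounded_lt B _ ((Y + cA * (k * r)) ^+ 2)) => // [x _|x Bx].
  exact: sqr_ge0.
have h := wY Bx.
by apply: lerXn2r; rewrite ?nnegrE ?frob_ge0//; apply: le_trans h; exact: frob_ge0.
Qed.

Let Zo : set 'cV[R]_m := Omega `&` Z.
Let mZo : leb.-caratheodory Zo. Proof. exact: caratheodory_measurable_setI. Qed.
Let Zo0 : leb Zo = 0%E.
Proof.
apply/eqP; rewrite eq_le leb_ge0 andbT -Z0.
by apply: le_outer_measure => x [].
Qed.

Let integral_a : (\int[LL]_(x in Omega) (a x)%:E = (c1 / r ^+ 2)%:E * Iw)%E.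
Proof.
rewrite /a integral_patch//; under eq_integral do rewrite EFinM.
apply: ge0_integralZl_EFin; [exact: mB| | |].
- by move=> x _; rewrite lee_fin sqr_ge0.
- by apply/measurable_EFinP; exact: (@mw B).
- by apply: divr_ge0; [exact: c10|exact: sqr_ge0].
Qed.

Let ma : measurable_fun (Omega : set (caratheodory_type leb)) (a : caratheodory_type leb -> R).
Proof.
have h : measurable_fun (B : set (caratheodory_type leb))
    ((fun x => c1 / r ^+ 2 * frob (w x) ^+ 2) : caratheodory_type leb -> R).
  by apply: measurable_funM; [exact: measurable_cst|exact: (@mw B)].
exact: (@measurable_patch R _ (caratheodory_type leb) Omega B _ mO mB BO h).
Qed.

Let integral_a' : (\int[LL]_(x in Omega) (a' x)%:E =
  cb%:E * ((r ^+ 2)%:E * IH + (r ^- 2)%:E * Iw))%E.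
Proof.
rewrite /a' integral_patch//.
have mh := mHv mB BO.
pose F1 (x : 'cV[R]_m) : \bar R := ((r ^+ 2)%:E * (frob (H (gr v x)) ^+ 2)%:E)%E.
pose F2 (x : 'cV[R]_m) : \bar R := ((r ^- 2)%:E * (frob (w x) ^+ 2)%:E)%E.
have -> : (\int[LL]_(x in B) (cb * (r ^+ 2 * frob (H (gr v x)) ^+ 2 +
    frob (w x) ^+ 2 / r ^+ 2))%:E = \int[LL]_(x in B) (cb%:E * (F1 x + F2 x)))%E.
  by apply: eq_integral => x _; rewrite /F1 /F2 -!(EFinM, EFinD) [_ / r ^+ 2]mulrC.
have mE (f : 'cV[R]_m -> R) c : measurable_fun (B : set (caratheodory_type leb))
    (f : caratheodory_type leb -> R) ->
    measurable_fun (B : set (caratheodory_type leb)) (fun x => c%:E * (f x)%:E)%E.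
  by move=> mf; apply: measurable_funeM; exact/measurable_EFinP.
have r20 : 0 <= r ^+ 2 by exact: sqr_ge0.
have r20' : 0 <= r ^- 2 by rewrite invr_ge0.
have F10 x : (0 <= F1 x)%E by rewrite /F1 -EFinM lee_fin mulr_ge0// sqr_ge0.
have F20 x : (0 <= F2 x)%E by rewrite /F2 -EFinM lee_fin mulr_ge0// sqr_ge0.
have mF1 := mE _ (r ^+ 2) mh; have mF2 := mE _ (r ^- 2) (@mw B).
have h1 : (\int[LL]_(x in B) F1 x = (r ^+ 2)%:E * IH)%E.
  apply: ge0_integralZl_EFin; [exact: mB| |exact/measurable_EFinP|exact: r20].
  by move=> x _; rewrite lee_fin sqr_ge0.
have h2 : (\int[LL]_(x in B) F2 x = (r ^- 2)%:E * Iw)%E.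
  apply: ge0_integralZl_EFin; [exact: mB| | |exact: r20'].
    by move=> x _; rewrite lee_fin sqr_ge0.
  by apply/measurable_EFinP; exact: (@mw B).
have h3 : (\int[LL]_(x in B) (F1 x + F2 x) =
    \int[LL]_(x in B) F1 x + \int[LL]_(x in B) F2 x)%E.
  apply: ge0_integralD; [exact: mB| |exact: mF1| |exact: mF2] => x _.
    exact: F10.
  exact: F20.
rewrite -h1 -h2 -h3.
apply: ge0_integralZl_EFin; [exact: mB| | |exact: cb0].
  by move=> x _; rewrite adde_ge0.
exact: (emeasurable_funD mF1 mF2).
Qed.

Let ma' : measurable_fun (Omega : set (caratheodory_type leb)) (a' : caratheodory_type leb -> R).
Proof.
have h : measurable_fun (B : set (caratheodory_type leb)) ((fun x => cb *
    (r ^+ 2 * frob (H (gr v x)) ^+ 2 + frob (w x) ^+ 2 / r ^+ 2)) : caratheodory_type leb -> R).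
  apply: measurable_funM; first exact: measurable_cst.
  apply: measurable_funD.
    by apply: measurable_funM; [exact: measurable_cst|exact: (mHv mB BO)].
  by apply: measurable_funM; [exact: (@mw B)|exact: measurable_cst].
exact: (@measurable_patch R _ (caratheodory_type leb) Omega B _ mO mB BO h).
Qed.

(** The charge on the null set where the tangent plane is not identified; it compensates a possibly
    negative first variation integrand there. *)
Let kZ : 'cV[R]_m -> R := cst kap \_ Zo.

Let kap0 : 0 <= kap.
Proof.
have h1 : 0 <= Y + cA * (k * r) by rewrite addr_ge0 ?(ltW Y0)// mulr_ge0// ltW.
have h2 : 0 <= 24 / r by rewrite divr_ge0// ltW.
by apply: mulr_ge0 => //; apply: addr_ge0 => //; apply: mulr_ge0 => //; exact: mulr_ge0.
Qed.

Let kZ0 x : 0 <= kZ x. Proof. by apply: patch_ge0. Qed.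

Let mcst (X : set 'cV[R]_m) : leb.-caratheodory X -> X `<=` Omega ->
  measurable_fun (Omega : set (caratheodory_type leb))
    ((cst kap \_ X) : caratheodory_type leb -> R).
Proof.
move=> mX XO; have h : measurable_fun (X : set (caratheodory_type leb))
    (cst kap : caratheodory_type leb -> R) by exact: measurable_cst.
exact: (@measurable_patch R _ (caratheodory_type leb) Omega X _ mO mX XO h).
Qed.

Let Icst (X : set 'cV[R]_m) : leb.-caratheodory X ->
  (\int[LL]_(x in X) (cst kap x)%:E = kap%:E * leb X)%E.
Proof. by move=> mX; exact: (integral_cst LL mX kap%:E). Qed.

Let graph_fin (f : 'cV[R]_m -> R) :
  measurable_fun (Omega : set (caratheodory_type leb)) (f : caratheodory_type leb -> R) ->
  (forall x, 0 <= f x) -> (\int[LL]_(x in Omega) (f x)%:E < +oo)%E ->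
  (\int[HH]_(z in G) (f (usubmx z))%:E < +oo)%E.
Proof.
move=> mf f0 ff; apply: le_lt_trans (graph_integral_le m0 ell0 vell mO mf (fun x _ => f0 x)) _.
by rewrite lte_mul_pinfty// lee_fin ltW// cHL_gt0.
Qed.

Let IH_ge0 : (0 <= IH)%E.
Proof. by apply: integral_ge0 => x _; rewrite lee_fin sqr_ge0. Qed.

Let Iw_ge0 : (0 <= Iw)%E.
Proof. by apply: integral_ge0 => x _; rewrite lee_fin sqr_ge0. Qed.

(** A measurable minorant [h] of the squared slope deviation, scaled by [cs], is the coercive term
    of [weak_balance] on the graph. The result is brought back to the base, so the constants of both
    measure comparisons enter [C3]. *)
Lemma caccioppoli_ball : (IH < +oo)%E ->
  (\int[LL]_(x in D) (frob (jac u x - A) ^+ 2)%:E <= (C3 / r ^+ 2)%:E * Iw +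
     (r ^+ 2 * C3)%:E * IH)%E.
Proof.
move=> IHfin; have IHf : IH \is a fin_num by rewrite ge0_fin_numE.
have DO : D `\` Z `<=` Omega by move=> x [Dx _]; exact/BO/DB.
have mDZ : leb.-caratheodory (D `\` Z) by exact: caratheodory_measurable_setD.
apply: (@lower_integral_sup _ _ _ LL D Z) => // [x|h mh h0 hle]; first exact: sqr_ge0.
(* The factor for which [cs * h] is at most [C / 2] times the squared distance of the tangent
   planes, the slope deviation being at most [cV] times that distance. *)
pose cs : R := C / (2 * cV ^+ 2).
have cV2 : 0 < cV ^+ 2 by rewrite exprn_gt0.
have cs0 : 0 < cs by rewrite divr_gt0// mulr_gt0.
pose s : 'cV[R]_m -> R := (fun x => cs * h x) \_ (D `\` Z).
have s0 x : 0 <= s x by apply: patch_ge0 => y _; rewrite mulr_ge0// ltW.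
have mh' : measurable_fun (D `\` Z : set (caratheodory_type leb)) (h : caratheodory_type leb -> R).
  exact: measurable_funTS.
have ms : measurable_fun (Omega : set (caratheodory_type leb)) (s : caratheodory_type leb -> R).
  have h' : measurable_fun (D `\` Z : set (caratheodory_type leb))
      ((fun x => cs * h x) : caratheodory_type leb -> R).
    by apply: measurable_funM; first exact: measurable_cst.
  exact: (@measurable_patch R _ (caratheodory_type leb) Omega _ _ mO mDZ DO h').
have Is : (\int[LL]_(x in Omega) (s x)%:E = cs%:E * \int[LL]_(x in D `\` Z) (h x)%:E)%E.
  rewrite /s integral_patch//; under eq_integral do rewrite EFinM.
  apply: ge0_integralZl_EFin; [exact: mDZ| |exact/measurable_EFinP|exact: ltW].
  by move=> x _; rewrite lee_fin.
have hJ x : (D `\` Z) x -> h x <= (cJ + cA) ^+ 2.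
  move=> [Dx /contrapT gx]; apply: le_trans (hle x _) _; first by split=> //; apply.
  have [J dJ ->] := jac_u (BO (DB Dx)) gx.
  apply: lerXn2r; rewrite ?nnegrE ?frob_ge0 ?addr_ge0//.
  apply: le_trans (ler_frobD _ _) _; rewrite frobN; apply: lerD => //.
  exact: jac_bound dJ.
have hfin : (\int[LL]_(x in D `\` Z) (h x)%:E < +oo)%E.
  by apply: (@bounded_lt _ _ ((cJ + cA) ^+ 2)) => // x [Dx _]; exact: DB.
have mU f mf := @usub_measurable _ _ _ m0 _ _ ell0 vell _ mO f mf.
have ZoO : Zo `<=` Omega by move=> x [].
have mkZ : measurable_fun (Omega : set (caratheodory_type leb)) (kZ : caratheodory_type leb -> R).
  exact: mcst.
have mak : measurable_fun (Omega : set (caratheodory_type leb))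
    ((fun x => a x + kZ x) : caratheodory_type leb -> R).
  by apply: measurable_funD; [exact: ma|exact: mkZ].
have ak0 x : 0 <= a x + kZ x by rewrite addr_ge0.
have Iak : (\int[LL]_(x in Omega) (a x + kZ x)%:E = (c1 / r ^+ 2)%:E * Iw)%E.
  have h3 : (\int[LL]_(x in Omega) ((a x)%:E + (kZ x)%:E) =
      \int[LL]_(x in Omega) (a x)%:E + \int[LL]_(x in Omega) (kZ x)%:E)%E.
    apply: ge0_integralD; [exact: mO| |exact/measurable_EFinP| |exact/measurable_EFinP] => x _.
      by rewrite lee_fin.
    by rewrite lee_fin.
  transitivity (\int[LL]_(x in Omega) ((a x)%:E + (kZ x)%:E))%E.
    by apply: eq_integral => x _; rewrite EFinD.
  rewrite h3 integral_a /kZ (@integral_patch R _ (caratheodory_type leb) LL Omega Zo _ ZoO).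
  by rewrite (Icst mZo) Zo0 mule0 adde0.
have key : (\int[HH]_(z in G) (s (usubmx z))%:E <=
    \int[HH]_(z in G) (a (usubmx z) + kZ (usubmx z))%:E + \int[HH]_(z in G) (a' (usubmx z))%:E)%E.
  pose kB : 'cV[R]_m -> R := cst kap \_ B.
  have kB0 x : 0 <= kB x by apply: patch_ge0.
  have mkB := mcst mB BO.
  apply: (@weak_balance _ _ _ HH G _ _ _ b (fun z => mxdot (H z) (g z)) (kB \o usubmx) mG
    (mU _ ms) (mU _ mak) (mU _ ma') mc (mU _ mkB)).
  - by move=> z _; exact: s0.
  - by move=> z _; exact: ak0.
  - by move=> _ [x Ox <-]; rewrite /comp usub_gr; exact: forcing.
  - move=> _ [x Ox <-]; rewrite /comp usub_gr.
    have [gx|gx] := pselect (lip_good v x).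
      have [J dJ JE] := jac_u Ox gx.
      apply: le_trans (_ : b (gr v x) + a x <= _); last by rewrite lerD2l lerDl.
      apply: le_trans (good_ge Ox gx dJ).
      rewrite /s patchE; case: ifPn => [/set_mem[Dx _]|_]; last first.
        by rewrite mulr_ge0 ?sqr_ge0// mulr_ge0 ?sqr_ge0// divr_ge0// ltW.
      rewrite (qD Dx) expr1n mulr1.
      have hx : h x <= cV ^+ 2 * frob (tproj J - S) ^+ 2.
        apply: le_trans (slope_good dJ); rewrite -JE; apply: hle.
        by split => //; apply.
      apply: le_trans (ler_wpM2l (ltW cs0) hx) _.
      rewrite mulrA /cs le_eqVlt; apply/orP; left; apply/eqP; congr (_ * _).
      by field; rewrite gt_eqF.
    (* On the exceptional set the left-hand side is 0 and [b + kap] is nonnegative. *)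
    have -> : s x = 0 by rewrite /s patchE memNset// => -[_]; apply.
    have -> : kZ x = kap by rewrite /kZ patchE mem_set.
    have := le_trans (b_le x) (_ : _ <= kap).
    rewrite ler_norml => /(_ _)/andP[]; last by move: (a0 x); lra.
    by rewrite patchE; case: ifP.
  - by move=> _ [x Ox <-]; rewrite /comp usub_gr; apply: le_trans (ler_norm _) (b_le x).
  - by move=> z _; exact: kB0.
  - by apply: (graph_fin ms s0); rewrite Is lte_mul_pinfty ?lee_fin// ltW.
  - by apply: (graph_fin mak ak0); rewrite Iak -(fineK Iw_fin) -EFinM ltry.
  - apply: (graph_fin ma' a'0); rewrite integral_a' -(fineK IHf) -(fineK Iw_fin).
    by rewrite -!(EFinM, EFinD) ltry.
  - apply: (graph_fin mkB kB0); rewrite /kB (@integral_patch R _ (caratheodory_type leb) LL Omega B _ BO).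
    rewrite (Icst mB) lte_mul_pinfty ?lee_fin// -ge0_fin_numE ?leb_ge0//; exact: leb_eball_fin.
  - exact: weak_g.
have E1 := graph_integral_le m0 ell0 vell mO mak (fun x _ => ak0 x).
have E2 := graph_integral_le m0 ell0 vell mO ma' (fun x _ => a'0 x).
have S1 := integral_graph_le m0 ell0 vell mO ms (fun x _ => s0 x).
rewrite Iak in E1; rewrite integral_a' in E2; rewrite Is in S1.
have hf : (\int[LL]_(x in D `\` Z) (h x)%:E)%E \is a fin_num.
  by rewrite ge0_fin_numE//; apply: integral_ge0 => x _; rewrite lee_fin.
have cLH0 : 0 < @cLH R m by exact: cLH_gt0.
have cHL0 : 0 < @cHL R m n ell by exact: cHL_gt0.
move: (le_trans key (leeD E1 E2)) => E3.
have S2 := le_trans S1 (lee_wpmul2l (_ : (0 <= (@cLH R m)%:E)%E) E3).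
move: (S2 (ltW cLH0)) => {S2 E1 E2 E3 S1 key Iak}.
have hE : (\int[LL]_(x in D `\` Z) (h x)%:E = (fine (\int[LL]_(x in D `\` Z) (h x)%:E))%:E)%E.
  by rewrite fineK.
have wE : Iw = (fine Iw)%:E by rewrite fineK.
have HE : IH = (fine IH)%:E by rewrite fineK.
have iw0 : 0 <= fine Iw by rewrite fine_ge0.
have iH0 : 0 <= fine IH by rewrite fine_ge0.
rewrite hE wE HE.
move: (fine _) (fine IH) (fine Iw) iw0 iH0 => ih iH iw iw0 iH0.
rewrite -!(EFinM, EFinD) !lee_fin => S3.
rewrite -(ler_pM2l cs0); apply: le_trans S3 _.
(* [C3] carries [c1 + cb] for both integrals, while the curvature integral needs only [cb]; the
   difference of the two sides is the surplus with [c1]. *)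
rewrite -subr_ge0.
have -> : cs * (C3 / r ^+ 2 * iw + r ^+ 2 * C3 * iH) -
    @cLH R m * (@cHL R m n ell * (c1 / r ^+ 2 * iw) +
    @cHL R m n ell * (cb * (r ^+ 2 * iH + r ^- 2 * iw))) =
    @cLH R m * @cHL R m n ell * c1 * (r ^+ 2 * iH).
  by rewrite /cs /C3; field; rewrite !gt_eqF.
by apply: mulr_ge0; apply: mulr_ge0 => //; [apply: mulr_ge0; exact: ltW|exact: sqr_ge0].
Qed.

End caccioppoli.

Lemma inv_scale_le {R : realType} (c kappa d b : R) : 0 <= c -> 0 < d -> 0 < b ->
  b <= kappa * d -> c * d^-1 <= c * kappa * b^-1.
Proof.
move=> c0 d0 b0 h; rewrite -mulrA; apply: ler_wpM2l => //.
by rewrite ler_pdivlMr// mulrC ler_pdivrMr.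
Qed.

(** Passage to averages in the extended reals. If [Y] is infinite so is the right-hand side, hence
    the integral inequality is required only for finite [Y]. *)
Lemma average_le {R : realType} (c c' c2 alpha beta r : R) (X Y I : \bar R) :
  0 < c -> 0 < c2 -> 0 < alpha -> 0 < beta -> 0 < r -> c' <= c ->
  c * alpha <= c2 * beta -> (0 <= X)%E -> (0 <= Y)%E ->
  ((Y < +oo)%E -> (I <= (c' / r ^+ 2)%:E * X + (r ^+ 2 * c')%:E * Y)%E) ->
  (alpha%:E * I <= (c2 / r ^+ 2)%:E * (beta%:E * X) + (r ^+ 2 * c2)%:E * (beta%:E * Y))%E.
Proof.
move=> c0 c20 alpha0 beta0 r0 c'c ab X0 Y0 main.
have r20 : 0 < r ^+ 2 by rewrite exprn_gt0.
have scale (d d' : R) (W : \bar R) : 0 <= d -> d * alpha <= d' * beta -> (0 <= W)%E ->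
    (alpha%:E * (d%:E * W) <= d'%:E * (beta%:E * W))%E.
  by move=> d0 dd' W0; rewrite !muleA -!EFinM lee_wpmul2r// lee_fin mulrC.
have [Yoo|Yfin] := eqVneq Y +oo%E.
  rewrite [X in (_ <= _ + X)%E](_ : _ = +oo%E); last first.
    by rewrite Yoo gt0_muley ?lte_fin// gt0_muley// lte_fin mulr_gt0.
  have t0 : (0 <= (c2 / r ^+ 2)%:E * (beta%:E * X))%E.
    by rewrite mule_ge0 ?lee_fin ?divr_ge0 ?(ltW c20) ?(ltW r20)// mule_ge0// lee_fin ltW.
  by rewrite addey ?leey//; apply: contraTneq t0 => ->.
have {}main : (I <= (c / r ^+ 2)%:E * X + (r ^+ 2 * c)%:E * Y)%E.
  apply: le_trans (main _) _; first by rewrite lt_neqAle Yfin leey.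
  apply: leeD; apply: lee_wpmul2r => //; rewrite lee_fin.
    by rewrite ler_wpM2r// invr_ge0 ltW.
  by rewrite ler_wpM2l// ltW.
apply: le_trans (lee_wpmul2l (_ : (0 <= alpha%:E)%E) main) _; first by rewrite lee_fin ltW.
rewrite ge0_muleDr; last 2 first.
- by rewrite mule_ge0// lee_fin divr_ge0// ltW.
- by rewrite mule_ge0// lee_fin mulr_ge0// ltW.
apply: leeD; apply: scale => //.
- by rewrite divr_ge0// ltW.
- by rewrite mulrAC [leRHS]mulrAC ler_wpM2r// invr_ge0 ltW.
- by rewrite mulr_ge0// ltW.
- by rewrite -[leLHS]mulrA -[leRHS]mulrA; apply: ler_wpM2l ab; exact: ltW.
Qed.

Theorem corollary4p4 (R : realType) (m n : nat) (K C L : R) :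
  (0 < m)%N -> (0 < n)%N -> 0 < C ->
  exists2 C2 : R, 0 < C2 &
  forall (Psi : 'M[R]_(m + n) -> R) (p : \bar R) (Omega : set 'cV[R]_m)
         (u : 'cV[R]_m -> 'cV[R]_n)
         (H : 'cV[R]_(m + n) -> 'cV[R]_(m + n)),
    C2_grass m Psi -> (forall T, grass m T -> 0 < Psi T) ->
    C2_norm m Psi = K%:E ->
    usac C Psi ->
    (m%:R%:E < p)%E ->
    open Omega -> bounded_set Omega ->
    lip_const Omega u = L%:E ->
    has_mean_curvature Psi p Omega u H ->
    let k := 2 * (1 + L) in
    forall (A : 'M[R]_(n, m)) (x0 : 'cV[R]_m) (r : R),
      ((frob A)%:E <= 2%:E * ess_sup_grad Omega u)%E ->
      Omega x0 -> 0 < r -> eball x0 (k * r) `<=` Omega ->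
      (ball_avg x0 r (fun x => frob (jac u x - A) ^+ 2)%R <=
       (C2 / r ^+ 2)%:E *
         ball_avg x0 (k * r) (fun x =>
           frob (u x - ball_mean x0 (k * r) u - A *m (x - x0)) ^+ 2)%R +
       (r ^+ 2 * C2)%:E *
         ball_avg x0 (k * r) (fun x => frob (H (col_mx x (u x))) ^+ 2)%R)%E.
Proof.
move=> m0 n0 C0.
(* [ell] is the maximum-norm Lipschitz constant given by [lip_const_le], with [|L|] because the sign
   of [L] is known only after the hypotheses; [cA] is twice the resulting bound on the gradient. *)
pose ell := (`|L| + 1) * m%:R; pose cA := 2 * ((n * m)%:R * ell).
pose C3 := energy_const m n (K + 1) C ell cA.
have ell0 : 0 <= ell by rewrite mulr_ge0.
have C30 : 0 < `|C3| + 1 by rewrite ltr_wpDl.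
have kL0 : 0 < (2 * (1 + `|L|)) ^+ m by rewrite exprn_gt0// mulr_gt0// ltr_pwDl.
(* The second factor is [k ^+ m], which bounds the ratio of the volumes of the two balls; the first
   is a positive bound for [C3]. *)
pose C2 := (`|C3| + 1) * (2 * (1 + `|L|)) ^+ m.
have C20 : 0 < C2 by rewrite mulr_gt0.
exists C2 => // Psi p Omega u H _ _ PsiK us _ oO _ uL [[mH _] curv] k A x0 r Aess Ox0 r0 BO.
have [L0 uL'] := lip_const_le uL.
have LE : `|L| = L by rewrite ger0_norm.
have uell x y : Omega x -> Omega y -> `|u x - u y| <= ell * `|x - y|.
  by move=> Ox Oy; rewrite /ell LE; exact: uL'.
have [v [vu vell]] := lipschitz_extension ell0 (ex_intro _ x0 Ox0) uell.
have uv x : Omega x -> u x = v x by move=> Ox; rewrite vu.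
have [Phi PhiK PhiPsi] := C2_norm_extension PsiK.
have AcA : frob A <= cA.
  rewrite -lee_fin; apply: le_trans Aess _; rewrite /cA EFinM lee_wpmul2l ?lee_fin//.
  exact: (ess_sup_grad_le m0 oO uv ell0 vell).
have GE : graph_on Omega u = gr v @` Omega.
  apply/seteqP; split => _ [x Ox <-]; exists x => //.
    by rewrite /gr uv.
  by rewrite /gr uv.
have k2 : 2 <= k by rewrite /k ler_peMr// lerDl.
have k0 : 0 < k by apply: lt_le_trans k2.
have kr0 : 0 < k * r by rewrite mulr_gt0.
(* The ball estimate holds for every height [y0]; the mean is inserted only here. *)
set y0 := ball_mean x0 (k * r) u.
rewrite GE in mH curv.
have main := @caccioppoli_ball R m n m0 (K + 1) C ell cA k r Phi Psi Omega u v H A x0 y0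
  C0 PhiK PhiPsi us oO uv ell0 vell AcA k2 r0 BO mH curv.
rewrite -/(energy_const m n (K + 1) C ell cA) -/C3 in main.
set B := eball x0 (k * r) in BO main *; set D := eball x0 r in main *.
have wE : (\int[lebesgue_mx R m]_(x in B) (frob (u x - y0 - A *m (x - x0)) ^+ 2)%:E =
    \int[lebesgue_mx R m]_(x in B) (frob (v x - y0 - A *m (x - x0)) ^+ 2)%:E)%E.
  by apply: eq_integral => x /set_mem Bx; rewrite uv//; exact: BO.
have HE : (\int[lebesgue_mx R m]_(x in B) (frob (H (col_mx x (u x))) ^+ 2)%:E =
    \int[lebesgue_mx R m]_(x in B) (frob (H (gr v x)) ^+ 2)%:E)%E.
  by apply: eq_integral => x /set_mem Bx; rewrite uv//; exact: BO.
rewrite /ball_avg wE HE.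
set IH := (\int[lebesgue_mx R m]_(x in B) (frob (H (gr v x)) ^+ 2)%:E)%E in main *.
set Iw := (\int[lebesgue_mx R m]_(x in B) (frob (v x - y0 - A *m (x - x0)) ^+ 2)%:E)%E in main *.
set ID := (\int[lebesgue_mx R m]_(x in D) (frob (jac u x - A) ^+ 2)%:E)%E in main *.
have IH0 : (0 <= IH)%E by apply: integral_ge0 => x _; rewrite lee_fin sqr_ge0.
have Iw0 : (0 <= Iw)%E by apply: integral_ge0 => x _; rewrite lee_fin sqr_ge0.
have lD0 : 0 < fine (lebesgue_outer D) by exact: leb_eball_gt0.
have lB0 : 0 < fine (lebesgue_outer B) by exact: leb_eball_gt0.
have lBD := leb_eball_scale m0 x0 k0 r0.
apply: (average_le C30 C20 _ _ r0 _ _ Iw0 IH0 main).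
- by rewrite invr_gt0; exact: lD0.
- by rewrite invr_gt0; exact: lB0.
- by apply: le_trans (ler_norm _) _; rewrite lerDl.
- by rewrite /C2 LE; exact: inv_scale_le (ltW C30) lD0 lB0 lBD.
Qed.
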